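(* Let $n\ge1$ be an integer. For functions in the classes $\mathcal{F}_1$, $\mathcal{F}_2$ and $\mathcal{F}_3$, the sharp $\mathcal{S}^*_{\rho,n}$-radii, respectively, are: (i) $R_{\mathcal{S}^*_{\rho,n}}(\mathcal{F}_1) = \left(\dfrac{\sqrt{4n^2 + (\sinh^{-1}(1))^2}-2n}{\sinh^{-1}(1)}\right)^{1/n}$. (ii) $R_{\mathcal{S}^*_{\rho,n}}(\mathcal{F}_2) = \left( \dfrac{\sqrt{9n^2 + 4\sinh^{-1}(1)(n + \sinh^{-1}(1))} -3n}{2(n+\sinh^{-1}(1))} \right)^{1/n}$. (iii) $R_{\mathcal{S}^*_{\rho,n}}(\mathcal{F}_3) = R_{\mathcal{S}^*_{\rho,n}}(\mathcal{F}_2)$.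
   Context: $\mathbb{D}=\{z\in\mathbb{C}:|z|<1\}$. For an integer $n\ge1$, $\mathcal{A}_n$ is the class of analytic functions $f$ on $\mathbb{D}$ of the form $f(z)=z+a_{n+1}z^{n+1}+a_{n+2}z^{n+2}+\cdots$, and $\mathcal{A}=\mathcal{A}_1$. For analytic $g,h$ on $\mathbb{D}$, $g\prec h$ (subordination) means $g=h\circ\omega$ for some analytic $\omega$ on $\mathbb{D}$ with $\omega(0)=0$ and $|\omega(z)|\le|z|$. $\sinh^{-1}(z)=\ln(z+\sqrt{1+z^2})$ is the principal branch (analytic in $\mathbb{D}$, $\sinh^{-1}(0)=0$). $\mathcal{S}^*_{\rho}=\{f\in\mathcal{A}: zf'(z)/f(z)\prec 1+\sinh^{-1}(z)\}$ and $\mathcal{S}^*_{\rho,n}=\mathcal{A}_n\cap\mathcal{S}^*_\rho$. The classes (inequalities required for all $z\in\mathbb{D}$, quotients extended to $z=0$ by the value $1$) are: $\mathcal{F}_1$: all $f\in\mathcal{A}_n$ for which there is $g\in\mathcal{A}_n$ with $\operatorname{Re}(f(z)/g(z))>0$ and $\operatorname{Re}(g(z)/z)>0$; $\mathcal{F}_2$: all $f\in\mathcal{A}_n$ for which there is $g\in\mathcal{A}_n$ with $\operatorname{Re}(f(z)/g(z))>0$ and $\operatorname{Re}(g(z)/z)>1/2$; $\mathcal{F}_3$: all $f\in\mathcal{A}_n$ for which there is $g\in\mathcal{A}_n$ with $|f(z)/g(z)-1|<1$ and $\operatorname{Re}(g(z)/z)>0$. For $G_1,G_2\subset\mathcal{A}$,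 the (sharp) $G_1$-radius $R_{G_1}(G_2)$ of $G_2$ is the greatest number $r_0\in(0,1]$ such that for every $g\in G_2$ and every $0<r\le r_0$ the function $z\mapsto r^{-1}g(rz)$ belongs to $G_1$. *)

(* Defs.v *)
(* Stdlib reals, with Coquelicot's complex numbers. *)
From Stdlib Require Import Reals.
From Coquelicot Require Import Coquelicot.

Open Scope R_scope.

(* Functions on the unit disc are total functions [C -> C]; their values
   outside the disc play no role. *)
Definition in_disc (z : C) : Prop := Cmod z < 1.

(* Analytic = complex differentiable at every point of the open disc. *)
Definition analytic_disc (f : C -> C) : Prop :=
  forall z : C, in_disc z -> @ex_derive C_AbsRing C_NormedModule f z.

(* Principal argument, in (-PI, PI]; irrelevant value at [z = 0]. *)
Definition Carg (z : C) : R :=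
  if Rle_dec 0 (Im z) then acos (Re z / Cmod z) else - acos (Re z / Cmod z).

(* Principal logarithm and principal square root (nonnegative real part),
   both with their cut along the nonpositive real axis. *)
Definition Clog (z : C) : C := (ln (Cmod z), Carg z).

Definition Csqrt (z : C) : C :=
  (sqrt (Cmod z) * cos (Carg z / 2), sqrt (Cmod z) * sin (Carg z / 2)).

Definition Casinh (z : C) : C := Clog (z + Csqrt (1 + z * z))%C.

Definition subordinate (g h : C -> C) : Prop :=
  analytic_disc g /\ analytic_disc h /\
  exists w : C -> C,
    analytic_disc w /\ w 0%C = 0%C /\
    (forall z : C, in_disc z -> Cmod (w z) <= Cmod z) /\
    (forall z : C, in_disc z -> g z = h (w z)).

(* The quotient [f / g] of two functions vanishing to the same order at [0]
   with equal leading coefficients, extended by the value [1] at [0].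

   Coquelicot sets [x / 0 = 0].  In the classes below this never admits a
   zero [z <> 0] of the denominator: each inequality fails for the quotient 0,
   and in [Sstar_rho] analyticity of [z f'(z) / f(z)], which is part of
   [subordinate], fails at a zero of [f] (a pole of the quotient). *)
Definition quot (f g : C -> C) (z : C) : C :=
  if Ceq_dec z 0%C then 1%C else (f z / g z)%C.

(* [f(z) = z + a_{n+1} z^{n+1} + a_{n+2} z^{n+2} + ...] on the disc. *)
Definition class_A (n : nat) (f : C -> C) : Prop :=
  analytic_disc f /\
  exists a : nat -> C,
    a 0%nat = 0%C /\ a 1%nat = 1%C /\
    (forall k : nat, (1 < k <= n)%nat -> a k = 0%C) /\
    (forall z : C, in_disc z -> @is_pseries C_AbsRing C_NormedModule a z (f z)).

Definition Sstar_rho (f : C -> C) : Prop :=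
  class_A 1 f /\
  subordinate (quot (fun z => z * C_derive f z)%C f)
              (fun z => 1 + Casinh z)%C.

Definition Sstar_rho_n (n : nat) (f : C -> C) : Prop :=
  class_A n f /\ Sstar_rho f.

Definition class_F1 (n : nat) (f : C -> C) : Prop :=
  class_A n f /\
  exists g : C -> C, class_A n g /\
    forall z : C, in_disc z ->
      Re (quot f g z) > 0 /\ Re (quot g (fun u => u) z) > 0.

Definition class_F2 (n : nat) (f : C -> C) : Prop :=
  class_A n f /\
  exists g : C -> C, class_A n g /\
    forall z : C, in_disc z ->
      Re (quot f g z) > 0 /\ Re (quot g (fun u => u) z) > 1 / 2.

Definition class_F3 (n : nat) (f : C -> C) : Prop :=
  class_A n f /\
  exists g : C -> C, class_A n g /\
    forall z : C, in_disc z ->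
      Cmod (quot f g z - 1)%C < 1 /\ Re (quot g (fun u => u) z) > 0.

Definition radius_admissible (G1 G2 : (C -> C) -> Prop) (r0 : R) : Prop :=
  0 < r0 <= 1 /\
  forall g : C -> C, G2 g ->
  forall r : R, 0 < r <= r0 -> G1 (fun z => / RtoC r * g (RtoC r * z))%C.

(* [r0] is the (sharp) [G1]-radius of [G2]. *)
Definition is_radius (G1 G2 : (C -> C) -> Prop) (r0 : R) : Prop :=
  radius_admissible G1 G2 r0 /\
  forall r1 : R, radius_admissible G1 G2 r1 -> r1 <= r0.

Lemma is_radius_unique (G1 G2 : (C -> C) -> Prop) (r r' : R) :
  is_radius G1 G2 r -> is_radius G1 G2 r' -> r = r'.
Proof. intros [H M] [H' M']; apply Rle_antisym; auto. Qed.

(* Main.v *)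
(** The function [f = z u] satisfies [z f'/f - 1 = z u'/u], and the hypotheses write [u] as a
    product or quotient of two functions [p = 1 + c z^n + ...] with [Re p > 0] or [Re p > 1/2].
    Such a [p] is a Moebius image of [w = z^n phi] with [|phi| <= 1], and the Schwarz-Pick
    inequality for [phi] gives [|z w'| <= n r^n (1 - |w|^2) / (1 - r^(2n))] on [|z| = r].  Hence
    [|z f'/f - 1|] is at most [4n x / (1 - x^2)], resp. [(3n x + n x^2) / (1 - x^2)], at
    [x = r^n], and the stated radii are where these bounds reach [asinh 1].  This suffices as
    [|sinh q| <= sinh |q|], so the disc [|q| < asinh 1] lies in [asinh] of the unit disc; it is
    sharp as [asinh 1] (or [- asinh 1]) is a boundary value of [asinh] attained by the extremal
    functions.

    The maximum principle is obtained without integration: at an interior maximum of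
    [|F|^2 + eps |z|^2], averaging over the four points [c + t, c + it, c - t, c - it] and a
    second order Taylor expansion give a contradiction. *)

Require Import Defs.
From Stdlib Require Import Reals Arith Lra Lia Classical ClassicalEpsilon.
From Coquelicot Require Import Coquelicot.
Open Scope R_scope.

(** Power series come only from [class_A], and quotients of such functions would call for division
    of series. The maximum principle therefore asks just for finite Taylor expansions with bounded
    remainders at each point. These [jet]s come from iterated slopes of a power series; they are
    closed under sums, products and reciprocals of nonvanishing functions, and a removable
    singularity is filled by the slope itself. The numerators of the bounds add up over the factors
    of [u]: at [x = r^n] a factor with positive real part contributes [2 n x / (1 - x^2)], one with
    real part above 1/2 contributes [n x / (1 - x)], and passing to a reciprocal only changes the
    sign of the logarithmic derivative. Subordination demands [|w(z)| <= |z|], which is stronger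
    than [|w| < 1]. The bounds grow at least linearly in [x], so for the function dilated by [r]
    they give [|q(z)| <= |z| asinh 1], and convexity of [sinh] turns this into
    [|sinh q(z)| <= |z|]. *)

(** * Neighbourhoods, local boundedness, continuity and jets *)

Definition near (c : C) (P : C -> Prop) : Prop :=
  exists d : R, 0 < d /\ forall z : C, Cmod (z - c) < d -> P z.

Lemma near_and c P Q : near c P -> near c Q -> near c (fun z => P z /\ Q z).
Proof.
  intros [d [Hd H]] [e [He K]]; exists (Rmin d e); split.
  - now apply Rmin_pos.
  - intros z Hz; split; [apply H | apply K]; eapply Rlt_le_trans; eauto;
    [apply Rmin_l | apply Rmin_r].
Qed.

Lemma near_mono c (P Q : C -> Prop) : (forall z, P z -> Q z) -> near c P -> near c Q.
Proof. intros H [d [Hd K]]; exists d; auto. Qed.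

Lemma near_all c (P : C -> Prop) : (forall z, P z) -> near c P.
Proof. intros H; exists 1; split; [lra | auto]. Qed.

Lemma near_at c P : near c P -> P c.
Proof.
  intros [d [Hd H]]; apply H.
  replace (c - c)%C with (RtoC 0) by ring; now rewrite Cmod_0.
Qed.

Lemma Cmod_triangle_sub (x y : C) : Cmod x - Cmod y <= Cmod (x - y).
Proof.
  pose proof (Cmod_triangle (x - y) y).
  replace (x - y + y)%C with x in H by ring; lra.
Qed.

Lemma Cmod_minus_sym (x y : C) : Cmod (x - y) = Cmod (y - x).
Proof. rewrite <- Cmod_opp; f_equal; ring. Qed.

Lemma near_disc c r : Cmod c < r -> near c (fun z => Cmod z < r).
Proof.
  intros H; exists (r - Cmod c); split; [lra|].
  intros z Hz; pose proof (Cmod_triangle_sub z c); lra.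
Qed.

Definition bdd_near (c : C) (g : C -> C) : Prop :=
  exists B : R, near c (fun z => Cmod (g z) <= B).

Lemma bdd_const c k : bdd_near c (fun _ => k).
Proof. exists (Cmod k); apply near_all; intros; lra. Qed.

Lemma bdd_id c : bdd_near c (fun z => z).
Proof.
  exists (Cmod c + 1); eapply near_mono, (near_disc c (Cmod c + 1)); intros; simpl in *; lra.
Qed.

Lemma bdd_plus c f g : bdd_near c f -> bdd_near c g -> bdd_near c (fun z => f z + g z)%C.
Proof.
  intros [A HA] [B HB]; exists (A + B).
  eapply near_mono, near_and; [| exact HA | exact HB]; simpl; intros z [H K].
  pose proof (Cmod_triangle (f z) (g z)); lra.
Qed.

Lemma bdd_mult c f g : bdd_near c f -> bdd_near c g -> bdd_near c (fun z => f z * g z)%C.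
Proof.
  intros [A HA] [B HB]; exists (A * B).
  eapply near_mono, near_and; [| exact HA | exact HB]; simpl; intros z [H K].
  rewrite Cmod_mult; apply Rmult_le_compat; auto using Cmod_ge_0.
Qed.

Lemma bdd_ext c f g : near c (fun z => f z = g z) -> bdd_near c f -> bdd_near c g.
Proof.
  intros E [A HA]; exists A; eapply near_mono, near_and; [| exact E | exact HA].
  simpl; intros z [H K]; congruence.
Qed.

Definition cont_at (f : C -> C) (c : C) : Prop :=
  forall eps : R, 0 < eps -> near c (fun z => Cmod (f z - f c) < eps).

Lemma cont_comp_near f c P : cont_at f c -> near (f c) P -> near c (fun z => P (f z)).
Proof.
  intros H [d [Hd K]]; eapply near_mono, (H d Hd); simpl; auto.
Qed.

Lemma cont_slope f c g : near c (fun z => f z = f c + (z - c) * g z)%C ->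
  bdd_near c g -> cont_at f c.
Proof.
  intros H [B HB] eps He.
  assert (HB0 : 0 <= B) by (generalize (near_at _ _ HB); generalize (Cmod_ge_0 (g c)); lra).
  destruct (near_and _ _ _ H HB) as [d [Hd K]].
  exists (Rmin d (eps / (B + 1))); split.
  - apply Rmin_pos; auto; apply Rdiv_lt_0_compat; lra.
  - intros z Hz; destruct (K z) as [E Bz].
    { eapply Rlt_le_trans; [exact Hz | apply Rmin_l]. }
    rewrite E; replace (f c + (z - c) * g z - f c)%C with ((z - c) * g z)%C by ring.
    rewrite Cmod_mult.
    assert (L : Cmod (z - c) < eps / (B + 1)) by (eapply Rlt_le_trans; [exact Hz | apply Rmin_r]).
    apply Rle_lt_trans with (Cmod (z - c) * (B + 1)).
    + apply Rmult_le_compat_l; [apply Cmod_ge_0 | lra].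
    + apply Rmult_lt_reg_r with (/ (B + 1)); [apply Rinv_0_lt_compat; lra|].
      rewrite Rmult_assoc, Rinv_r; lra.
Qed.

Lemma near_neq0 f c : cont_at f c -> f c <> 0%C ->
  near c (fun z => Cmod (f c) / 2 < Cmod (f z)).
Proof.
  intros H N; apply Cmod_gt_0 in N.
  eapply near_mono, (H (Cmod (f c) / 2)); [|lra]; simpl; intros z Hz.
  rewrite Cmod_minus_sym in Hz; pose proof (Cmod_triangle_sub (f c) (f z)); lra.
Qed.

Lemma bdd_inv f c : cont_at f c -> f c <> 0%C -> bdd_near c (fun z => / f z)%C.
Proof.
  intros H N; exists (/ (Cmod (f c) / 2)).
  pose proof N as N'; apply Cmod_gt_0 in N'.
  eapply near_mono, (near_neq0 f c H N); simpl; intros z Hz.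
  rewrite Cmod_inv; [| apply Cmod_gt_0; lra].
  apply Rinv_le_contravar; lra.
Qed.

(* [jet k f c]: Taylor expansion of order [k] with a bounded remainder, given by iterated slopes. *)
Fixpoint jet (k : nat) (f : C -> C) (c : C) : Prop :=
  match k with
  | O => bdd_near c f
  | S k => exists g, near c (fun z => f z = f c + (z - c) * g z)%C /\ jet k g c
  end.

(** Both conclusions go through one induction: boundedness of [f] rests on boundedness of its slope
    [g], which is itself only known through a jet of lower order. *)
Lemma jet_S_bdd k f c : jet (S k) f c -> bdd_near c f /\ jet k f c.
Proof.
  revert f; induction k; intros f [g [E J]].
  - assert (bdd_near c f); [|simpl; auto].
    apply bdd_ext with (fun z => f c + (z - c) * g z)%C.
    { eapply near_mono, E; auto. }
    apply bdd_plus; [apply bdd_const | apply bdd_mult; [|exact J]].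
    apply (bdd_plus c (fun z => z) (fun _ => - c)%C); [apply bdd_id | apply bdd_const].
  - destruct (IHk g J) as [B J']; split.
    + apply bdd_ext with (fun z => f c + (z - c) * g z)%C.
      { eapply near_mono, E; auto. }
      apply bdd_plus; [apply bdd_const | apply bdd_mult; [|exact B]].
      apply (bdd_plus c (fun z => z) (fun _ => - c)%C); [apply bdd_id | apply bdd_const].
    + exists g; auto.
Qed.

Lemma jet_bdd k f c : jet k f c -> bdd_near c f.
Proof. destruct k; [auto | intros; eapply jet_S_bdd; eauto]. Qed.

Lemma jet_pred k f c : jet (S k) f c -> jet k f c.
Proof. intros; eapply jet_S_bdd; eauto. Qed.

Lemma jet_cont k f c : jet (S k) f c -> cont_at f c.
Proof. intros [g [E J]]; eapply cont_slope; eauto using jet_bdd. Qed.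

Lemma jet_ext k f g c : near c (fun z => f z = g z) -> jet k f c -> jet k g c.
Proof.
  destruct k; simpl; [apply bdd_ext|].
  intros H [h [E J]]; exists h; split; auto.
  pose proof (near_at _ _ H) as Hc; simpl in Hc.
  eapply near_mono, near_and; [| exact H | exact E]; simpl; intros z [A B]; congruence.
Qed.

Lemma jet_const k a c : jet k (fun _ => a) c.
Proof.
  revert a; induction k; intros a; [apply bdd_const|].
  exists (fun _ => RtoC 0); split; [apply near_all; intros; ring | auto].
Qed.

Lemma jet_id k c : jet k (fun z => z) c.
Proof.
  destruct k; [apply bdd_id|].
  exists (fun _ => RtoC 1); split; [apply near_all; intros; ring | apply jet_const].
Qed.

Lemma jet_plus k f g c : jet k f c -> jet k g c -> jet k (fun z => f z + g z)%C c.
Proof.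
  revert f g; induction k; intros f g; [apply bdd_plus|].
  intros [f1 [E F]] [g1 [E' G]]; exists (fun z => f1 z + g1 z)%C; split; auto.
  eapply near_mono, near_and; [| exact E | exact E']; simpl; intros z [A B].
  rewrite A, B; ring.
Qed.

(** The slope of a product is [f1 g + f(c) g1]. It contains [g] itself, one order below what is
    assumed of it, hence [jet_pred]. *)
Lemma jet_mult k f g c : jet k f c -> jet k g c -> jet k (fun z => f z * g z)%C c.
Proof.
  revert f g; induction k; intros f g; [apply bdd_mult|].
  intros [f1 [E F]] Hg; pose proof (jet_pred _ _ _ Hg) as Hg'.
  destruct Hg as [g1 [E' G]].
  exists (fun z => f1 z * g z + f c * g1 z)%C; split.
  - eapply near_mono, near_and; [| exact E | exact E']; simpl; intros z [A B].
    rewrite A, B; ring.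
  - apply jet_plus; auto; apply IHk; auto; apply jet_const.
Qed.

(** The slope of [1 / f] is [- g / (f(c) f)], which contains [1 / f] again at one order less; so the
    order is climbed step by step from boundedness. Order at least 1 provides the continuity that
    keeps [f] away from 0. *)
Lemma jet_inv k f c : jet (S k) f c -> f c <> 0%C -> jet (S k) (fun z => / f z)%C c.
Proof.
  intros J N; pose proof (jet_cont _ _ _ J) as Cf.
  assert (Nz : near c (fun z => f z <> 0%C)).
  { eapply near_mono, (near_neq0 f c Cf N); simpl; intros z Hz.
    apply Cmod_gt_0; pose proof (Cmod_ge_0 (f c)); lra. }
  assert (H : forall j, jet (S j) f c -> jet j (fun z => / f z)%C c ->
    jet (S j) (fun z => / f z)%C c).
  { intros j [g [E G]] I; exists (fun z => - (/ f c) * (g z * / f z))%C; split.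
    - eapply near_mono, near_and; [| exact E | exact Nz]; simpl; intros z [A B].
      assert (A' : ((z - c) * g z = f z - f c)%C) by (rewrite A; ring).
      replace ((z - c) * (- / f c * (g z * / f z)))%C
        with (- / f c * (((z - c) * g z) * / f z))%C by ring.
      rewrite A'; field; auto.
    - apply (jet_mult j (fun _ => - / f c)%C); [apply jet_const | apply jet_mult; auto]. }
  assert (D : forall j, (j <= k)%nat -> jet (S j) f c).
  { clear - J; induction k; intros j Hj.
    - replace j with 0%nat by lia; auto.
    - destruct (Nat.eq_dec j (S k)) as [->|]; auto.
      apply IHk; [now apply jet_pred | lia]. }
  assert (K : forall j, (j <= k)%nat -> jet (S j) (fun z => / f z)%C c).
  { induction j; intros Hj.
    - apply H; auto; now apply bdd_inv.
    - apply H; auto; apply IHj; lia. }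
  auto.
Qed.

Lemma jet_pow k f c m : jet k f c -> jet k (fun z => f z ^ m)%C c.
Proof.
  intros H; induction m; [exact (jet_const k 1 c)|].
  apply jet_ext with (fun z => f z * f z ^ m)%C; [| now apply jet_mult].
  apply near_all; intros; now rewrite Cpow_S.
Qed.

(** * Derivatives *)

(** Stronger than differentiability: the second-order remainder is bounded. Sums, products,
    compositions and inverses then reduce to algebra on slopes, without limits. *)
Definition has_der (f : C -> C) (c l : C) : Prop :=
  exists g, near c (fun z => f z = f c + (z - c) * (l + (z - c) * g z))%C /\ bdd_near c g.

Lemma has_der_jet f c l : has_der f c l <->
  exists h, h c = l /\ near c (fun z => f z = f c + (z - c) * h z)%C /\ jet 1 h c.
Proof.
  split.
  - intros [g [E B]]; exists (fun z => l + (z - c) * g z)%C; split; [ring|split; auto].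
    exists g; split; auto; apply near_all; intros; ring.
  - intros [h [<- [E [g [E' B]]]]]; exists g; split; auto.
    eapply near_mono, near_and; [| exact E | exact E']; simpl; intros z [A A'].
    rewrite A, A' at 1; reflexivity.
Qed.

Lemma has_der_jet2 f c l : has_der f c l -> jet 2 f c.
Proof. intros H; apply has_der_jet in H; destruct H as [h [_ [E J]]]; exists h; auto. Qed.

Lemma has_der_cont f c l : has_der f c l -> cont_at f c.
Proof. intros H; eapply jet_cont, has_der_jet2; eauto. Qed.

Lemma has_der_is_derive f c l : has_der f c l -> @is_derive C_AbsRing C_NormedModule f c l.
Proof.
  intros [g [E [B HB]]]; split.
  - apply (is_linear_scal_l (K := C_AbsRing) (V := C_NormedModule)).
  - intros x Hx.
    apply (@is_filter_lim_locally_unique C_AbsRing (AbsRing_NormedModule C_AbsRing)) in Hx.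
    rewrite <- Hx; clear x Hx.
    intros eps.
    assert (HB0 : 0 <= B) by (generalize (near_at _ _ HB); generalize (Cmod_ge_0 (g c)); lra).
    destruct (near_and _ _ _ E HB) as [d [Hd K]].
    assert (P : 0 < Rmin d (eps / (B + 1))).
    { apply Rmin_pos; auto; apply Rdiv_lt_0_compat; [apply cond_pos | lra]. }
    exists (mkposreal _ P); intros z Hz.
    change (Cmod (z - c) < Rmin d (eps / (B + 1))) in Hz.
    destruct (K z) as [Ez Bz].
    { eapply Rlt_le_trans; [exact Hz | apply Rmin_l]. }
    assert (L : Cmod (z - c) < eps / (B + 1)) by (eapply Rlt_le_trans; [exact Hz | apply Rmin_r]).
    change (Cmod (f z - f c - (z - c) * l) <= eps * Cmod (z - c)).
    rewrite Ez; replace (f c + (z - c) * (l + (z - c) * g z) - f c - (z - c) * l)%C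
      with ((z - c) * ((z - c) * g z))%C by ring.
    rewrite !Cmod_mult, (Rmult_comm eps); apply Rmult_le_compat_l; [apply Cmod_ge_0|].
    apply Rle_trans with (Cmod (z - c) * (B + 1)).
    + apply Rmult_le_compat_l; [apply Cmod_ge_0 | lra].
    + apply Rmult_le_reg_r with (/ (B + 1)); [apply Rinv_0_lt_compat; lra|].
      rewrite Rmult_assoc, Rinv_r; lra.
Qed.

Lemma has_der_C_derive f c l : has_der f c l -> C_derive f c = l.
Proof. intros H; apply is_C_derive_unique; now apply has_der_is_derive. Qed.

Lemma has_der_unique f c l l' : has_der f c l -> has_der f c l' -> l = l'.
Proof. intros H K; rewrite <- (has_der_C_derive _ _ _ H); now apply has_der_C_derive. Qed.

Lemma has_der_ext f g c l : near c (fun z => f z = g z) -> has_der f c l -> has_der g c l.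
Proof.
  intros H [h [E J]]; exists h; split; auto.
  pose proof (near_at _ _ H) as Hc; simpl in Hc.
  eapply near_mono, near_and; [| exact H | exact E]; simpl; intros z [A B]; congruence.
Qed.

Lemma has_der_const a c : has_der (fun _ => a) c 0.
Proof. exists (fun _ => RtoC 0); split; [apply near_all; intros; ring | apply bdd_const]. Qed.

Lemma has_der_id c : has_der (fun z => z) c 1.
Proof. exists (fun _ => RtoC 0); split; [apply near_all; intros; ring | apply bdd_const]. Qed.

Lemma has_der_plus f g c l m : has_der f c l -> has_der g c m ->
  has_der (fun z => f z + g z)%C c (l + m).
Proof.
  intros [f1 [E F]] [g1 [E' G]]; exists (fun z => f1 z + g1 z)%C; split.
  - eapply near_mono, near_and; [| exact E | exact E']; simpl; intros z [A B].
    rewrite A, B; ring.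
  - now apply bdd_plus.
Qed.

Lemma has_der_mult f g c l m : has_der f c l -> has_der g c m ->
  has_der (fun z => f z * g z)%C c (l * g c + f c * m).
Proof.
  rewrite !has_der_jet; intros [f1 [<- [E F]]] [g1 [<- [E' G]]].
  exists (fun z => f1 z * g z + f c * g1 z)%C; repeat split.
  - eapply near_mono, near_and; [| exact E | exact E']; simpl; intros z [A B].
    rewrite A, B; ring.
  - apply jet_plus; apply jet_mult; auto; [| apply jet_const].
    apply jet_pred; exists g1; auto.
Qed.

Lemma has_der_comp f g c l m : has_der f (g c) l -> has_der g c m ->
  has_der (fun z => f (g z)) c (l * m).
Proof.
  intros [f2 [E F]] Hg; pose proof (has_der_cont _ _ _ Hg) as Cg.
  pose proof (has_der_jet2 _ _ _ Hg) as J.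
  apply has_der_jet in Hg; destruct Hg as [g1 [<- [E' G]]].
  apply has_der_jet.
  exists (fun z => (l + (g z - g c) * f2 (g z)) * g1 z)%C; split; [ring|split].
  - eapply near_mono, near_and; [| exact (cont_comp_near _ _ _ Cg E) | exact E'].
    simpl; intros z [A B]; rewrite A.
    replace (f (g c) + (z - c) * ((l + (g z - g c) * f2 (g z)) * g1 z))%C
      with (f (g c) + ((z - c) * g1 z) * (l + (g z - g c) * f2 (g z)))%C by ring.
    replace ((z - c) * g1 z)%C with (g z - g c)%C by (rewrite B; ring); reflexivity.
  - apply jet_mult; auto.
    exists (fun z => g1 z * f2 (g z))%C; split.
    + eapply near_mono, E'; simpl; intros z B; rewrite B at 1; ring.
    + apply bdd_mult; [eapply jet_bdd; eauto|].
      destruct F as [B HB]; exists B; exact (cont_comp_near _ _ _ Cg HB).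
Qed.

Lemma has_der_inv f c l : has_der f c l -> f c <> 0%C ->
  has_der (fun z => / f z)%C c (- l / (f c * f c)).
Proof.
  intros H N; pose proof (has_der_jet2 _ _ _ H) as J.
  pose proof (jet_inv 1 f c J N) as I.
  pose proof (has_der_cont _ _ _ H) as Cf.
  assert (Nz : near c (fun z => f z <> 0%C)).
  { eapply near_mono, (near_neq0 f c Cf N); simpl; intros z Hz.
    apply Cmod_gt_0; pose proof (Cmod_ge_0 (f c)); lra. }
  apply has_der_jet in H; destruct H as [g [<- [E G]]].
  apply has_der_jet; exists (fun z => - / f c * (g z * / f z))%C; repeat split.
  - field; auto.
  - eapply near_mono, near_and; [| exact E | exact Nz]; simpl; intros z [A B].
    assert (A' : ((z - c) * g z = f z - f c)%C) by (rewrite A; ring).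
    replace ((z - c) * (- / f c * (g z * / f z)))%C
      with (- / f c * (((z - c) * g z) * / f z))%C by ring.
    rewrite A'; field; auto.
  - apply (jet_mult 1 (fun _ => - / f c)%C); [apply jet_const | apply jet_mult; auto].
    now apply jet_pred.
Qed.

Lemma has_der_div f g c l m : has_der f c l -> has_der g c m -> g c <> 0%C ->
  has_der (fun z => f z / g z)%C c ((l * g c - f c * m) / (g c * g c)).
Proof.
  intros Hf Hg N; pose proof (has_der_mult _ _ _ _ _ Hf (has_der_inv _ _ _ Hg N)) as H.
  replace ((l * g c - f c * m) / (g c * g c))%C
    with (l * / g c + f c * (- m / (g c * g c)))%C by (field; auto).
  exact H.
Qed.

Lemma has_der_pow c m : has_der (fun z => z ^ S m)%C c (INR (S m) * c ^ m).
Proof.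
  induction m.
  - replace (INR 1 * c ^ 0)%C with (RtoC 1) by (simpl; ring).
    eapply has_der_ext, has_der_id; apply near_all; intros; rewrite Cpow_1_r; auto.
  - pose proof (has_der_mult _ _ _ _ _ (has_der_id c) IHm) as H.
    replace (INR (S (S m)) * c ^ S m)%C
      with (1 * c ^ S m + c * (INR (S m) * c ^ m))%C.
    + eapply has_der_ext, H; apply near_all; intros; now rewrite <- Cpow_S.
    + rewrite (S_INR (S m)), RtoC_plus, !Cpow_S; ring.
Qed.

(** If [s] is the slope of [f] at [w = g(c)], then [f(g z) = z] reads [z - c = (g z - w) s(g z)].
    Continuity of [g] keeps [s(g z)] near [l], away from 0, so [1 / s(g z)] is a slope of [g]. This
    differentiates [Casinh] from its continuity alone. *)
Lemma has_der_right_inverse f g c l : cont_at g c -> has_der f (g c) l -> l <> 0%C ->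
  near c (fun z => f (g z) = z) -> has_der g c (/ l).
Proof.
  intros Cg [t [E T]] N R.
  set (w := g c) in *.
  set (s := fun x => (l + (x - w) * t x)%C).
  assert (Sw : s w = l) by (unfold s; ring).
  assert (Cs : cont_at s w).
  { apply cont_slope with t; auto; apply near_all; intros; unfold s; ring. }
  assert (Sg : cont_at (fun z => s (g z)) c).
  { intros eps He; apply (cont_comp_near g c (fun x => Cmod (s x - s w) < eps) Cg), Cs, He. }
  assert (Rc : f w = c) by apply (near_at _ _ R).
  assert (Nz : near c (fun z => s (g z) <> 0%C)).
  { eapply near_mono, (near_neq0 (fun z => s (g z)) c Sg); simpl.
    - intros z Hz; apply Cmod_gt_0; pose proof (Cmod_ge_0 (s (g c))); lra.
    - fold w; now rewrite Sw. }
  assert (Eg : near c (fun z => g z = w + (z - c) * / s (g z))%C).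
  { eapply near_mono, near_and; [| exact (near_and _ _ _ R Nz) | exact (cont_comp_near _ _ _ Cg E)].
    simpl; intros z [[A B] D]; rewrite A, Rc in D; fold (s (g z)) in D.
    assert (D' : (z - c = (g z - w) * s (g z))%C).
    { transitivity (c + (g z - w) * s (g z) - c)%C; [f_equal; exact D | ring]. }
    rewrite D'; field; auto. }
  assert (Bi : bdd_near c (fun z => / s (g z))%C).
  { apply (bdd_inv (fun z => s (g z)) c Sg); fold w; now rewrite Sw. }
  apply has_der_jet; exists (fun z => / s (g z))%C; repeat split; auto.
  - fold w; now rewrite Sw.
  - exists (fun z => - / l * (t (g z) * / s (g z) * / s (g z)))%C; split.
    + eapply near_mono, near_and; [| exact Nz | exact Eg]; simpl; intros z [A B].
      fold w; rewrite Sw.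
      assert (K : (s (g z) - l = (z - c) * / s (g z) * t (g z))%C).
      { unfold s at 1.
        replace ((z - c) * / s (g z))%C with (g z - w)%C; [ring|].
        transitivity (w + (z - c) * / s (g z) - w)%C; [f_equal; exact B | ring]. }
      replace ((z - c) * (- / l * (t (g z) * / s (g z) * / s (g z))))%C
        with (- / l * ((z - c) * / s (g z) * t (g z)) * / s (g z))%C by ring.
      rewrite <- K; field; auto.
    + apply bdd_mult; [apply bdd_const|]; repeat apply bdd_mult; auto.
      destruct T as [B HB]; exists B; exact (cont_comp_near _ _ _ Cg HB).
Qed.

(** * Convergence of complex sequences and partial sums *)

Definition cv (u : nat -> C) (l : C) : Prop :=
  forall eps : R, 0 < eps -> exists N, forall n, (N <= n)%nat -> Cmod (u n - l) < eps.

Lemma cv_unique u l l' : cv u l -> cv u l' -> l = l'.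
Proof.
  intros H K; apply Ceq_minus; apply Cmod_eq_0.
  destruct (Rle_lt_or_eq_dec 0 (Cmod (l - l')) (Cmod_ge_0 _)) as [P|]; auto.
  destruct (H (Cmod (l - l') / 2)) as [N HN]; [lra|].
  destruct (K (Cmod (l - l') / 2)) as [M HM]; [lra|].
  specialize (HN (N + M)%nat ltac:(lia)); specialize (HM (N + M)%nat ltac:(lia)).
  rewrite Cmod_minus_sym in HN.
  pose proof (Cmod_triangle (l - u (N + M)%nat) (u (N + M)%nat - l')).
  replace (l - u (N + M)%nat + (u (N + M)%nat - l'))%C with (l - l')%C in H0 by ring; lra.
Qed.

Lemma cv_ext u v l : (forall n, u n = v n) -> cv u l -> cv v l.
Proof.
  intros E H eps He; destruct (H eps He) as [N HN]; exists N; intros; rewrite <- E; auto.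
Qed.

Lemma cv_const a : cv (fun _ => a) a.
Proof.
  intros eps He; exists 0%nat; intros.
  replace (a - a)%C with (RtoC 0) by ring; now rewrite Cmod_0.
Qed.

Lemma cv_plus u v l m : cv u l -> cv v m -> cv (fun n => u n + v n)%C (l + m)%C.
Proof.
  intros H K eps He.
  destruct (H (eps / 2)) as [N HN]; [lra|]; destruct (K (eps / 2)) as [M HM]; [lra|].
  exists (N + M)%nat; intros n Hn.
  specialize (HN n ltac:(lia)); specialize (HM n ltac:(lia)).
  replace (u n + v n - (l + m))%C with ((u n - l) + (v n - m))%C by ring.
  pose proof (Cmod_triangle (u n - l) (v n - m)); lra.
Qed.

Lemma cv_scal a u l : cv u l -> cv (fun n => a * u n)%C (a * l)%C.
Proof.
  intros H eps He.
  destruct (H (eps / (Cmod a + 1))) as [N HN].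
  { apply Rdiv_lt_0_compat; auto; pose proof (Cmod_ge_0 a); lra. }
  exists N; intros n Hn; specialize (HN n Hn).
  replace (a * u n - a * l)%C with (a * (u n - l))%C by ring; rewrite Cmod_mult.
  pose proof (Cmod_ge_0 a).
  apply Rle_lt_trans with ((Cmod a + 1) * Cmod (u n - l)).
  - apply Rmult_le_compat_r; [apply Cmod_ge_0 | lra].
  - apply Rmult_lt_reg_r with (/ (Cmod a + 1)); [apply Rinv_0_lt_compat; lra|].
    replace ((Cmod a + 1) * Cmod (u n - l) * / (Cmod a + 1)) with (Cmod (u n - l)); auto.
    field; lra.
Qed.

Lemma cv_shift u l m : cv (fun n => u (m + n)%nat) l <-> cv u l.
Proof.
  split; intros H eps He; destruct (H eps He) as [N HN].
  - exists (m + N)%nat; intros n Hn; replace n with (m + (n - m))%nat by lia; apply HN; lia.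
  - exists N; intros; apply HN; lia.
Qed.

Lemma cv_bound u l B : cv u l -> (forall n, Cmod (u n) <= B) -> Cmod l <= B.
Proof.
  intros H K; apply le_epsilon; intros eps He.
  destruct (H eps He) as [N HN]; specialize (HN N (le_n N)); specialize (K N).
  rewrite Cmod_minus_sym in HN; pose proof (Cmod_triangle_sub l (u N)); lra.
Qed.

Lemma cv_dominated u (v : nat -> R) : (forall n, Cmod (u n) <= v n) -> is_lim_seq v 0 -> cv u 0%C.
Proof.
  intros H K eps He; apply is_lim_seq_spec in K; destruct (K (mkposreal _ He)) as [N HN].
  exists N; intros n Hn; specialize (HN n Hn); specialize (H n); simpl in HN.
  replace (u n - 0)%C with (u n) by ring.
  rewrite Rminus_0_r in HN; pose proof (Rle_abs (v n)); lra.
Qed.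

(** Empty at 0, with [n] terms at [n], so that [psum_shift] splits without correction; [sum_n] at
    [n] has one term more, which accounts for the shifts by 1 below. *)
Fixpoint psum (a : nat -> C) (z : C) (n : nat) : C :=
  match n with O => 0%C | S m => (psum a z m + a m * z ^ m)%C end.

Lemma pow_n_Cpow (z : C) k : @pow_n C_Ring z k = (z ^ k)%C.
Proof. induction k; [reflexivity|]; rewrite Cpow_S, <- IHk; reflexivity. Qed.

Lemma is_pseries_cv a z l : @is_pseries C_AbsRing C_NormedModule a z l <-> cv (psum a z) l.
Proof.
  assert (E : forall n, sum_n (fun k => scal (pow_n z k) (a k) : C_NormedModule) n
                        = psum a z (S n)).
  { induction n.
    - rewrite sum_O; change (pow_n z 0 * a 0%nat = 0 + a 0%nat * z ^ 0)%C.
      rewrite pow_n_Cpow; ring.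
    - rewrite sum_Sn, IHn.
      change (psum a z (S n) + pow_n z (S n) * a (S n)
              = psum a z (S n) + a (S n) * z ^ S n)%C.
      rewrite pow_n_Cpow; ring. }
  rewrite <- (cv_shift _ _ 1); unfold is_pseries, is_series; split.
  - intros H eps He.
    apply filterlim_locally_ball_norm with (eps := mkposreal _ He) in H.
    destruct H as [N HN]; exists N; intros n Hn; specialize (HN n Hn).
    rewrite E in HN; exact HN.
  - intros H; apply filterlim_locally_ball_norm; intros eps.
    destruct (H eps (cond_pos eps)) as [N HN]; exists N; intros n Hn.
    specialize (HN n Hn); rewrite E; exact HN.
Qed.

(** * Power series converging on the unit disc *)

(** Radius of convergence at least 1, stated as a growth bound on the coefficients, since this form
    passes directly to tails, derivatives and slopes. *)
Definition disc_coeffs (a : nat -> C) : Prop :=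
  forall s : R, 0 < s < 1 -> exists M, forall k, Cmod (a k) * s ^ k <= M.

(** One expansion about 0 valid on the whole disc, which is what [class_A] supplies. *)
Definition hol (F : C -> C) : Prop :=
  exists a : nat -> C, forall z, in_disc z -> @is_pseries C_AbsRing C_NormedModule a z (F z).

Lemma coeffs_of_cv a : (forall z, in_disc z -> exists l, cv (psum a z) l) -> disc_coeffs a.
Proof.
  intros H s Hs; destruct (H (RtoC s)) as [l Hl].
  { unfold in_disc; rewrite Cmod_R, Rabs_pos_eq; lra. }
  destruct (Hl 1 Rlt_0_1) as [N HN].
  assert (L : forall k, (N <= k)%nat -> Cmod (a k) * s ^ k <= 2).
  { intros k Hk; pose proof (HN k Hk) as A; pose proof (HN (S k) ltac:(lia)) as B.
    (* A term is the difference of consecutive partial sums, each within 1 of the limit; hence the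
       bound 2. *)
    assert (E : (a k * RtoC s ^ k = (psum a s (S k) - l) - (psum a s k - l))%C) by (simpl; ring).
    replace (Cmod (a k) * s ^ k) with (Cmod (a k * RtoC s ^ k)).
    - rewrite E; pose proof (Cmod_triangle (psum a s (S k) - l) (- (psum a s k - l))).
      rewrite Cmod_opp in H0; unfold Cminus at 1; lra.
    - rewrite Cmod_mult, Cmod_pow, Cmod_R, (Rabs_pos_eq s); [reflexivity | lra]. }
  clear HN Hl H.
  assert (P : forall m, exists M, forall k, (k < m)%nat -> Cmod (a k) * s ^ k <= M).
  { induction m as [|m [M HM]]; [exists 0; intros; lia|].
    exists (Rmax M (Cmod (a m) * s ^ m)); intros k Hk.
    destruct (Nat.eq_dec k m) as [->|]; [apply Rmax_r|].
    eapply Rle_trans; [apply HM; lia | apply Rmax_l]. }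
  destruct (P N) as [M HM]; exists (Rmax M 2); intros k.
  destruct (le_lt_dec N k).
  - eapply Rle_trans; [apply L; auto | apply Rmax_r].
  - eapply Rle_trans; [apply HM; auto | apply Rmax_l].
Qed.

Lemma ex_series_geom_scal M q : 0 <= q < 1 -> ex_series (fun k => M * q ^ k).
Proof.
  intros Hq; apply ex_series_ext with (fun k => scal M (q ^ k)); [reflexivity|].
  apply (@ex_series_scal R_AbsRing R_NormedModule M (fun k => q ^ k)), ex_series_geom; rewrite Rabs_pos_eq; lra.
Qed.

Lemma geom_partial M q (a : nat -> C) z : 0 <= q < 1 ->
  (forall k, Cmod (a k) * Cmod z ^ k <= M * q ^ k) ->
  forall n, Cmod (psum a z n) <= M / (1 - q).
Proof.
  intros Hq H n.
  assert (M0 : 0 <= M).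
  { specialize (H 0%nat); simpl in H; pose proof (Cmod_ge_0 (a 0%nat)); lra. }
  assert (K : Cmod (psum a z n) <= M * (1 - q ^ n) / (1 - q)).
  { induction n; simpl psum.
    - rewrite Cmod_0; simpl; apply Req_le; field; lra.
    - eapply Rle_trans; [apply Cmod_triangle|].
      rewrite Cmod_mult, Cmod_pow; specialize (H n).
      replace (M * (1 - q ^ S n) / (1 - q)) with (M * (1 - q ^ n) / (1 - q) + M * q ^ n)
        by (simpl; field; lra); lra. }
  eapply Rle_trans; [exact K|].
  apply Rmult_le_compat_r; [left; apply Rinv_0_lt_compat; lra|].
  rewrite <- (Rmult_1_r M) at 2; apply Rmult_le_compat_l; auto.
  pose proof (pow_le q n ltac:(lra)); lra.
Qed.

Lemma cv_of_geom M q (a : nat -> C) z : 0 <= q < 1 ->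
  (forall k, Cmod (a k) * Cmod z ^ k <= M * q ^ k) ->
  exists l, cv (psum a z) l.
Proof.
  intros Hq H.
  destruct (@ex_series_le C_AbsRing C_CompleteNormedModule
    (fun k => scal (pow_n z k) (a k)) (fun k => M * q ^ k)) as [l Hl].
  - intros k; change (Cmod (pow_n z k * a k) <= M * q ^ k).
    rewrite pow_n_Cpow, Cmod_mult, Cmod_pow, Rmult_comm; auto.
  - now apply ex_series_geom_scal.
  - exists l; apply is_pseries_cv; exact Hl.
Qed.

(** An intermediate radius [s], halfway from [r] to 1, turns boundedness at [s] into geometric decay
    at [r] with ratio [r / s < 1]. *)
Lemma coeffs_geom a r : disc_coeffs a -> 0 <= r < 1 ->
  exists s M, r < s < 1 /\ 0 <= M /\ (forall k, Cmod (a k) <= M * / s ^ k) /\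
  forall k, Cmod (a k) * r ^ k <= M * (r / s) ^ k.
Proof.
  intros H Hr; exists ((1 + r) / 2); destruct (H ((1 + r) / 2)) as [M HM]; [lra|].
  assert (P : forall k, 0 < ((1 + r) / 2) ^ k) by (intros; apply pow_lt; lra).
  assert (B : forall k, Cmod (a k) <= M * / ((1 + r) / 2) ^ k).
  { intros k; apply Rmult_le_reg_r with (((1 + r) / 2) ^ k); auto.
    rewrite Rmult_assoc, Rinv_l, Rmult_1_r; auto; specialize (P k); lra. }
  exists M; split; [lra|split]; [|split]; auto.
  - eapply Rle_trans; [|apply (HM 0%nat)]; simpl; pose proof (Cmod_ge_0 (a 0%nat)); lra.
  - intros k; unfold Rdiv at 1; rewrite Rpow_mult_distr, pow_inv, (Rmult_comm (r ^ k)), <- Rmult_assoc.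
    apply Rmult_le_compat_r; [apply pow_le; lra | auto].
Qed.

Lemma div_lt_1 r s : 0 <= r < s -> 0 <= r / s < 1.
Proof.
  intros H; split.
  - apply Rmult_le_pos; [lra | left; apply Rinv_0_lt_compat; lra].
  - apply Rmult_lt_reg_r with s; [lra|]; unfold Rdiv; rewrite Rmult_assoc, Rinv_l; lra.
Qed.

Lemma coeffs_cv a z : disc_coeffs a -> in_disc z -> exists l, cv (psum a z) l.
Proof.
  intros H Hz; pose proof (Cmod_ge_0 z).
  destruct (coeffs_geom a (Cmod z) H) as [s [M [Hs [M0 [_ B]]]]]; [unfold in_disc in Hz; lra|].
  apply (cv_of_geom M (Cmod z / s)); auto; apply div_lt_1; lra.
Qed.

Lemma hol_coeffs F : hol F <-> exists a, disc_coeffs a /\ forall z, in_disc z -> cv (psum a z) (F z).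
Proof.
  split.
  - intros [a Ha]; exists a; split.
    + apply coeffs_of_cv; intros z Hz; exists (F z); now apply is_pseries_cv, Ha.
    + intros z Hz; now apply is_pseries_cv, Ha.
  - intros [a [_ Ha]]; exists a; intros z Hz; now apply is_pseries_cv, Ha.
Qed.

(** The limits are only known to exist, so the sum function is obtained by choice; outside the disc
    its value is arbitrary. *)
Lemma hol_of_coeffs a : disc_coeffs a -> exists F, hol F /\ forall z, in_disc z -> cv (psum a z) (F z).
Proof.
  intros H.
  assert (X : forall z, exists l, in_disc z -> cv (psum a z) l).
  { intros z; destruct (Rlt_dec (Cmod z) 1) as [L|L].
    - destruct (coeffs_cv a z H L) as [l Hl]; exists l; auto.
    - exists 0%C; intros K; contradiction. }
  exists (fun z => proj1_sig (constructive_indefinite_description _ (X z))).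
  assert (Y : forall z, in_disc z ->
    cv (psum a z) (proj1_sig (constructive_indefinite_description _ (X z)))).
  { intros z Hz; destruct (constructive_indefinite_description _ (X z)); auto. }
  split; auto; apply hol_coeffs; exists a; auto.
Qed.

Lemma hol_ext F G : (forall z, in_disc z -> F z = G z) -> hol F -> hol G.
Proof. intros E [a Ha]; exists a; intros z Hz; rewrite <- E; auto. Qed.

Lemma hol_const k : hol (fun _ => k).
Proof.
  exists (fun j => if Nat.eqb j 0 then k else 0%C); intros z Hz; apply is_pseries_cv.
  rewrite <- (cv_shift _ _ 1); apply cv_ext with (fun _ => k); [|apply cv_const].
  induction n; simpl in *; [ring | rewrite <- IHn; ring].
Qed.

Lemma hol_plus F G : hol F -> hol G -> hol (fun z => F z + G z)%C.
Proof.
  intros [a Ha] [b Hb]; exists (fun k => a k + b k)%C; intros z Hz; apply is_pseries_cv.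
  apply cv_ext with (fun n => psum a z n + psum b z n)%C.
  - induction n; simpl; [ring | rewrite <- IHn; ring].
  - apply cv_plus; apply is_pseries_cv; auto.
Qed.

Lemma hol_scal k F : hol F -> hol (fun z => k * F z)%C.
Proof.
  intros [a Ha]; exists (fun j => k * a j)%C; intros z Hz; apply is_pseries_cv.
  apply cv_ext with (fun n => k * psum a z n)%C.
  - induction n; simpl; [ring | rewrite <- IHn; ring].
  - apply cv_scal; apply is_pseries_cv; auto.
Qed.

Lemma psum_shift a z m n :
  psum a z (m + n) = (psum a z m + z ^ m * psum (fun k => a (m + k)%nat) z n)%C.
Proof.
  induction n; [rewrite Nat.add_0_r; simpl; ring|].
  rewrite Nat.add_succ_r; simpl; rewrite IHn, Cpow_add_r; ring.
Qed.

Lemma psum_ext a b z n : (forall k, a k = b k) -> psum a z n = psum b z n.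
Proof. intros H; induction n; simpl; auto; now rewrite IHn, H. Qed.

Lemma psum_zero (a : nat -> C) z m : (forall k, (k < m)%nat -> a k = RtoC 0) -> psum a z m = RtoC 0.
Proof.
  induction m; intros H; simpl; auto; rewrite IHm, H by (intros; try apply H; lia); ring.
Qed.

Lemma hol_monom m F : hol F -> hol (fun z => z ^ m * F z)%C.
Proof.
  intros [a Ha]; set (b := fun k => if Nat.ltb k m then RtoC 0 else a (k - m)%nat).
  exists b; intros z Hz; apply is_pseries_cv.
  rewrite <- (cv_shift _ _ m).
  apply cv_ext with (fun n => z ^ m * psum a z n)%C.
  - intros n; rewrite psum_shift.
    rewrite (psum_zero b); [|intros k Hk; unfold b; apply Nat.ltb_lt in Hk; now rewrite Hk].
    replace (psum (fun k => b (m + k)%nat) z n) with (psum a z n); [ring|].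
    induction n; simpl; auto; rewrite IHn; f_equal; f_equal; unfold b.
    replace (m + n <? m)%nat with false by (symmetry; apply Nat.ltb_ge; lia).
    f_equal; lia.
  - apply cv_scal; apply is_pseries_cv; auto.
Qed.

Lemma hol_dilate r F : 0 <= r <= 1 -> hol F -> hol (fun z => F (RtoC r * z))%C.
Proof.
  intros Hr [a Ha]; exists (fun k => a k * RtoC r ^ k)%C; intros z Hz; apply is_pseries_cv.
  apply cv_ext with (psum a (RtoC r * z)%C).
  - induction n; simpl; auto; rewrite IHn, Cpow_mult_l; ring.
  - apply is_pseries_cv, Ha; unfold in_disc in *; rewrite Cmod_mult, Cmod_R, Rabs_pos_eq; [|lra].
    pose proof (Cmod_ge_0 z); nra.
Qed.

Lemma coeffs_tail a m : disc_coeffs a -> disc_coeffs (fun k => a (m + k)%nat).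
Proof.
  intros H s Hs; destruct (H s Hs) as [M HM]; exists (M * / s ^ m); intros k.
  assert (P : 0 < s ^ m) by (apply pow_lt; lra).
  apply Rmult_le_reg_r with (s ^ m); auto.
  rewrite !Rmult_assoc, Rinv_l, Rmult_1_r by lra.
  rewrite <- pow_add, Nat.add_comm; rewrite Nat.add_comm at 1; rewrite Nat.add_comm; apply HM.
Qed.

(** Each of the [k + 1] terms of [1 + q + ... + q^k] is at least [q^k], and the whole sum is at most
    [1 / (1 - q)]. *)
Lemma pow_bernoulli q k : 0 <= q < 1 -> INR (S k) * q ^ k <= / (1 - q).
Proof.
  intros Hq; apply Rmult_le_reg_r with (1 - q); [lra|]; rewrite Rinv_l by lra.
  assert (H : INR (S k) * q ^ k * (1 - q) <= 1 - q ^ S k).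
  { induction k; [simpl; lra|].
    rewrite (S_INR (S k)); pose proof (pow_le q (S k) ltac:(lra)) as P.
    change (q ^ S (S k)) with (q * q ^ S k); change (q ^ S k) with (q * q ^ k) in *.
    assert (X : 0 <= q ^ k <= 1).
    { split; [apply pow_le; lra | rewrite <- (pow1 k); apply pow_incr; lra]. }
    set (x := q ^ k) in *; set (N := INR (S k)) in *.
    assert (0 <= (1 - q) * (1 - q * x)) by (apply Rmult_le_pos; nra).
    assert (q * (N * x * (1 - q)) <= q * (1 - q * x)) by (apply Rmult_le_compat_l; lra).
    lra. }
  pose proof (pow_le q (S k) ltac:(lra)); lra.
Qed.

Lemma lim_n_geom M q : 0 <= q < 1 -> is_lim_seq (fun n => M * (INR n * q ^ n)) 0.
Proof.
  (* Write [q^n = p^n p^n]: one factor absorbs [n] by [pow_bernoulli], the other tends to 0. *)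
  intros Hq; set (p := sqrt q).
  assert (P0 : 0 <= p) by apply sqrt_pos.
  assert (E : p * p = q) by (apply sqrt_sqrt; lra).
  assert (P1 : p < 1) by nra.
  replace (Finite 0) with (Rbar_mult M 0) by (simpl; f_equal; ring).
  apply is_lim_seq_scal_l.
  apply is_lim_seq_le_le with (fun _ => 0) (fun n => / (1 - p) * p ^ n).
  - intros n; pose proof (pow_le q n ltac:(lra)); pose proof (pos_INR n); split; [nra|].
    rewrite <- E, Rpow_mult_distr, <- Rmult_assoc; apply Rmult_le_compat_r; [apply pow_le; lra|].
    eapply Rle_trans; [|apply (pow_bernoulli p n); lra].
    apply Rmult_le_compat_r; [apply pow_le; lra | rewrite S_INR; lra].
  - apply is_lim_seq_const.
  - replace (Finite 0) with (Rbar_mult (/ (1 - p)) 0) by (simpl; f_equal; ring).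
    apply is_lim_seq_scal_l, is_lim_seq_geom; rewrite Rabs_pos_eq; lra.
Qed.

Lemma lim_geom_scal M q : 0 <= q < 1 -> is_lim_seq (fun n => M * q ^ n) 0.
Proof.
  intros Hq; replace (Finite 0) with (Rbar_mult M 0) by (simpl; f_equal; ring).
  apply is_lim_seq_scal_l, is_lim_seq_geom; rewrite Rabs_pos_eq; lra.
Qed.

Lemma coeffs_der a : disc_coeffs a -> disc_coeffs (fun k => INR (S k) * a (S k))%C.
Proof.
  intros H s Hs; set (t := (1 + s) / 2); assert (Ht : s < t < 1) by (unfold t; lra).
  destruct (coeffs_tail a 1 H t) as [M HM]; [lra|].
  exists (M * / (1 - s / t)); intros k; specialize (HM k).
  rewrite Cmod_mult, Cmod_R, Rabs_pos_eq by apply pos_INR.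
  pose proof (div_lt_1 s t ltac:(lra)) as D.
  assert (E : s ^ k = t ^ k * (s / t) ^ k).
  { rewrite <- Rpow_mult_distr; f_equal; field; lra. }
  rewrite E.
  replace (INR (S k) * Cmod (a (S k)) * (t ^ k * (s / t) ^ k))
    with ((Cmod (a (S k)) * t ^ k) * (INR (S k) * (s / t) ^ k)) by ring.
  apply Rmult_le_compat; auto.
  - apply Rmult_le_pos; [apply Cmod_ge_0 | apply pow_le; lra].
  - apply Rmult_le_pos; [apply pos_INR | apply pow_le; lra].
  - now apply pow_bernoulli.
Qed.

(* With [t j = sum_k a_(j+k) c^k] one has [t j = a_j + c t (j+1)], so that
   [(z - c) sum_(j<N) t (j+1) z^j] telescopes to the partial sum of [F z - F c]. *)
Lemma hol_slope_coeffs a c : disc_coeffs a -> in_disc c -> exists t : nat -> C,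
  cv (psum a c) (t 0%nat) /\ (forall j, t j = a j + c * t (S j))%C /\
  disc_coeffs (fun j => t (S j)).
Proof.
  intros H Hc.
  assert (X : forall j, exists l, cv (psum (fun k => a (j + k)%nat) c) l).
  { intros j; apply coeffs_cv; auto; now apply coeffs_tail. }
  set (t := fun j => proj1_sig (constructive_indefinite_description _ (X j))).
  assert (T : forall j, cv (psum (fun k => a (j + k)%nat) c) (t j)).
  { intros j; unfold t; destruct (constructive_indefinite_description _ (X j)); auto. }
  exists t; split; [exact (T 0%nat)|split].
  - intros j; apply cv_unique with (psum (fun k => a (j + k)%nat) c); auto.
    rewrite <- (cv_shift _ _ 1).
    apply cv_ext with (fun n => a j + c * psum (fun k => a (S j + k)%nat) c n)%C.
    + intros n; rewrite psum_shift; rewrite Cpow_1_r.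
      replace (psum (fun k => a (j + k)%nat) c 1) with (a j).
      * f_equal; f_equal; apply psum_ext; intros; f_equal; lia.
      * simpl; rewrite Nat.add_0_r; ring.
    + apply cv_plus; [apply cv_const | apply cv_scal, T].
  - intros s0 Hs0; pose proof (Cmod_ge_0 c) as Cc; unfold in_disc in Hc.
    (* The radius [s] found beyond [r] then exceeds both [|c|], so that the tails at [c] are summed
       geometrically, and [s0], where the new coefficients are tested. *)
    set (r := Rmax (Cmod c) s0).
    assert (Hr : 0 < r < 1 /\ Cmod c <= r /\ s0 <= r).
    { unfold r, Rmax; destruct Rle_dec; lra. }
    destruct (coeffs_geom a r H) as [s [M [Hs [M0 [B _]]]]]; [lra|].
    assert (D : 0 <= Cmod c / s < 1) by (apply div_lt_1; lra).
    exists (M / (1 - Cmod c / s) * / s); intros j.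
    assert (Ps : forall i, 0 < s ^ i) by (intros; apply pow_lt; lra).
    assert (Bt : Cmod (t (S j)) <= (M * / s ^ S j) / (1 - Cmod c / s)).
    { apply (cv_bound _ _ _ (T (S j))); apply geom_partial; auto; intros k.
      replace (M * / s ^ S j * (Cmod c / s) ^ k) with (M * / s ^ (S j + k) * Cmod c ^ k).
      - apply Rmult_le_compat_r; [now apply pow_le | apply B].
      - unfold Rdiv; rewrite Rpow_mult_distr, pow_inv, pow_add; field.
        split; apply Rgt_not_eq, Ps. }
    assert (0 < 1 - Cmod c / s) by lra.
    assert (s0 ^ j <= s ^ j) by (apply pow_incr; lra).
    apply Rle_trans with ((M * / s ^ S j) / (1 - Cmod c / s) * s ^ j).
    + apply Rmult_le_compat; auto using Cmod_ge_0; apply pow_le; lra.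
    + simpl; apply Req_le; field; repeat split; try lra; apply Rgt_not_eq, Ps.
Qed.

Lemma coeffs_pow_to_0 b z : disc_coeffs b -> in_disc z -> cv (fun n => b n * z ^ S n)%C 0%C.
Proof.
  intros H Hz; unfold in_disc in Hz; pose proof (Cmod_ge_0 z).
  destruct (coeffs_geom b (Cmod z) H) as [s [M [Hs [M0 [_ B]]]]]; [lra|].
  apply cv_dominated with (fun n => M * (Cmod z / s) ^ n).
  - intros n; rewrite Cmod_mult, Cmod_pow; simpl; eapply Rle_trans; [|apply B].
    apply Rmult_le_compat_l; [apply Cmod_ge_0|].
    rewrite <- (Rmult_1_l (Cmod z ^ n)) at 2; apply Rmult_le_compat_r; [apply pow_le|]; lra.
  - apply lim_geom_scal, div_lt_1; lra.
Qed.

Lemma coeffs_npow_to_0 b z : disc_coeffs b -> in_disc z ->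
  cv (fun n => INR n * b n * z ^ n)%C 0%C.
Proof.
  intros H Hz; unfold in_disc in Hz; pose proof (Cmod_ge_0 z).
  destruct (coeffs_geom b (Cmod z) H) as [s [M [Hs [M0 [_ B]]]]]; [lra|].
  apply cv_dominated with (fun n => M * (INR n * (Cmod z / s) ^ n)).
  - intros n; rewrite !Cmod_mult, Cmod_pow, Cmod_R, Rabs_pos_eq by apply pos_INR.
    specialize (B n); pose proof (pos_INR n); nra.
  - apply lim_n_geom, div_lt_1; lra.
Qed.

(** Slopes of a power series are again power series, so slopes can be taken repeatedly; this is the
    source of all jets. The function [F'] is chosen before [c], so that the derivative itself is a
    power series. The equality [G c = F' c] is Abel summation, whose boundary term [n t_(n+1) c^n]
    tends to 0. *)
Lemma hol_slope F : hol F -> exists F', hol F' /\ forall c, in_disc c ->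
  exists G, hol G /\ G c = F' c /\ forall z, in_disc z -> (F z = F c + (z - c) * G z)%C.
Proof.
  intros HF; apply hol_coeffs in HF; destruct HF as [a [Ha Fa]].
  destruct (hol_of_coeffs _ (coeffs_der a Ha)) as [F' [HF' Fa']].
  exists F'; split; auto; intros c Hc.
  destruct (hol_slope_coeffs a c Ha Hc) as [t [T0 [T Dt]]].
  destruct (hol_of_coeffs _ Dt) as [G [HG Gt]].
  exists G; split; [|split]; auto.
  - apply cv_unique with (psum (fun j => t (S j)) c); auto.
    replace (F' c) with (0 + F' c)%C by ring.
    apply cv_ext with
      (fun n => INR n * t (S n) * c ^ n + psum (fun k => INR (S k) * a (S k)) c n)%C.
    + induction n; [simpl; ring|].
      cbn [psum]; rewrite <- IHn, (S_INR n), RtoC_plus, Cpow_S.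
      rewrite (T (S n)); ring.
    + apply cv_plus; auto; exact (coeffs_npow_to_0 _ _ Dt Hc).
  - intros z Hz; rewrite (cv_unique _ _ _ (Fa c Hc) T0).
    apply cv_unique with (fun n => psum a z (S n) + t (S n) * z ^ S n)%C.
    + replace (F z) with (F z + 0)%C by ring; apply cv_plus.
      * apply (cv_shift (psum a z) (F z) 1); auto.
      * exact (coeffs_pow_to_0 _ _ Dt Hz).
    + apply cv_ext with (fun n => t 0%nat + (z - c) * psum (fun j => t (S j)) z (S n))%C.
      * induction n.
        -- simpl psum; rewrite Cpow_1_r; rewrite (T 0%nat); simpl; ring.
        -- change (psum (fun j => t (S j)) z (S (S n)))
             with (psum (fun j => t (S j)) z (S n) + t (S (S n)) * z ^ S n)%C.
           change (psum a z (S (S n))) with (psum a z (S n) + a (S n) * z ^ S n)%C.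
           transitivity ((t 0%nat + (z - c) * psum (fun j => t (S j)) z (S n))
             + (z - c) * (t (S (S n)) * z ^ S n))%C; [ring|].
           rewrite IHn, (T (S n)), (Cpow_S z (S n)); ring.
      * apply cv_plus; [apply cv_const | apply cv_scal].
        apply (cv_shift (psum (fun j => t (S j)) z) (G z) 1); auto.
Qed.

Lemma hol_bdd F c : hol F -> in_disc c -> bdd_near c F.
Proof.
  intros HF Hc; apply hol_coeffs in HF; destruct HF as [a [Ha Fa]].
  pose proof (Cmod_ge_0 c); unfold in_disc in *.
  set (r := (1 + Cmod c) / 2); assert (Hr : Cmod c < r < 1) by (unfold r; lra).
  destruct (coeffs_geom a r Ha) as [s [M [Hs [M0 [_ B]]]]]; [lra|].
  exists (M / (1 - r / s)); eapply near_mono, (near_disc c r); [|lra]; simpl; intros z Hz.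
  apply (cv_bound (psum a z)); [apply Fa; lra|].
  apply geom_partial; [apply div_lt_1; lra|]; intros k; eapply Rle_trans; [|apply B].
  apply Rmult_le_compat_l; [apply Cmod_ge_0|].
  apply pow_incr; split; [apply Cmod_ge_0 | lra].
Qed.

Lemma hol_jet k F c : hol F -> in_disc c -> jet k F c.
Proof.
  revert F; induction k; intros F HF Hc; [now apply hol_bdd|].
  destruct (hol_slope F HF) as [F' [_ S]]; destruct (S c Hc) as [G [HG [_ E]]].
  exists G; split; auto.
  eapply near_mono, (near_disc c 1 Hc); simpl; intros z Hz; now apply E.
Qed.

Lemma hol_der F : hol F -> exists F', hol F' /\ forall c, in_disc c -> has_der F c (F' c).
Proof.
  intros HF; destruct (hol_slope F HF) as [F' [HF' S]]; exists F'; split; auto.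
  intros c Hc; destruct (S c Hc) as [G [HG [<- E]]].
  apply has_der_jet; exists G; repeat split; [|now apply hol_jet].
  eapply near_mono, (near_disc c 1 Hc); simpl; intros z Hz; now apply E.
Qed.

Lemma hol_analytic F : hol F -> analytic_disc F.
Proof.
  intros HF z Hz; destruct (hol_der F HF) as [F' [_ D]].
  exists (F' z); now apply has_der_is_derive, D.
Qed.

(** * Compactness of closed discs and the maximum principle *)

Lemma Cmod_sqr (z : C) : Cmod z ^ 2 = Re z ^ 2 + Im z ^ 2.
Proof.
  unfold Cmod; rewrite pow2_sqrt; [reflexivity|].
  pose proof (pow2_ge_0 (fst z)); pose proof (pow2_ge_0 (snd z)); lra.
Qed.

Lemma Cmod_le_abs_sum (z : C) : Cmod z <= Rabs (Re z) + Rabs (Im z).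
Proof.
  apply Rsqr_incr_0_var.
  - rewrite !Rsqr_pow2, Cmod_sqr, <- (pow2_abs (Re z)), <- (pow2_abs (Im z)).
    pose proof (Rabs_pos (Re z)); pose proof (Rabs_pos (Im z)); nra.
  - pose proof (Rabs_pos (Re z)); pose proof (Rabs_pos (Im z)); lra.
Qed.

(** Compactness as the passage from a local [d] to a uniform one, derived from the same principle on
    the square enclosing the disc. *)
Lemma disc_compact rho (P : C -> R -> Prop) :
  (forall z d d', P z d -> 0 < d' <= d -> P z d') ->
  (forall c, Cmod c <= rho -> exists d, 0 < d /\
     forall z, Cmod z <= rho -> Cmod (z - c) < d -> P z d) ->
  exists d, 0 < d /\ forall z, Cmod z <= rho -> P z d.
Proof.
  intros Mono Loc.
  assert (X : forall u v : R, exists d : posreal, forall z, Cmod z <= rho ->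
    Rabs (Re z - u) < d -> Rabs (Im z - v) < d -> P z d).
  { intros u v; destruct (Rle_lt_dec (Cmod (u, v)) rho) as [L|L].
    - destruct (Loc _ L) as [d [Hd H]].
      assert (Hd2 : 0 < d / 2) by lra.
      exists (mkposreal _ Hd2); intros z Hz A B; simpl in *.
      apply Mono with d; [|lra]; apply H; auto.
      pose proof (Cmod_le_abs_sum (z - (u, v))); simpl in *.
      change (Rabs (fst z + - u) + Rabs (snd z + - v)) with
        (Rabs (Re z - u) + Rabs (Im z - v)) in *; lra.
    (* The square also has centres outside the disc. A box of half the distance to the disc contains
       none of its points, so the requirement is vacuous there. *)
    - assert (Hd : 0 < (Cmod (u, v) - rho) / 2) by lra.
      exists (mkposreal _ Hd); intros z Hz A B; exfalso; simpl in *.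
      pose proof (Cmod_le_abs_sum (z - (u, v))); simpl in *.
      change (Rabs (fst z + - u) + Rabs (snd z + - v)) with
        (Rabs (Re z - u) + Rabs (Im z - v)) in *.
      pose proof (Cmod_triangle_sub (u, v) z); rewrite Cmod_minus_sym in H0; lra. }
  set (delta := fun u v => proj1_sig (constructive_indefinite_description _ (X u v))).
  assert (D : forall u v z, Cmod z <= rho -> Rabs (Re z - u) < delta u v ->
    Rabs (Im z - v) < delta u v -> P z (delta u v)).
  { intros u v; unfold delta; destruct (constructive_indefinite_description _ (X u v)); auto. }
  destruct (compactness_value_2d (- rho) rho (- rho) rho delta) as [d Hd].
  exists d; split; [apply cond_pos|]; intros z Hz.
  pose proof (Rmax_Cmod z) as Mz.
  assert (A : - rho <= Re z <= rho).
  { apply Rabs_le_between; eapply Rle_trans; [apply Rmax_l|]; eapply Rle_trans; [exact Mz | auto]. }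
  assert (B : - rho <= Im z <= rho).
  { apply Rabs_le_between; eapply Rle_trans; [apply Rmax_r|]; eapply Rle_trans; [exact Mz | auto]. }
  apply NNPP; intros N; apply (Hd _ _ A B); intros [u [v [_ [_ [U [V L]]]]]].
  apply N, (Mono _ (delta u v)); [now apply D | split; [apply cond_pos | auto]].
Qed.

(** [disc_compact] is used twice: with [G z <= 1 / d] for an upper bound, and, if the supremum [m]
    were not attained, with [G z <= m - d], which contradicts that it is the least upper bound. *)
Lemma disc_max rho (G : C -> R) : 0 <= rho ->
  (forall c, Cmod c <= rho -> forall eps, 0 < eps ->
     near c (fun z => Rabs (G z - G c) < eps)) ->
  exists c, Cmod c <= rho /\ forall z, Cmod z <= rho -> G z <= G c.
Proof.
  intros Hr H.
  destruct (disc_compact rho (fun z d => G z <= / d)) as [d [Hd B]].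
  - intros z d d' A [Hd' L]; eapply Rle_trans; [exact A|]; now apply Rinv_le_contravar.
  - intros c Hc; destruct (H c Hc 1 Rlt_0_1) as [d [Hd K]].
    set (m := Rmax 1 (G c + 1)).
    assert (M1 : 0 < / m) by (apply Rinv_0_lt_compat; unfold m; pose proof (Rmax_l 1 (G c + 1)); lra).
    exists (Rmin d (/ m)); split; [now apply Rmin_pos|]; intros z Hz Lz.
    assert (Kz := K z (Rlt_le_trans _ _ _ Lz (Rmin_l _ _))).
    apply Rabs_lt_between in Kz.
    apply Rle_trans with m; [unfold m; pose proof (Rmax_r 1 (G c + 1)); lra|].
    rewrite <- (Rinv_inv m) at 1; apply Rinv_le_contravar; [now apply Rmin_pos | apply Rmin_r].
  - destruct (completeness (fun y => exists z, Cmod z <= rho /\ y = G z)) as [m [Ub Lub]].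
    + exists (/ d); intros y [z [Hz ->]]; auto.
    + exists (G 0%C), 0%C; rewrite Cmod_0; auto.
    + apply NNPP; intros N.
      assert (Lt : forall c, Cmod c <= rho -> G c < m).
      { intros c Hc; destruct (Rle_lt_or_eq_dec (G c) m) as [L|E]; auto; [apply Ub; eauto|].
        exfalso; apply N; exists c; split; auto; intros z Hz; rewrite E; apply Ub; eauto. }
      destruct (disc_compact rho (fun z d => G z <= m - d)) as [e [He K]].
      * intros; lra.
      * intros c Hc; specialize (Lt c Hc).
        destruct (H c Hc ((m - G c) / 2)) as [e [He K]]; [lra|].
        exists (Rmin e ((m - G c) / 2)); split; [apply Rmin_pos; lra|]; intros z Hz Lz.
        assert (Kz := K z (Rlt_le_trans _ _ _ Lz (Rmin_l _ _))).
        apply Rabs_lt_between in Kz; pose proof (Rmin_r e ((m - G c) / 2)); lra.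
      * assert (m <= m - e); [|lra].
        apply Lub; intros y [z [Hz ->]]; auto.
Qed.

Lemma Cmod_sqr_cont F c : cont_at F c -> forall eps, 0 < eps ->
  near c (fun z => Rabs (Cmod (F z) ^ 2 - Cmod (F c) ^ 2) < eps).
Proof.
  intros H eps He; pose proof (Cmod_ge_0 (F c)) as B0.
  assert (P : 0 < eps / (2 * Cmod (F c) + 2)) by (apply Rdiv_lt_0_compat; lra).
  eapply near_mono, (H (Rmin 1 (eps / (2 * Cmod (F c) + 2)))); [|apply Rmin_pos; lra].
  simpl; intros z Hz.
  assert (A : Cmod (F z - F c) < 1) by (eapply Rlt_le_trans; [exact Hz | apply Rmin_l]).
  assert (B : Cmod (F z - F c) < eps / (2 * Cmod (F c) + 2))
    by (eapply Rlt_le_trans; [exact Hz | apply Rmin_r]).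
  pose proof (Cmod_triangle_sub (F z) (F c)) as T1.
  pose proof (Cmod_triangle_sub (F c) (F z)) as T2; rewrite Cmod_minus_sym in T2.
  set (x := Cmod (F z - F c)) in *; set (u := Cmod (F z)) in *; set (v := Cmod (F c)) in *.
  assert (U : 0 <= u) by apply Cmod_ge_0.
  assert (X : 0 <= x) by apply Cmod_ge_0.
  assert (x * (2 * v + 2) < eps).
  { apply Rmult_lt_reg_r with (/ (2 * v + 2)); [apply Rinv_0_lt_compat; lra|].
    rewrite Rmult_assoc, Rinv_r; lra. }
  apply Rabs_def1; nra.
Qed.

(** Parseval for a quadratic polynomial over [t] times the fourth roots of unity. The mixed terms
    carry exponent differences 1 and 2 up to sign, none divisible by 4, and so cancel. *)
Lemma Parseval4 (a b c : C) (t : R) :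
  Cmod (a + t * b + t * t * c) ^ 2 + Cmod (a + Ci * t * b + Ci * t * (Ci * t) * c) ^ 2
  + Cmod (a + - t * b + - t * - t * c) ^ 2 + Cmod (a + - (Ci * t) * b + - (Ci * t) * - (Ci * t) * c) ^ 2
  = 4 * (Cmod a ^ 2 + t ^ 2 * Cmod b ^ 2 + t ^ 4 * Cmod c ^ 2).
Proof.
  destruct a as [a1 a2], b as [b1 b2], c as [c1 c2].
  rewrite !Cmod_sqr; simpl; ring.
Qed.

(** For [e <= p] square [p - e <= q] and drop [e^2]; otherwise [p^2 <= p e <= S K] makes the left
    side nonpositive. *)
Lemma Cmod_sqr_perturb (p q e S K : R) : 0 <= p <= S -> 0 <= q -> p - e <= q -> 0 <= e <= K ->
  p ^ 2 - 2 * S * K <= q ^ 2.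
Proof.
  intros. destruct (Rle_lt_dec e p).
  - assert ((p - e) ^ 2 <= q ^ 2) by (apply pow_incr; lra). nra.
  - nra.
Qed.

(* At an interior maximum [c] of [|F|^2 + eps |z|^2], the mean over [c + h] with
   [h = t, it, -t, -it] exceeds the value at [c] by at least [eps t^2 - O(t^3)]. *)
Lemma no_interior_max F c eps d : jet 3 F c -> 0 < eps -> 0 < d ->
  (forall z, Cmod (z - c) < d ->
     Cmod (F z) ^ 2 + eps * Cmod z ^ 2 <= Cmod (F c) ^ 2 + eps * Cmod c ^ 2) -> False.
Proof.
  intros [g1 [E1 [g2 [E2 [g3 [E3 [B HB]]]]]]] He Hd H.
  destruct (near_and _ _ _ (near_and _ _ _ E1 E2) (near_and _ _ _ E3 HB)) as [r [Hr K]].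
  assert (B0 : 0 <= B).
  { destruct (K c) as [_ [_ X]]; [replace (c - c)%C with (RtoC 0) by ring; now rewrite Cmod_0|].
    pose proof (Cmod_ge_0 (g3 c)); lra. }
  set (S := Cmod (F c) + Cmod (g1 c) + Cmod (g2 c)).
  assert (S0 : 0 <= S).
  { unfold S; pose proof (Cmod_ge_0 (F c)); pose proof (Cmod_ge_0 (g1 c));
    pose proof (Cmod_ge_0 (g2 c)); lra. }
  assert (SB : 0 <= S * B) by (apply Rmult_le_pos; auto).
  (* Being below [d] and [r] puts the four points where the maximality and the expansion hold,
     [t <= 1] bounds the quadratic part by [S], and the last entry makes the error [2 S B t^3]
     smaller than the gain [eps t^2]. *)
  set (t := Rmin (Rmin (d / 2) (r / 2)) (Rmin 1 (eps / (2 * (S * B + 1))))).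
  assert (Te : 0 < eps / (2 * (S * B + 1))) by (apply Rdiv_lt_0_compat; lra).
  assert (T : 0 < t /\ t < d /\ t < r /\ t <= 1 /\ t <= eps / (2 * (S * B + 1))).
  { unfold t; repeat split.
    - repeat apply Rmin_pos; lra.
    - eapply Rle_lt_trans; [apply Rmin_l|]; eapply Rle_lt_trans; [apply Rmin_l | lra].
    - eapply Rle_lt_trans; [apply Rmin_l|]; eapply Rle_lt_trans; [apply Rmin_r | lra].
    - eapply Rle_trans; [apply Rmin_r | apply Rmin_l].
    - eapply Rle_trans; [apply Rmin_r | apply Rmin_r]. }
  destruct T as [T0 [Td [Tr [T1 Tx]]]].
  assert (Tx' : 2 * (S * B) * t < eps).
  { assert (t * (2 * (S * B + 1)) <= eps); [|nra].
    apply Rmult_le_reg_r with (/ (2 * (S * B + 1))); [apply Rinv_0_lt_compat; lra|].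
    rewrite Rmult_assoc, Rinv_r; lra. }
  assert (Step : forall h : C, Cmod h = t ->
    Cmod (F c + h * g1 c + h * h * g2 c) ^ 2 - 2 * S * (B * t ^ 3) + eps * Cmod (c + h) ^ 2
    <= Cmod (F c) ^ 2 + eps * Cmod c ^ 2).
  { intros h Hh.
    assert (Eh : (c + h - c = h)%C) by ring.
    destruct (K (c + h)%C) as [[F1 F2] [F3 F4]]; [rewrite Eh; lra|].
    specialize (H (c + h)%C ltac:(rewrite Eh; lra)).
    rewrite Eh in F1, F2, F3.
    set (p := (F c + h * g1 c + h * h * g2 c)%C) in *.
    assert (Fe : F (c + h)%C = (p + h * (h * (h * g3 (c + h))))%C).
    { rewrite F1, F2, F3; unfold p; ring. }
    assert (Ee : Cmod (h * (h * (h * g3 (c + h)%C))) <= B * t ^ 3).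
    { rewrite !Cmod_mult, Hh; simpl.
      replace (B * (t * (t * (t * 1)))) with (t * (t * (t * B))) by ring.
      repeat (apply Rmult_le_compat_l; [lra|]); auto. }
    assert (Cmod p ^ 2 - 2 * S * (B * t ^ 3) <= Cmod (F (c + h)%C) ^ 2); [|lra].
    apply Cmod_sqr_perturb with (Cmod (h * (h * (h * g3 (c + h)%C)))).
    - split; [apply Cmod_ge_0|]; unfold p, S.
      pose proof (Cmod_triangle (F c + h * g1 c) (h * h * g2 c)) as X1.
      pose proof (Cmod_triangle (F c) (h * g1 c)) as X2.
      rewrite !Cmod_mult, Hh in *.
      pose proof (Cmod_ge_0 (g1 c)); pose proof (Cmod_ge_0 (g2 c)).
      assert (t * t <= 1) by nra; nra.
    - apply Cmod_ge_0.
    - rewrite Fe; pose proof (Cmod_triangle_sub p (- (h * (h * (h * g3 (c + h)%C))))) as X.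
      rewrite Cmod_opp in X.
      replace (p - - (h * (h * (h * g3 (c + h)))))%C with (p + h * (h * (h * g3 (c + h))))%C in X
        by ring; lra.
    - split; [apply Cmod_ge_0 | auto]. }
  pose proof (Parseval4 (F c) (g1 c) (g2 c) t) as P.
  (* The same identity for the polynomial [c + h] shows that the mean of [|z|^2] exceeds [|c|^2] by
     exactly [t^2]. *)
  pose proof (Parseval4 c 1 0 t) as Q.
  assert (Ct : Cmod t = t) by (rewrite Cmod_R, Rabs_pos_eq; lra).
  assert (Cit : Cmod (Ci * t) = t) by (rewrite Cmod_mult, Cmod_Ci, Ct; ring).
  pose proof (Step t Ct) as H1.
  pose proof (Step (Ci * t)%C Cit) as H2.
  pose proof (Step (- t)%C ltac:(now rewrite Cmod_opp)) as H3.
  pose proof (Step (- (Ci * t))%C ltac:(now rewrite Cmod_opp)) as H4.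
  rewrite !Cmult_0_r, !Cplus_0_r, !Cmult_1_r, Cmod_0, Cmod_1 in Q.
  set (A1 := Cmod (F c + t * g1 c + _) ^ 2) in *.
  set (A2 := Cmod (F c + Ci * t * g1 c + _) ^ 2) in *.
  set (A3 := Cmod (F c + - t * g1 c + _) ^ 2) in *.
  set (A4 := Cmod (F c + - (Ci * t) * g1 c + _) ^ 2) in *.
  assert (Z : 4 * eps * t ^ 2 - 8 * S * (B * t ^ 3) <= 0).
  { assert (0 <= t ^ 2 * Cmod (g1 c) ^ 2) by (apply Rmult_le_pos; apply pow2_ge_0).
    assert (0 <= t ^ 4 * Cmod (g2 c) ^ 2)
      by (apply Rmult_le_pos; [apply pow_le; lra | apply pow2_ge_0]).
    assert (Q' : eps * (Cmod (c + t) ^ 2 + Cmod (c + Ci * t) ^ 2 + Cmod (c + - t) ^ 2 +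
     Cmod (c + - (Ci * t)) ^ 2) = eps * (4 * (Cmod c ^ 2 + t ^ 2))) by (rewrite Q; ring).
    lra. }
  assert (0 < t ^ 2) by (apply pow_lt; lra).
  assert (0 < 4 * t ^ 2 * (eps - 2 * (S * B) * t)) by (apply Rmult_lt_0_compat; lra).
  nra.
Qed.

Lemma maximum_principle F rho M : 0 <= rho -> 0 <= M ->
  (forall c, Cmod c <= rho -> jet 3 F c) ->
  (forall z, Cmod z = rho -> Cmod (F z) <= M) ->
  forall z, Cmod z <= rho -> Cmod (F z) <= M.
Proof.
  intros Hr HM J Hb z Hz.
  apply Rsqr_incr_0_var; auto; rewrite !Rsqr_pow2; apply le_epsilon; intros e He.
  (* With this choice the perturbation adds at most [e] on the closed disc, and 1 in the denominator
     covers [rho = 0]. The maximum of the perturbed function must lie on the circle, where [M]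
     applies. *)
  set (eps := e / (rho ^ 2 + 1)).
  assert (R2 : 0 <= rho ^ 2) by apply pow2_ge_0.
  assert (Hp : 0 < eps) by (apply Rdiv_lt_0_compat; lra).
  assert (Hpe : eps * rho ^ 2 <= e).
  { replace e with (eps * (rho ^ 2 + 1)) by (unfold eps; field; lra); nra. }
  destruct (disc_max rho (fun z => Cmod (F z) ^ 2 + eps * Cmod z ^ 2) Hr) as [c [Hc Mc]].
  - intros c Hc e' He'.
    pose proof (Cmod_sqr_cont F c (jet_cont _ _ _ (J c Hc)) (e' / 2) ltac:(lra)) as N1.
    assert (N2 : near c (fun z => Rabs (Cmod z ^ 2 - Cmod c ^ 2) < e' / (2 * eps))).
    { apply (Cmod_sqr_cont (fun z => z) c); [exact (jet_cont 0 _ _ (jet_id 1 c))|].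
      apply Rdiv_lt_0_compat; lra. }
    eapply near_mono, near_and; [| exact N1 | exact N2]; simpl; intros x [X1 X2].
    assert (X3 : eps * Rabs (Cmod x ^ 2 - Cmod c ^ 2) < e' / 2).
    { replace (e' / 2) with (eps * (e' / (2 * eps))) by (field; lra).
      now apply Rmult_lt_compat_l. }
    rewrite <- (Rabs_pos_eq eps), <- Rabs_mult in X3 by lra.
    apply Rabs_lt_between in X1; apply Rabs_lt_between in X3; apply Rabs_def1; nra.
  - destruct (Rle_lt_or_eq_dec _ _ Hc) as [L|E].
    + exfalso; apply (no_interior_max F c eps (rho - Cmod c)); auto; [lra|].
      intros x Hx; apply Mc; pose proof (Cmod_triangle_sub x c); lra.
    + specialize (Mc z Hz); simpl in Mc; rewrite E in Mc.
      assert (Cmod (F c) ^ 2 <= M ^ 2) by (apply pow_incr; split; [apply Cmod_ge_0 | auto]).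
      assert (0 <= eps * Cmod z ^ 2) by (apply Rmult_le_pos; [lra | apply pow2_ge_0]).
      unfold pow in *; lra.
Qed.

(** * The Schwarz and Schwarz-Pick inequalities *)

Lemma Cmod_neq0 z : 0 < Cmod z -> z <> 0%C.
Proof. apply Cmod_gt_0. Qed.

Lemma near_neq (c z0 : C) : c <> z0 -> near c (fun z => z <> z0).
Proof.
  intros N; exists (Cmod (c - z0)); split.
  - now apply Cmod_gt_0, Cminus_eq_contra.
  - intros z Hz ->; rewrite Cmod_minus_sym in Hz; lra.
Qed.

(** The difference of the squared moduli, right minus left, is [(1 - |a|^2) (1 - |w|^2)]. *)
Lemma Moebius_le_1 (a w : C) : Cmod a <= 1 -> Cmod w <= 1 ->
  Cmod (w - a) <= Cmod (1 - Cconj a * w).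
Proof.
  intros Ha Hw; apply Rsqr_incr_0_var; [|apply Cmod_ge_0]; rewrite !Rsqr_pow2.
  assert (A : Cmod a ^ 2 <= 1) by (pose proof (Cmod_ge_0 a); nra).
  assert (W : Cmod w ^ 2 <= 1) by (pose proof (Cmod_ge_0 w); nra).
  assert (P : 0 <= (1 - Cmod a ^ 2) * (1 - Cmod w ^ 2)) by (apply Rmult_le_pos; lra).
  rewrite !Cmod_sqr in *; destruct a as [a1 a2], w as [w1 w2]; simpl in *; nra.
Qed.

Lemma Cconj_mult_self z : (Cconj z * z)%C = RtoC (Cmod z ^ 2).
Proof. rewrite Cmod_sqr; destruct z as [x y]; apply injective_projections; simpl; ring. Qed.

(** The maximum principle for [F], the quotient of [(f - a) / (1 - conj a f)] by
    [rho (z - z0) / (rho^2 - conj z0 z)]; the divisor has modulus 1 on [|z| = rho], and the value of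
    [F] at [z0] is [l (rho^2 - |z0|^2) / (rho (1 - |a|^2))]. A bound [kappa] strictly below 1 keeps
    [1 - conj a f] away from 0. *)
Lemma pick_circle f z0 l rho kappa : (forall c, in_disc c -> forall k, jet k f c) ->
  kappa < 1 -> (forall z, in_disc z -> Cmod (f z) <= kappa) ->
  has_der f z0 l -> Cmod z0 < rho < 1 ->
  Cmod l * (rho ^ 2 - Cmod z0 ^ 2) <= rho * (1 - Cmod (f z0) ^ 2).
Proof.
  intros J Hk Hf D Hr; pose proof (Cmod_ge_0 z0) as Z0.
  assert (Hz0 : in_disc z0) by (unfold in_disc; lra).
  set (a := f z0) in *.
  assert (Ha : Cmod a <= kappa) by (apply Hf; auto).
  pose proof (Cmod_ge_0 a) as A0.
  set (psi := fun z => if Ceq_dec z z0 then l else ((f z - a) / (z - z0))%C).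
  assert (Den : forall z, in_disc z -> (RtoC rho * (1 - Cconj a * f z))%C <> 0%C).
  { intros z Hz; apply Cmult_neq_0; [apply Cmod_neq0; rewrite Cmod_R, Rabs_pos_eq; lra|].
    apply Cmod_neq0; pose proof (Cmod_triangle_sub 1 (Cconj a * f z)) as T.
    rewrite Cmod_1, Cmod_mult, Cmod_conj in T; specialize (Hf z Hz).
    pose proof (Cmod_ge_0 (f z)); nra. }
  set (F := fun z => (psi z * (rho ^ 2 - Cconj z0 * z) * / (RtoC rho * (1 - Cconj a * f z)))%C).
  assert (JF : forall c, Cmod c <= rho -> jet 3 F c).
  { intros c Hc; assert (Dc : in_disc c) by (unfold in_disc; lra).
    apply jet_mult; [apply jet_mult|].
    - unfold psi; destruct (Ceq_dec c z0) as [->|N].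
      (* At [z0] the quotient is the slope of [f], which loses one order: order 4 for [f] leaves the
         order 3 of the maximum principle. *)
      + destruct (J z0 Hz0 4%nat) as [g [E G]].
        assert (El : g z0 = l).
        { apply (has_der_unique f z0); auto; apply has_der_jet; exists g; repeat split; auto.
          now do 2 apply jet_pred. }
        apply jet_ext with g; auto; eapply near_mono, E; simpl; intros z Ez.
        destruct (Ceq_dec z z0) as [->|N]; auto.
        fold a in Ez; rewrite Ez; field; now apply Cminus_eq_contra.
      + apply jet_ext with (fun z => (f z + - a) * / (z + - z0))%C.
        * eapply near_mono, (near_neq _ _ N); simpl; intros z Nz.
          destruct (Ceq_dec z z0); [contradiction | reflexivity].
        * apply jet_mult; [apply jet_plus; [apply J; auto | apply jet_const]|].
          apply jet_inv; [apply jet_plus; [apply jet_id | apply jet_const]|].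
          now apply Cminus_eq_contra.
    - apply (jet_plus 3 (fun _ => _) (fun z => - (Cconj z0 * z))%C); [apply jet_const|].
      apply jet_ext with (fun z => (- Cconj z0) * z)%C; [apply near_all; intros; ring|].
      apply jet_mult; [apply jet_const | apply jet_id].
    - apply jet_inv; [|now apply Den].
      apply jet_mult; [apply jet_const|].
      apply jet_ext with (fun z => 1 + (- Cconj a) * f z)%C; [apply near_all; intros; ring|].
      apply jet_plus; [apply jet_const|]; apply jet_mult; [apply jet_const | apply J; auto]. }
  assert (BF : forall z, Cmod z = rho -> Cmod (F z) <= 1).
  { intros z Hz; assert (Dz : in_disc z) by (unfold in_disc; lra).
    assert (N : z <> z0) by (intros ->; lra).
    assert (N' : 0 < Cmod (z - z0)) by (apply Cmod_gt_0, Cminus_eq_contra; auto).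
    unfold F, psi; destruct (Ceq_dec z z0) as [|_]; [contradiction|].
    (* On the circle [rho^2 = conj z z], so this factor has modulus [rho |z - z0|] and cancels the
       denominator of [psi]. *)
    replace (RtoC rho ^ 2 - Cconj z0 * z)%C with (Cconj (z - z0) * z)%C.
    2:{ rewrite <- RtoC_pow, <- Hz, <- Cconj_mult_self, Cminus_conj; ring. }
    pose proof (Den z Dz) as Dn; pose proof Dn as Dn'; apply Cmod_gt_0 in Dn'.
    rewrite !Cmod_mult, Cmod_div, Cmod_inv by (try apply Cmod_neq0; auto).
    rewrite Cmod_conj, Hz.
    rewrite Cmod_mult, Cmod_R, Rabs_pos_eq in * by lra.
    assert (0 < Cmod (1 - Cconj a * f z)) by (pose proof (Cmod_ge_0 (1 - Cconj a * f z)); nra).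
    pose proof (Moebius_le_1 a (f z) ltac:(lra) ltac:(specialize (Hf z Dz); lra)) as Mo.
    replace (Cmod (f z - a) / Cmod (z - z0) * (Cmod (z - z0) * rho) *
      / (rho * Cmod (1 - Cconj a * f z))) with (Cmod (f z - a) / Cmod (1 - Cconj a * f z))
      by (field; lra).
    apply Rmult_le_reg_r with (Cmod (1 - Cconj a * f z)); auto.
    unfold Rdiv; rewrite Rmult_assoc, Rinv_l; lra. }
  pose proof (maximum_principle F rho 1 ltac:(lra) ltac:(lra) JF BF z0 ltac:(lra)) as Fin.
  unfold F, psi in Fin; destruct (Ceq_dec z0 z0) as [_|]; [|contradiction].
  fold a in Fin; rewrite !Cconj_mult_self, <- RtoC_pow, <- !RtoC_minus, <- RtoC_mult in Fin.
  assert (A1 : 0 < 1 - Cmod a ^ 2) by nra.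
  assert (A2 : 0 < rho ^ 2 - Cmod z0 ^ 2) by nra.
  rewrite !Cmod_mult, Cmod_inv in Fin.
  2:{ apply Cmod_neq0; rewrite Cmod_R, Rabs_pos_eq; nra. }
  rewrite !Cmod_R, !Rabs_pos_eq in Fin; try nra.
  assert (0 < rho * (1 - Cmod a ^ 2)) by (apply Rmult_lt_0_compat; lra).
  apply Rmult_le_reg_r with (/ (rho * (1 - Cmod a ^ 2))); [now apply Rinv_0_lt_compat|].
  rewrite Rinv_r; lra.
Qed.

(** [pick_circle] needs a bound below 1 and a circle inside the disc, so it is applied to [f / M]
    with [M > 1] and some [rho < 1]; both limits are carried by one tolerance [e]. *)
Lemma Schwarz_Pick f z0 l : (forall c, in_disc c -> forall k, jet k f c) ->
  (forall z, in_disc z -> Cmod (f z) <= 1) -> in_disc z0 -> has_der f z0 l ->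
  Cmod l * (1 - Cmod z0 ^ 2) <= 1 - Cmod (f z0) ^ 2.
Proof.
  intros J Hf Hz D; unfold in_disc in Hz; pose proof (Cmod_ge_0 z0) as Z0.
  pose proof (Cmod_ge_0 l) as L0; pose proof (Cmod_ge_0 (f z0)) as F0.
  apply le_epsilon; intros e He.
  (* From [M <= 2] and [M <= 1 + e / 6] follows [M^2 <= 1 + e / 2]; the choice of [rho] below gives
     [|l| (1 - rho^2) <= e / 2]. The two errors add up to [e]. *)
  set (M := 1 + Rmin 1 (e / 6)).
  assert (HM : 1 < M <= 2 /\ M <= 1 + e / 6).
  { unfold M; pose proof (Rmin_l 1 (e / 6)); pose proof (Rmin_r 1 (e / 6)).
    assert (0 < Rmin 1 (e / 6)) by (apply Rmin_pos; lra); lra. }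
  set (rho := Rmax ((1 + Cmod z0) / 2) (1 - e / (4 * (Cmod l + 1)))).
  assert (Q : 0 < e / (4 * (Cmod l + 1))) by (apply Rdiv_lt_0_compat; lra).
  assert (Hr : Cmod z0 < rho < 1 /\ 1 - rho <= e / (4 * (Cmod l + 1))).
  { unfold rho, Rmax; destruct Rle_dec; lra. }
  assert (Hl : Cmod l * (1 - rho) <= e / 4).
  { replace (e / 4) with ((Cmod l + 1) * (e / (4 * (Cmod l + 1)))) by (field; lra).
    apply Rmult_le_compat; lra. }
  assert (iM : 0 < / M < 1).
  { split; [apply Rinv_0_lt_compat; lra | rewrite <- Rinv_1; apply Rinv_lt_contravar; lra]. }
  assert (P : Cmod (0 * f z0 + RtoC (/ M) * l) * (rho ^ 2 - Cmod z0 ^ 2)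
              <= rho * (1 - Cmod (RtoC (/ M) * f z0) ^ 2)).
  { apply (pick_circle (fun z => RtoC (/ M) * f z)%C z0 _ rho (/ M)); try lra.
    - intros c Hc k; apply jet_mult; [apply jet_const | apply J; auto].
    - intros z Hz'; rewrite Cmod_mult, Cmod_R, Rabs_pos_eq by lra.
      specialize (Hf z Hz'); pose proof (Cmod_ge_0 (f z)); nra.
    - apply has_der_mult; [apply has_der_const | auto]. }
  replace (0 * f z0 + RtoC (/ M) * l)%C with (RtoC (/ M) * l)%C in P by ring.
  rewrite !Cmod_mult, !Cmod_R, !Rabs_pos_eq in P by lra.
  assert (K : M * M * (/ M * Cmod l * (rho ^ 2 - Cmod z0 ^ 2))
              <= M * M * (rho * (1 - (/ M * Cmod (f z0)) ^ 2))) by (apply Rmult_le_compat_l; nra).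
  replace (M * M * (/ M * Cmod l * (rho ^ 2 - Cmod z0 ^ 2)))
    with (M * (Cmod l * (rho ^ 2 - Cmod z0 ^ 2))) in K by (field; lra).
  replace (M * M * (rho * (1 - (/ M * Cmod (f z0)) ^ 2)))
    with (rho * (M ^ 2 - Cmod (f z0) ^ 2)) in K by (field; lra).
  assert (X1 : 0 <= Cmod l * (rho ^ 2 - Cmod z0 ^ 2)) by (apply Rmult_le_pos; nra).
  assert (F1 : Cmod (f z0) <= 1) by (apply Hf; exact Hz).
  assert (X2 : 0 <= M ^ 2 - Cmod (f z0) ^ 2) by nra.
  assert (X3 : Cmod l * (rho ^ 2 - Cmod z0 ^ 2) <= M ^ 2 - Cmod (f z0) ^ 2) by nra.
  assert (X4 : M ^ 2 <= 1 + e / 2) by nra.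
  assert (X5 : Cmod l * (1 - rho ^ 2) <= e / 2).
  { replace (1 - rho ^ 2) with ((1 - rho) * (1 + rho)) by ring; nra. }
  nra.
Qed.

(** On [|z| = rho] division by [z^n] costs the factor [rho^(-n)]. The limit [rho -> 1] is made
    explicit by Bernoulli's inequality [1 - n (1 - rho) <= rho^n]. *)
Lemma Schwarz_pow n f : (forall c, in_disc c -> forall k, jet k f c) ->
  (forall z, in_disc z -> Cmod (z ^ n * f z) <= 1) ->
  forall z, in_disc z -> Cmod (f z) <= 1.
Proof.
  intros J H z Hz; unfold in_disc in Hz; pose proof (Cmod_ge_0 z) as Z0.
  pose proof (Cmod_ge_0 (f z)) as F0.
  apply le_epsilon; intros e He.
  set (X := Cmod (f z)) in *.
  assert (N0 : 0 <= INR n) by apply pos_INR.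
  assert (D0 : 0 < X * INR n + 1) by nra.
  set (rho := Rmax ((1 + Cmod z) / 2) (1 - e / (X * INR n + 1))).
  assert (Q : 0 < e / (X * INR n + 1)) by (apply Rdiv_lt_0_compat; lra).
  assert (Hr : Cmod z < rho < 1 /\ 0 < rho /\ 1 - rho <= e / (X * INR n + 1)).
  { unfold rho, Rmax; destruct Rle_dec; lra. }
  destruct Hr as [Hr [Hr0 Hr1]].
  assert (Pr : 0 < rho ^ n) by (apply pow_lt; lra).
  assert (M : X <= / rho ^ n).
  { apply (maximum_principle f rho (/ rho ^ n)); try lra.
    - left; now apply Rinv_0_lt_compat.
    - intros c Hc; apply J; unfold in_disc; lra.
    - intros w Hw; specialize (H w ltac:(unfold in_disc; lra)).
      rewrite Cmod_mult, Cmod_pow, Hw in H.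
      apply Rmult_le_reg_l with (rho ^ n); auto; rewrite Rinv_r; lra. }
  assert (M' : X * rho ^ n <= 1).
  { apply Rmult_le_reg_r with (/ rho ^ n); [now apply Rinv_0_lt_compat|].
    rewrite Rmult_assoc, Rinv_r; lra. }
  assert (B : 1 - INR n * (1 - rho) <= rho ^ n).
  { clearbody rho; clear - Hr0 Hr; induction n; [simpl; lra|].
    rewrite S_INR; simpl.
    assert (0 <= INR n * ((1 - rho) * (1 - rho)))
      by (apply Rmult_le_pos; [apply pos_INR | apply Rmult_le_pos; lra]).
    assert (rho * (1 - INR n * (1 - rho)) <= rho * rho ^ n) by (apply Rmult_le_compat_l; lra).
    lra. }
  assert (C1 : (X * INR n + 1) * (1 - rho) <= e).
  { apply Rmult_le_reg_r with (/ (X * INR n + 1)); [now apply Rinv_0_lt_compat|].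
    replace ((X * INR n + 1) * (1 - rho) * / (X * INR n + 1)) with (1 - rho) by (field; lra).
    exact Hr1. }
  nra.
Qed.

(** Replaces [hol] where quotients occur: reciprocals of nonvanishing functions stay in this class
    by [jet_inv], pointwise and without a power series for the quotient. *)
Definition hjet (f : C -> C) : Prop := forall c, in_disc c -> forall k, jet k f c.

Lemma hjet_hol f : hol f -> hjet f.
Proof. intros H c Hc k; now apply hol_jet. Qed.

Lemma hjet_plus f g : hjet f -> hjet g -> hjet (fun z => f z + g z)%C.
Proof. intros H K c Hc k; apply jet_plus; auto. Qed.

Lemma hjet_mult f g : hjet f -> hjet g -> hjet (fun z => f z * g z)%C.
Proof. intros H K c Hc k; apply jet_mult; auto. Qed.

Lemma hjet_const a : hjet (fun _ => a).
Proof. intros c Hc k; apply jet_const. Qed.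

Lemma hjet_inv f : hjet f -> (forall z, in_disc z -> f z <> 0%C) -> hjet (fun z => / f z)%C.
Proof. intros H N c Hc k; apply jet_pred, jet_inv; auto. Qed.

Lemma hjet_div f g : hjet f -> hjet g -> (forall z, in_disc z -> g z <> 0%C) ->
  hjet (fun z => f z / g z)%C.
Proof. intros; apply hjet_mult; auto; now apply hjet_inv. Qed.

Lemma jet2_has_der f c : jet 2 f c -> exists l, has_der f c l.
Proof. intros [g [E J]]; exists (g c); apply has_der_jet; exists g; auto. Qed.

(* In terms of [r = exp (- t)] this reads [tanh (n t) <= n sinh t]. *)
Lemma tanh_sinh_bound n r : 0 < r < 1 ->
  2 * r * (1 - (r ^ n) ^ 2) <= INR n * (1 - r ^ 2) * (1 + (r ^ n) ^ 2).
Proof.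
  intros Hr.
  assert (X : forall k, 0 < (r ^ k) ^ 2 <= 1).
  { intros k; rewrite <- pow_mult; split; [apply pow_lt; lra|].
    rewrite <- (pow1 (k * 2)); apply pow_incr; lra. }
  (* In the same notation this is [tanh (n t) <= n tanh t], by subadditivity of [tanh], whose defect
     is computed in [E]. It remains to use [tanh t <= sinh t], that is [2 r <= 1 + r^2]. *)
  assert (H : (1 - (r ^ n) ^ 2) / (1 + (r ^ n) ^ 2) <= INR n * ((1 - r ^ 2) / (1 + r ^ 2))).
  { induction n.
    - simpl; apply Req_le; field.
      pose proof (pow2_ge_0 r); simpl in *; lra.
    - rewrite S_INR, Rmult_plus_distr_r, Rmult_1_l.
      pose proof (X n) as Y; set (y := (r ^ n) ^ 2) in *.
      replace ((r ^ S n) ^ 2) with (r ^ 2 * y) by (unfold y; simpl; ring).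
      set (q := r ^ 2) in *.
      assert (Q : 0 < q < 1) by (unfold q; simpl; split; nra).
      assert (QY : 0 < q * y < 1).
      { split; [apply Rmult_lt_0_compat; lra|].
        apply Rle_lt_trans with (q * 1); [apply Rmult_le_compat_l|]; lra. }
      apply Rle_trans with ((1 - y) / (1 + y) + (1 - q) / (1 + q)); [|lra].
      assert (E : (1 - y) / (1 + y) + (1 - q) / (1 + q) - (1 - q * y) / (1 + q * y)
        = (1 - q) * ((1 - y) * (1 - q * y)) / ((1 + q) * ((1 + y) * (1 + q * y)))).
      { field; repeat split; lra. }
      assert (0 <= (1 - q) * ((1 - y) * (1 - q * y)) / ((1 + q) * ((1 + y) * (1 + q * y)))).
      { apply Rmult_le_pos; [|left; apply Rinv_0_lt_compat; repeat apply Rmult_lt_0_compat; lra].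
        apply Rmult_le_pos; [lra|]; apply Rmult_le_pos; lra. }
      lra. }
  specialize (X n); set (y := (r ^ n) ^ 2) in *.
  assert (R2 : 0 < r ^ 2 < 1) by (simpl; nra).
  assert (K : (1 - y) * (1 + r ^ 2) <= INR n * (1 - r ^ 2) * (1 + y)).
  { apply Rmult_le_reg_r with (/ (1 + y) * / (1 + r ^ 2)).
    { apply Rmult_lt_0_compat; apply Rinv_0_lt_compat; lra. }
    replace ((1 - y) * (1 + r ^ 2) * (/ (1 + y) * / (1 + r ^ 2))) with ((1 - y) / (1 + y))
      by (field; lra).
    replace (INR n * (1 - r ^ 2) * (1 + y) * (/ (1 + y) * / (1 + r ^ 2)))
      with (INR n * ((1 - r ^ 2) / (1 + r ^ 2))) by (field; lra).
    exact H. }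
  assert (2 * r <= 1 + r ^ 2) by (pose proof (pow2_ge_0 (1 - r)); simpl in *; nra).
  nra.
Qed.

Lemma pow_in_0_1 r n : 0 <= r < 1 -> (1 <= n)%nat -> 0 <= r ^ n < 1.
Proof.
  intros Hr Hn; split; [apply pow_le; lra|].
  destruct n; [lia|]; simpl.
  assert (0 <= r ^ n <= 1).
  { split; [apply pow_le; lra | rewrite <- (pow1 n); apply pow_incr; lra]. }
  nra.
Qed.

(** Stated for [z m] instead of [m]: the factor [z] absorbs the exponent [n - 1] and produces the
    [z f'] of the logarithmic derivative. *)
Lemma has_der_pow_mult n f z l : (1 <= n)%nat -> has_der f z l ->
  exists m, has_der (fun z => z ^ n * f z)%C z m /\
    (z * m = INR n * (z ^ n * f z) + z * z ^ n * l)%C.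
Proof.
  intros Hn H; destruct n as [|n]; [lia|].
  eexists; split; [apply has_der_mult; [apply has_der_pow | exact H]|].
  cbv beta; rewrite Cpow_S; ring.
Qed.

(** Here [z w' = n w + z^(n+1) phi'], where [phi] is bounded by 1 by [Schwarz_pow] and [phi'] by
    [Schwarz_Pick]. With [f = |phi(z)|] and [x = r^n] what remains is a real inequality in [r], [x]
    and [f]. *)
Lemma Schwarz_Pick_pow n phi w z m : (1 <= n)%nat -> hjet phi ->
  (forall z, in_disc z -> w z = z ^ n * phi z)%C ->
  (forall z, in_disc z -> Cmod (w z) <= 1) -> in_disc z -> has_der w z m ->
  Cmod (w z) <= Cmod z ^ n /\
  Cmod (z * m) * (1 - (Cmod z ^ n) ^ 2) <= INR n * Cmod z ^ n * (1 - Cmod (w z) ^ 2).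
Proof.
  intros Hn J Ew Hw Hz D.
  assert (Bphi : forall z, in_disc z -> Cmod (phi z) <= 1).
  { apply (Schwarz_pow n); auto; intros c Hc; rewrite <- Ew; auto. }
  destruct (jet2_has_der phi z (J z Hz 2%nat)) as [l Dl].
  pose proof (Schwarz_Pick phi z l J Bphi Hz Dl) as SP.
  destruct (has_der_pow_mult n phi z l Hn Dl) as [m' [Dm' Em']].
  assert (m = m').
  { apply (has_der_unique w z); auto; eapply has_der_ext, Dm'.
    eapply near_mono, (near_disc z 1 Hz); simpl; intros; symmetry; auto. }
  subst m'; rewrite Em', Ew by auto.
  pose proof (Cmod_ge_0 z) as Z0; pose proof (Cmod_ge_0 l) as L0.
  pose proof (Cmod_ge_0 (phi z)) as F0; specialize (Bphi z Hz); unfold in_disc in Hz.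
  destruct (pow_in_0_1 (Cmod z) n) as [X0 X1]; [lra | auto |].
  rewrite Cmod_mult, Cmod_pow; split; [nra|].
  assert (T : Cmod (INR n * (z ^ n * phi z) + z * z ^ n * l)
    <= INR n * (Cmod z ^ n * Cmod (phi z)) + Cmod z * Cmod z ^ n * Cmod l).
  { eapply Rle_trans; [apply Cmod_triangle|]; rewrite !Cmod_mult, !Cmod_pow, Cmod_R, Rabs_pos_eq;
    [lra | apply pos_INR]. }
  assert (N0 : 0 <= INR n) by apply pos_INR.
  (* [tanh_sinh_bound] needs [r > 0]; at [z = 0] both sides vanish. *)
  destruct (Rle_lt_or_eq_dec 0 (Cmod z) Z0) as [Zp|Ze].
  2:{ rewrite <- Ze in *; assert (E0 : 0 ^ n = 0) by (apply pow_i; lia); rewrite E0 in *; nra. }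
  pose proof (tanh_sinh_bound n (Cmod z) ltac:(lra)) as TB.
  set (r := Cmod z) in *; set (x := r ^ n) in *; set (f := Cmod (phi z)) in *;
  set (L := Cmod l) in *; set (N := INR n) in *.
  assert (X2 : 0 <= x ^ 2 < 1) by (simpl; nra).
  assert (R2 : 0 < 1 - r ^ 2) by (simpl; nra).
  (* Both sides are affine in [f], so the endpoints of [[0, 1]] suffice: [f = 1] is
     [tanh_sinh_bound], and [f = 0] follows from it by [1 + x^2 <= 2]. *)
  assert (A : r * (1 + f) * (1 - x ^ 2) <= N * (1 - r ^ 2) * (1 + x ^ 2 * f)).
  { assert (P0 : r * (1 - x ^ 2) <= N * (1 - r ^ 2)).
    { assert (0 <= N * (1 - r ^ 2)) by (apply Rmult_le_pos; lra). nra. }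
    replace (r * (1 + f) * (1 - x ^ 2))
      with ((1 - f) * (r * (1 - x ^ 2)) + f * (2 * r * (1 - x ^ 2))) by ring.
    replace (N * (1 - r ^ 2) * (1 + x ^ 2 * f))
      with ((1 - f) * (N * (1 - r ^ 2)) + f * (N * (1 - r ^ 2) * (1 + x ^ 2))) by ring.
    apply Rplus_le_compat; apply Rmult_le_compat_l; lra. }
  assert (B : r * L * (1 - x ^ 2) <= N * ((1 - f) * (1 + x ^ 2 * f))).
  { apply Rmult_le_reg_r with (1 - r ^ 2); auto.
    apply Rle_trans with (r * (1 - x ^ 2) * (1 - f ^ 2)).
    - replace (r * L * (1 - x ^ 2) * (1 - r ^ 2)) with (r * (1 - x ^ 2) * (L * (1 - r ^ 2))) by ring.
      apply Rmult_le_compat_l; [apply Rmult_le_pos; lra | auto].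
    - replace (r * (1 - x ^ 2) * (1 - f ^ 2)) with ((1 - f) * (r * (1 + f) * (1 - x ^ 2))) by ring.
      replace (N * ((1 - f) * (1 + x ^ 2 * f)) * (1 - r ^ 2))
        with ((1 - f) * (N * (1 - r ^ 2) * (1 + x ^ 2 * f))) by ring.
      apply Rmult_le_compat_l; lra. }
  apply Rle_trans with ((N * (x * f) + r * x * L) * (1 - x ^ 2)).
  - apply Rmult_le_compat_r; lra.
  - replace ((N * (x * f) + r * x * L) * (1 - x ^ 2))
      with (x * (N * f * (1 - x ^ 2) + r * L * (1 - x ^ 2))) by ring.
    replace (N * x * (1 - (x * f) ^ 2))
      with (x * (N * f * (1 - x ^ 2) + N * ((1 - f) * (1 + x ^ 2 * f)))) by ring.
    apply Rmult_le_compat_l; lra.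
Qed.

(** * Logarithmic derivatives under a bound on the real part *)

Lemma Re_pos_neq0 z : 0 < Re z -> z <> 0%C.
Proof. intros H ->; simpl in H; lra. Qed.

Lemma one_minus_Cmod_le w : 1 - Cmod w <= Cmod (1 - w).
Proof. pose proof (Cmod_triangle_sub 1 w); rewrite Cmod_1 in H; lra. Qed.

Lemma Cmod_lt_of_sqr z w : Cmod z ^ 2 < Cmod w ^ 2 -> Cmod z < Cmod w.
Proof. intros H; apply Rsqr_incrst_0; [rewrite !Rsqr_pow2; auto | |]; apply Cmod_ge_0. Qed.

(** With [w = (p - 1) / (p + 1)] one has [w = z^n Q / (p + 1)] and [z p'/p = 2 z w' / (1 - w^2)].
    Since [1 - |w|^2 <= |1 - w^2|], the denominator cancels the factor [1 - |w|^2] from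
    [Schwarz_Pick_pow]. *)
Lemma log_derivative_Re_pos n Q p z p1 : (1 <= n)%nat -> hjet Q ->
  (forall z, in_disc z -> p z = 1 + z ^ n * Q z)%C ->
  (forall z, in_disc z -> 0 < Re (p z)) -> in_disc z -> has_der p z p1 ->
  Cmod (z * p1 / p z) * (1 - (Cmod z ^ n) ^ 2) <= 2 * INR n * Cmod z ^ n.
Proof.
  intros Hn JQ Ep Hp Hz D.
  assert (N1 : forall z, in_disc z -> (p z + 1)%C <> 0%C).
  { intros c Hc; apply Re_pos_neq0; specialize (Hp c Hc); simpl; unfold Re in *; lra. }
  assert (N0 : forall z, in_disc z -> p z <> 0%C) by (intros; apply Re_pos_neq0; auto).
  assert (Jp : forall c, in_disc c -> forall k, jet k p c).
  { intros c Hc k; apply jet_ext with (fun z => 1 + z ^ n * Q z)%C.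
    - eapply near_mono, (near_disc c 1 Hc); simpl; intros; symmetry; auto.
    - apply jet_plus; [apply jet_const | apply jet_mult; [apply jet_pow, jet_id | auto]]. }
  set (w := fun z => ((p z + - (1)) / (p z + 1))%C).
  assert (W1 : forall z, in_disc z -> Cmod (w z) < 1).
  { intros c Hc; unfold w; rewrite Cmod_div by auto.
    assert (P : 0 < Cmod (p c + 1)) by (apply Cmod_gt_0; auto).
    apply Rmult_lt_reg_r with (Cmod (p c + 1)); auto.
    unfold Rdiv; rewrite Rmult_assoc, Rinv_l, Rmult_1_l, Rmult_1_r by lra.
    apply Cmod_lt_of_sqr; rewrite !Cmod_sqr; specialize (Hp c Hc).
    destruct (p c) as [a b]; simpl in *; nra. }
  assert (Dw : has_der w z (((p1 + 0) * (p z + 1) - (p z + - (1)) * (p1 + 0))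
                             / ((p z + 1) * (p z + 1)))%C).
  { apply (has_der_div (fun z => p z + - (1))%C (fun z => p z + 1)%C); auto.
    - apply (has_der_plus p (fun _ => (- (1))%C)); auto; apply has_der_const.
    - apply (has_der_plus p (fun _ => RtoC 1)); auto; apply has_der_const. }
  assert (Jphi : hjet (fun z => Q z / (p z + 1))%C).
  { apply hjet_div; auto; apply (hjet_plus p (fun _ => RtoC 1)); auto; apply hjet_const. }
  assert (Ew : forall c, in_disc c -> w c = (c ^ n * (Q c / (p c + 1)))%C).
  { intros c Hc; unfold w; rewrite (Ep c Hc) at 1; field; auto. }
  destruct (Schwarz_Pick_pow n _ w z _ Hn Jphi Ew (fun c Hc => Rlt_le _ _ (W1 c Hc)) Hz Dw)
    as [_ B].
  specialize (W1 z Hz); pose proof (Cmod_ge_0 (w z)) as W0.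
  set (m := (((p1 + 0) * (p z + 1) - (p z + - (1)) * (p1 + 0)) / ((p z + 1) * (p z + 1)))%C) in *.
  assert (G : 1 - Cmod (w z) ^ 2 <= Cmod (1 - w z * w z)).
  { pose proof (one_minus_Cmod_le (w z * w z)); rewrite Cmod_mult in H; simpl; lra. }
  assert (P : 0 < 1 - Cmod (w z) ^ 2) by nra.
  assert (E : (z * p1 / p z = 2 * (z * m) / (1 - w z * w z))%C).
  { assert (E1 : (1 - w z * w z = 4 * p z / ((p z + 1) * (p z + 1)))%C) by (unfold w; field; auto).
    assert (E2 : (m = 2 * p1 / ((p z + 1) * (p z + 1)))%C) by (unfold m; field; auto).
    rewrite E1, E2; field; repeat split; auto; intros H; apply RtoC_inj in H; lra. }
  assert (Nw : (1 - w z * w z)%C <> 0%C) by (apply Cmod_neq0; lra).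
  rewrite E, Cmod_div, !Cmod_mult, Cmod_R, Rabs_pos_eq by (auto; lra).
  rewrite Cmod_mult in B.
  set (A := Cmod z * Cmod m) in *; set (d := Cmod (1 - w z * w z)) in *.
  apply Rmult_le_reg_r with d; [lra|].
  replace (2 * A / d * (1 - (Cmod z ^ n) ^ 2) * d) with (2 * (A * (1 - (Cmod z ^ n) ^ 2)))
    by (field; lra).
  assert (0 <= INR n * Cmod z ^ n)
    by (apply Rmult_le_pos; [apply pos_INR | apply pow_le, Cmod_ge_0]).
  nra.
Qed.

(** Now [p = 1 / (1 - w)], so [z p'/p = z w' / (1 - w)]. As [1 - |w| <= |1 - w|], the factor
    [1 - |w|^2] leaves [1 + |w|], at most [1 + |z|^n]. *)
Lemma log_derivative_Re_gt_half n Q p z p1 : (1 <= n)%nat -> hjet Q ->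
  (forall z, in_disc z -> p z = 1 + z ^ n * Q z)%C ->
  (forall z, in_disc z -> 1 / 2 < Re (p z)) -> in_disc z -> has_der p z p1 ->
  Cmod (z * p1 / p z) * (1 - (Cmod z ^ n) ^ 2) <= INR n * Cmod z ^ n * (1 + Cmod z ^ n).
Proof.
  intros Hn JQ Ep Hp Hz D.
  assert (N0 : forall z, in_disc z -> p z <> 0%C)
    by (intros c Hc; apply Re_pos_neq0; specialize (Hp c Hc); lra).
  assert (Jp : forall c, in_disc c -> forall k, jet k p c).
  { intros c Hc k; apply jet_ext with (fun z => 1 + z ^ n * Q z)%C.
    - eapply near_mono, (near_disc c 1 Hc); simpl; intros; symmetry; auto.
    - apply jet_plus; [apply jet_const | apply jet_mult; [apply jet_pow, jet_id | auto]]. }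
  set (w := fun z => ((p z + - (1)) / p z)%C).
  assert (W1 : forall z, in_disc z -> Cmod (w z) < 1).
  { intros c Hc; unfold w; rewrite Cmod_div by auto.
    assert (P : 0 < Cmod (p c)) by (apply Cmod_gt_0; auto).
    apply Rmult_lt_reg_r with (Cmod (p c)); auto.
    unfold Rdiv; rewrite Rmult_assoc, Rinv_l, Rmult_1_l, Rmult_1_r by lra.
    apply Cmod_lt_of_sqr; rewrite !Cmod_sqr; specialize (Hp c Hc).
    destruct (p c) as [a b]; simpl in *; nra. }
  assert (Dw : has_der w z (((p1 + 0) * p z - (p z + - (1)) * p1) / (p z * p z))%C).
  { apply (has_der_div (fun z => p z + - (1))%C p); auto.
    apply (has_der_plus p (fun _ => (- (1))%C)); auto; apply has_der_const. }
  assert (Jphi : hjet (fun z => Q z / p z)%C) by (apply hjet_div; auto).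
  assert (Ew : forall c, in_disc c -> w c = (c ^ n * (Q c / p c))%C).
  { intros c Hc; unfold w; rewrite (Ep c Hc) at 1; field; auto. }
  destruct (Schwarz_Pick_pow n _ w z _ Hn Jphi Ew (fun c Hc => Rlt_le _ _ (W1 c Hc)) Hz Dw)
    as [Wx B].
  specialize (W1 z Hz); pose proof (Cmod_ge_0 (w z)) as W0.
  set (m := (((p1 + 0) * p z - (p z + - (1)) * p1) / (p z * p z))%C) in *.
  pose proof (one_minus_Cmod_le (w z)) as G.
  assert (E : (z * p1 / p z = (z * m) / (1 - w z))%C).
  { assert (E1 : (1 - w z = / p z)%C) by (unfold w; field; auto).
    assert (E2 : (m = p1 / (p z * p z))%C) by (unfold m; field; auto).
    rewrite E1, E2; field; auto using C1_nz. }
  assert (Nw : (1 - w z)%C <> 0%C) by (apply Cmod_neq0; lra).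
  rewrite E, Cmod_div by auto.
  set (A := Cmod (z * m)) in *; set (d := Cmod (1 - w z)) in *.
  apply Rmult_le_reg_r with d; [lra|].
  replace (A / d * (1 - (Cmod z ^ n) ^ 2) * d) with (A * (1 - (Cmod z ^ n) ^ 2))
    by (field; lra).
  assert (K : 0 <= INR n * Cmod z ^ n)
    by (apply Rmult_le_pos; [apply pos_INR | apply pow_le, Cmod_ge_0]).
  eapply Rle_trans; [exact B|].
  rewrite (Rmult_assoc (INR n * Cmod z ^ n)); apply Rmult_le_compat_l; auto.
  replace (1 - Cmod (w z) ^ 2) with ((1 + Cmod (w z)) * (1 - Cmod (w z))) by ring.
  apply Rmult_le_compat; lra.
Qed.

(** * The complex exponential and hyperbolic functions *)

Lemma Rabs_sin_le x : Rabs (sin x) <= Rabs x.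
Proof.
  destruct (Rtotal_order x 0) as [L|[->|G]].
  - rewrite (Rabs_left x) by lra; pose proof (sin_gt_x x L).
    unfold Rabs; destruct Rcase_abs; [lra|].
    pose proof (sin_lt_x (- x) ltac:(lra)) as K; rewrite sin_neg in K.
    destruct (Rle_lt_dec (- PI) x) as [P|P].
    + pose proof (sin_ge_0 (- x) ltac:(lra) ltac:(lra)) as S; rewrite sin_neg in S; lra.
    + pose proof (SIN_bound x); pose proof PI2_3_2; unfold PI2 in *; lra.
  - rewrite sin_0; lra.
  - rewrite (Rabs_pos_eq x) by lra; pose proof (sin_lt_x x G).
    unfold Rabs; destruct Rcase_abs; [|lra].
    destruct (Rle_lt_dec x PI) as [P|P].
    + pose proof (sin_ge_0 x ltac:(lra) ltac:(lra)); lra.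
    + pose proof (SIN_bound x); pose proof PI2_3_2; unfold PI2 in *; lra.
Qed.

Lemma one_minus_cos_bound y : 0 <= 1 - cos y <= y ^ 2 / 2.
Proof.
  replace (1 - cos y) with (2 * (sin (y / 2)) ^ 2).
  2:{ replace y with (2 * (y / 2)) at 2 by field; rewrite cos_2a_sin; simpl; ring. }
  pose proof (Rabs_sin_le (y / 2)) as H; apply Rsqr_le_abs_1 in H; unfold Rsqr in H.
  pose proof (pow2_ge_0 (sin (y / 2))); simpl in *; lra.
Qed.

Lemma sin_minus_id_bound y : Rabs y <= 1 -> Rabs (sin y - y) <= y ^ 2.
Proof.
  intros Hy.
  destruct (MVT_cor4 (fun t => sin t - t) (fun t => cos t - 1) 0 1) with (b := y) as [c [E L]].
  - intros t _; auto_derive; auto; ring.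
  - rewrite Rminus_0_r; auto.
  - rewrite !Rminus_0_r, sin_0 in *; rewrite Rminus_0_r in E; rewrite E, Rabs_mult.
    pose proof (one_minus_cos_bound c) as B.
    rewrite (Rabs_minus_sym (cos c)), (Rabs_pos_eq (1 - cos c)) by lra.
    rewrite <- (pow2_abs y); rewrite <- (pow2_abs c) in B.
    pose proof (Rabs_pos c); pose proof (Rabs_pos y); simpl in *; nra.
Qed.

Lemma exp_taylor_bound x : Rabs x <= 1 / 2 -> 0 <= exp x - 1 - x <= 2 * x ^ 2.
Proof.
  intros Hx; apply Rabs_le_between in Hx; pose proof (exp_ineq1_le x); split; [lra|].
  pose proof (exp_ineq1_le (- x)) as K.
  assert (E : exp x * exp (- x) = 1) by (rewrite <- exp_plus, Rplus_opp_r; apply exp_0).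
  pose proof (exp_pos x) as P.
  assert (exp x * (1 - x) <= 1) by nra.
  assert (1 <= (1 + x + 2 * x ^ 2) * (1 - x)) by (pose proof (pow2_ge_0 x); simpl in *; nra).
  assert (exp x <= 1 + x + 2 * x ^ 2); [|lra].
  apply Rmult_le_reg_r with (1 - x); lra.
Qed.

Definition Cexp (z : C) : C := (exp (Re z) * cos (Im z), exp (Re z) * sin (Im z)).
Definition Csinh (z : C) : C := ((Cexp z - Cexp (- z)) / 2)%C.
Definition Ccosh (z : C) : C := ((Cexp z + Cexp (- z)) / 2)%C.

Lemma Cexp_plus z w : Cexp (z + w) = (Cexp z * Cexp w)%C.
Proof.
  destruct z as [a b], w as [c d]; unfold Cexp; simpl; rewrite exp_plus, cos_plus, sin_plus.
  apply injective_projections; simpl; ring.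
Qed.

Lemma Cexp_0 : Cexp 0 = 1.
Proof. unfold Cexp; simpl; rewrite exp_0, cos_0, sin_0; apply injective_projections; simpl; ring. Qed.

Lemma Cexp_opp_r z : (Cexp z * Cexp (- z) = 1)%C.
Proof. rewrite <- Cexp_plus, Cplus_opp_r; apply Cexp_0. Qed.

Lemma Cexp_taylor_bound h : Cmod h <= 1 / 2 -> Cmod (Cexp h - 1 - h) <= 6 * Cmod h ^ 2.
Proof.
  intros H; pose proof (Rmax_Cmod h) as M; rewrite Cmod_sqr.
  destruct h as [x y]; unfold Cexp in *; simpl Re in *; simpl Im in *; simpl fst in *; simpl snd in *.
  assert (X : Rabs x <= 1 / 2) by (eapply Rle_trans; [apply Rmax_l | eapply Rle_trans; eauto]).
  assert (Y : Rabs y <= 1 / 2) by (eapply Rle_trans; [apply Rmax_r | eapply Rle_trans; eauto]).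
  pose proof (exp_taylor_bound x X) as Ex; pose proof (one_minus_cos_bound y) as Cy.
  pose proof (sin_minus_id_bound y ltac:(lra)) as Sy; pose proof (Rabs_sin_le y) as Sa.
  pose proof (Rabs_pos x) as X0; pose proof (Rabs_pos y) as Y0.
  rewrite <- (pow2_abs x) in *; rewrite <- (pow2_abs y) in *.
  assert (Ebd : exp x <= 2)
    by (pose proof (Rle_abs x); assert (Rabs x ^ 2 <= 1 / 4) by (simpl; nra); lra).
  assert (Ex1 : Rabs (exp x - 1) <= 2 * Rabs x).
  { replace (exp x - 1) with ((exp x - 1 - x) + x) by ring.
    eapply Rle_trans; [apply Rabs_triang|]; rewrite (Rabs_pos_eq (exp x - 1 - x)) by lra.
    simpl in *; nra. }
  eapply Rle_trans; [apply Cmod_le_abs_sum|]; simpl.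
  replace (exp x * cos y + - (1) + - x) with ((exp x - 1 - x) + - (exp x * (1 - cos y))) by ring.
  replace (exp x * sin y + - 0 + - y) with ((exp x - 1) * sin y + (sin y - y)) by ring.
  pose proof (Rabs_triang (exp x - 1 - x) (- (exp x * (1 - cos y)))) as T1.
  pose proof (Rabs_triang ((exp x - 1) * sin y) (sin y - y)) as T2.
  rewrite Rabs_Ropp, (Rabs_pos_eq (exp x - 1 - x)), Rabs_mult in T1 by lra.
  rewrite (Rabs_pos_eq (exp x)), (Rabs_pos_eq (1 - cos y)) in T1 by (try lra; left; apply exp_pos).
  rewrite Rabs_mult in T2.
  assert (A1 : exp x * (1 - cos y) <= 2 * (Rabs y ^ 2 / 2)) by (pose proof (exp_pos x); apply Rmult_le_compat; lra).
  assert (A2 : Rabs (exp x - 1) * Rabs (sin y) <= 2 * Rabs x * Rabs y)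
    by (apply Rmult_le_compat; auto; apply Rabs_pos).
  pose proof (pow2_ge_0 (Rabs x - Rabs y)); simpl in *; nra.
Qed.

(** The addition formula moves the expansion from [w] to 0, where [Cexp_taylor_bound] bounds the
    remainder divided by [h^2]. *)
Lemma has_der_Cexp w : has_der Cexp w (Cexp w).
Proof.
  set (g := fun h => if Ceq_dec h 0 then RtoC 0 else ((Cexp h - 1 - h) / (h * h))%C).
  exists (fun z => Cexp w * g (z - w)%C)%C; split.
  - apply near_all; intros z; unfold g.
    replace (Cexp z) with (Cexp w * Cexp (z - w))%C by (rewrite <- Cexp_plus; f_equal; ring).
    destruct (Ceq_dec (z - w)%C 0) as [E|N]; [rewrite E, Cexp_0; ring | field; auto].
  - apply bdd_mult; [apply bdd_const|].
    exists 6, (1 / 2); split; [lra|]; intros z Hz; unfold g.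
    destruct (Ceq_dec (z - w)%C 0) as [E|N]; [rewrite Cmod_0; lra|].
    rewrite Cmod_div, Cmod_mult by (apply Cmult_neq_0; auto).
    pose proof (Cexp_taylor_bound (z - w) ltac:(lra)) as B.
    apply Cmod_gt_0 in N; set (d := Cmod (z - w)) in *.
    apply Rmult_le_reg_r with (d * d); [now apply Rmult_lt_0_compat|].
    unfold Rdiv; rewrite Rmult_assoc, Rinv_l, Rmult_1_r; [simpl in B; lra | nra].
Qed.

Lemma has_der_Csinh w : has_der Csinh w (Ccosh w).
Proof.
  unfold Csinh, Ccosh.
  assert (O : has_der (fun z => - z)%C w (- (1))%C).
  { replace (- (1))%C with (0 * w + (- (1)) * 1)%C by ring.
    apply has_der_ext with (fun z => (- (1)) * z)%C; [apply near_all; intros; ring|].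
    exact (has_der_mult _ _ _ _ _ (has_der_const (- (1))%C w) (has_der_id w)). }
  pose proof (has_der_comp _ _ _ _ _ (has_der_Cexp (- w)%C) O) as E.
  pose proof (has_der_mult _ _ _ _ _ (has_der_const (/ 2) w)
    (has_der_plus _ _ _ _ _ (has_der_Cexp w)
      (has_der_mult _ _ _ _ _ (has_der_const (- (1)) w) E))) as H.
  cbv beta in H.
  replace ((Cexp w + Cexp (- w)) / 2)%C with
    (0 * (Cexp w + - (1) * Cexp (- w)) + / 2 * (Cexp w + (0 * Cexp (- w) + - (1) * (Cexp (- w) * - (1)))))%C.
  - eapply has_der_ext, H; apply near_all; intros; unfold Cdiv; ring.
  - unfold Cdiv; ring.
Qed.

Lemma Csinh_eq z : Csinh z = (sinh (Re z) * cos (Im z), cosh (Re z) * sin (Im z)).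
Proof.
  destruct z as [x y]; unfold Csinh, Cexp, sinh, cosh; simpl; rewrite cos_neg, sin_neg.
  apply injective_projections; simpl; field.
Qed.

Lemma Ccosh_eq z : Ccosh z = (cosh (Re z) * cos (Im z), sinh (Re z) * sin (Im z)).
Proof.
  destruct z as [x y]; unfold Ccosh, Cexp, sinh, cosh; simpl; rewrite cos_neg, sin_neg.
  apply injective_projections; simpl; field.
Qed.

Lemma Csinh_RtoC t : Csinh (RtoC t) = RtoC (sinh t).
Proof. rewrite Csinh_eq; simpl; rewrite cos_0, sin_0; apply injective_projections; simpl; ring. Qed.

Lemma Ccosh_sqr z : (Ccosh z * Ccosh z = 1 + Csinh z * Csinh z)%C.
Proof.
  unfold Ccosh, Csinh; pose proof (Cexp_opp_r z) as E.
  set (a := Cexp z) in *; set (b := Cexp (- z)) in *.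
  replace (RtoC 1) with (a * b)%C by exact E; field.
Qed.

Lemma cosh_ge_1 x : 1 <= cosh x.
Proof.
  unfold cosh; assert (E : exp x * exp (- x) = 1) by (rewrite <- exp_plus, Rplus_opp_r; apply exp_0).
  pose proof (exp_pos x); pose proof (exp_pos (- x)).
  pose proof (pow2_ge_0 (exp x - exp (- x))); simpl in *; nra.
Qed.

Lemma sinh_ge_id t : 0 <= t -> t <= sinh t.
Proof.
  intros Ht; destruct (Rle_lt_or_eq_dec 0 t Ht) as [P|<-]; [|rewrite sinh_0; lra].
  destruct (MVT_cor2 sinh cosh 0 t P) as [c [E _]].
  - intros; apply derivable_pt_lim_sinh.
  - rewrite sinh_0 in E; pose proof (cosh_ge_1 c); nra.
Qed.

Lemma cosh_incr x y : 0 <= x <= y -> cosh x <= cosh y.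
Proof.
  intros [H L]; destruct (Rle_lt_or_eq_dec x y L) as [P|<-]; [|lra].
  destruct (MVT_cor2 cosh sinh x y P) as [c [E [C1 C2]]].
  - intros; apply derivable_pt_lim_cosh.
  - pose proof (sinh_ge_id c ltac:(lra)); nra.
Qed.

(** Convexity of [sinh] on the half-line together with [sinh 0 = 0], by the mean value theorem on
    either side of [t s]. It turns [|q(z)| <= |z| asinh 1] into the bound [|z|] for [sinh q(z)]. *)
Lemma sinh_scale t s : 0 <= t <= 1 -> 0 < s -> sinh (t * s) <= t * sinh s.
Proof.
  intros Ht Hs.
  destruct (Req_dec t 0) as [->|T0]; [rewrite !Rmult_0_l, sinh_0; lra|].
  destruct (Req_dec t 1) as [->|T1]; [rewrite !Rmult_1_l; lra|].
  assert (P1 : 0 < t * s) by (apply Rmult_lt_0_compat; lra).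
  assert (P2 : t * s < s) by nra.
  destruct (MVT_cor2 sinh cosh 0 (t * s) P1) as [c [E [C1 C2]]];
    [intros; apply derivable_pt_lim_sinh|].
  destruct (MVT_cor2 sinh cosh (t * s) s P2) as [d [F [D1 D2]]];
    [intros; apply derivable_pt_lim_sinh|].
  rewrite sinh_0, !Rminus_0_r in E; pose proof (cosh_incr c d ltac:(lra)) as I.
  assert (t * (sinh s - sinh (t * s)) >= (1 - t) * sinh (t * s)); [|lra].
  rewrite F, E.
  replace (t * (cosh d * (s - t * s))) with (cosh d * (t * s) * (1 - t)) by ring.
  replace ((1 - t) * (cosh c * (t * s))) with (cosh c * (t * s) * (1 - t)) by ring.
  apply Rle_ge; do 2 (apply Rmult_le_compat_r; [lra|]); exact I.
Qed.

(** For [w = x + i y] and [r = |w|], [|sinh w|^2 = sinh^2 x + sin^2 y], while [sinh^2 r - sinh^2 x =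
    sinh (r + |x|) sinh (r - |x|) >= r^2 - x^2 = y^2 >= sin^2 y]. *)
Lemma Cmod_Csinh_le w : Cmod (Csinh w) <= sinh (Cmod w).
Proof.
  pose proof (Cmod_ge_0 w) as W0; pose proof (sinh_ge_id _ W0) as S0.
  apply Rsqr_incr_0_var; [|lra]; rewrite !Rsqr_pow2, Cmod_sqr, Csinh_eq; simpl Re; simpl Im.
  pose proof (Cmod_sqr w) as M; set (r := Cmod w) in *.
  destruct w as [x y]; simpl Re in *; simpl Im in *.
  assert (Id : sinh r ^ 2 - sinh (Rabs x) ^ 2 = sinh (r + Rabs x) * sinh (r - Rabs x)).
  { unfold sinh, Rminus; rewrite !Ropp_plus_distr, !Ropp_involutive, !exp_plus.
    assert (E1 : exp r * exp (- r) = 1) by (rewrite <- exp_plus, Rplus_opp_r; apply exp_0).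
    assert (E2 : exp (Rabs x) * exp (- Rabs x) = 1) by (rewrite <- exp_plus, Rplus_opp_r; apply exp_0).
    set (a := exp r) in *; set (a' := exp (- r)) in *.
    set (b := exp (Rabs x)) in *; set (b' := exp (- Rabs x)) in *.
    transitivity ((a ^ 2 + a' ^ 2 - b ^ 2 - b' ^ 2 - 2 * (a * a') + 2 * (b * b')) / 4); [simpl; field|].
    transitivity ((a ^ 2 * (b * b') + a' ^ 2 * (b * b') - (a * a') * b ^ 2 - (a * a') * b' ^ 2) / 4);
      [rewrite E1, E2; field | simpl; field]. }
  assert (Ax : sinh (Rabs x) ^ 2 = sinh x ^ 2).
  { unfold Rabs; destruct Rcase_abs; auto.
    unfold sinh; rewrite Ropp_involutive; simpl; field. }
  assert (Rx : Rabs x <= r).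
  { apply Rsqr_incr_0_var; auto; rewrite !Rsqr_pow2, pow2_abs, M; pose proof (pow2_ge_0 y); lra. }
  pose proof (Rabs_pos x) as X0.
  assert (K : (r + Rabs x) * (r - Rabs x) <= sinh (r + Rabs x) * sinh (r - Rabs x)).
  { apply Rmult_le_compat; try lra; apply sinh_ge_id; lra. }
  replace ((r + Rabs x) * (r - Rabs x)) with (r ^ 2 - Rabs x ^ 2) in K by ring.
  rewrite pow2_abs, M in K.
  pose proof (Rabs_sin_le y) as Sy; apply Rsqr_le_abs_1 in Sy; rewrite !Rsqr_pow2 in Sy.
  replace ((sinh x * cos y) ^ 2 + (cosh x * sin y) ^ 2) with (sinh x ^ 2 + sin y ^ 2); [lra|].
  assert (Ch : cosh x ^ 2 = 1 + sinh x ^ 2).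
  { unfold cosh, sinh; assert (E1 : exp x * exp (- x) = 1)
      by (rewrite <- exp_plus, Rplus_opp_r; apply exp_0).
    transitivity (exp x * exp (- x) + ((exp x - exp (- x)) / 2) ^ 2); [simpl; field | rewrite E1; auto]. }
  pose proof (sin2_cos2 y) as SC; rewrite !Rsqr_pow2 in SC.
  rewrite !Rpow_mult_distr, Ch; replace (cos y ^ 2) with (1 - sin y ^ 2) by lra; ring.
Qed.

(** * The principal branches *)

Lemma Carg_spec (z : C) : z <> 0%C -> Re z = Cmod z * cos (Carg z) /\ Im z = Cmod z * sin (Carg z).
Proof.
  intros N; apply Cmod_gt_0 in N; pose proof (Cmod_sqr z) as M.
  set (r := Cmod z) in *.
  assert (B : -1 <= Re z / r <= 1).
  { assert (X : Rabs (Re z / r) <= 1); [|now apply Rabs_le_between in X].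
    unfold Rdiv; rewrite Rabs_mult, (Rabs_pos_eq (/ r)) by (left; now apply Rinv_0_lt_compat).
    apply Rmult_le_reg_r with r; auto; rewrite Rmult_assoc, Rinv_l, Rmult_1_r, Rmult_1_l by lra.
    apply Rsqr_incr_0_var; [|lra]; rewrite !Rsqr_pow2, pow2_abs, M.
    pose proof (pow2_ge_0 (Im z)); lra. }
  assert (S : r * sqrt (1 - (Re z / r)²) = Rabs (Im z)).
  { rewrite <- (sqrt_Rsqr r) at 1 by lra; rewrite <- sqrt_mult_alt by apply Rle_0_sqr.
    rewrite <- sqrt_Rsqr_abs; f_equal; rewrite !Rsqr_pow2.
    replace (r ^ 2 * (1 - (Re z / r) ^ 2)) with (r ^ 2 - Re z ^ 2) by (simpl; field; lra).
    rewrite M; ring. }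
  unfold Carg; fold r; destruct Rle_dec as [P|P].
  - rewrite cos_acos, sin_acos, S, Rabs_pos_eq by auto; split; [field; lra | auto].
  - rewrite cos_neg, sin_neg, cos_acos, sin_acos by auto; split; [field; lra|].
    rewrite Ropp_mult_distr_r_reverse, S, Rabs_left; lra.
Qed.

Lemma Carg_bound z : - PI <= Carg z <= PI.
Proof.
  pose proof (acos_bound (Re z / Cmod z)); unfold Carg; destruct Rle_dec; lra.
Qed.

Lemma Cmod_Cexp w : Cmod (Cexp w) = exp (Re w).
Proof.
  pose proof (exp_pos (Re w)) as E.
  apply Rsqr_inj; [apply Cmod_ge_0 | lra|].
  rewrite !Rsqr_pow2, Cmod_sqr; unfold Cexp; simpl Re; simpl Im.
  pose proof (sin2_cos2 (Im w)) as SC; rewrite !Rsqr_pow2 in SC.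
  transitivity (exp (Re w) ^ 2 * (sin (Im w) ^ 2 + cos (Im w) ^ 2)); [ring | rewrite SC; ring].
Qed.

Lemma Carg_Cexp w : - PI < Im w < PI -> Carg (Cexp w) = Im w.
Proof.
  intros H; pose proof (exp_pos (Re w)) as E; unfold Carg; rewrite Cmod_Cexp.
  unfold Cexp; simpl Re; simpl Im.
  replace (exp (Re w) * cos (Im w) / exp (Re w)) with (cos (Im w)) by (field; lra).
  destruct (Rle_lt_dec 0 (Im w)) as [P|P].
  - pose proof (sin_ge_0 (Im w) P ltac:(lra)).
    destruct Rle_dec as [_|X]; [apply acos_cos; lra|].
    exfalso; apply X; apply Rmult_le_pos; lra.
  - pose proof (sin_gt_0 (- Im w) ltac:(lra) ltac:(lra)) as S; rewrite sin_neg in S.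
    destruct Rle_dec as [X|_]; [nra|].
    rewrite <- cos_neg, acos_cos; lra.
Qed.

Lemma Cexp_Clog (z : C) : z <> 0%C -> Cexp (Clog z) = z.
Proof.
  intros N; destruct (Carg_spec z N) as [A B]; apply Cmod_gt_0 in N.
  unfold Cexp, Clog; simpl; rewrite exp_ln by auto.
  apply injective_projections; simpl; [rewrite <- A | rewrite <- B]; reflexivity.
Qed.

Lemma Clog_Cexp w : - PI < Im w < PI -> Clog (Cexp w) = w.
Proof.
  intros H; unfold Clog; rewrite Cmod_Cexp, ln_exp, Carg_Cexp by auto; now destruct w.
Qed.

Lemma Csqrt_sqr z : (Csqrt z * Csqrt z = z)%C.
Proof.
  destruct (Ceq_dec z 0) as [->|N].
  - unfold Csqrt; rewrite Cmod_0, sqrt_0; apply injective_projections; simpl; ring.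
  - destruct (Carg_spec z N) as [A B]; pose proof (Cmod_ge_0 z) as Z0.
    pose proof (sqrt_sqrt _ Z0) as S.
    replace (Carg z) with (2 * (Carg z / 2)) in A, B by field.
    rewrite cos_2a in A; rewrite sin_2a in B.
    unfold Csqrt; set (q := sqrt (Cmod z)) in *; set (t := Carg z / 2) in *.
    apply injective_projections; simpl.
    + change (fst z) with (Re z); rewrite A, <- S; ring.
    + change (snd z) with (Im z); rewrite B, <- S; ring.
Qed.

Lemma Re_Csqrt_ge0 z : 0 <= Re (Csqrt z).
Proof.
  unfold Csqrt; simpl; pose proof (Carg_bound z); apply Rmult_le_pos; [apply sqrt_pos|].
  apply cos_ge_0; lra.
Qed.

Lemma Csqrt_unique (z c : C) : (c * c = z)%C -> 0 < Re c -> Csqrt z = c.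
Proof.
  intros H P; pose proof (Re_Csqrt_ge0 z) as S; pose proof (Csqrt_sqr z) as E.
  assert (K : ((Csqrt z - c) * (Csqrt z + c) = 0)%C).
  { replace ((Csqrt z - c) * (Csqrt z + c))%C with (Csqrt z * Csqrt z - c * c)%C by ring.
    rewrite E, H; ring. }
  assert (N : (Csqrt z + c)%C <> 0%C) by (apply Re_pos_neq0; change (0 < Re (Csqrt z) + Re c); lra).
  apply Ceq_minus; destruct (Ceq_dec (Csqrt z - c)%C 0); auto.
  exfalso; revert K; now apply Cmult_neq_0.
Qed.

(** The argument of the logarithm in [Casinh] is invertible for every [z]; hence
    [Csinh (Casinh z) = z] holds on all of [C], branch cuts included. *)
Lemma Casinh_den z : ((z + Csqrt (1 + z * z)) * (Csqrt (1 + z * z) - z) = 1)%C.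
Proof.
  pose proof (Csqrt_sqr (1 + z * z)%C) as E; set (s := Csqrt _) in *.
  replace ((z + s) * (s - z))%C with (s * s - z * z)%C by ring; rewrite E; ring.
Qed.

Lemma Cexp_Casinh z : Cexp (Casinh z) = (z + Csqrt (1 + z * z))%C /\
  Cexp (- Casinh z) = (Csqrt (1 + z * z) - z)%C.
Proof.
  pose proof (Casinh_den z) as D.
  assert (N : (z + Csqrt (1 + z * z))%C <> 0%C).
  { intros H; rewrite H, Cmult_0_l in D; now apply C1_nz. }
  assert (E : Cexp (Casinh z) = (z + Csqrt (1 + z * z))%C) by (apply Cexp_Clog; auto).
  split; auto; pose proof (Cexp_opp_r (Casinh z)) as O; rewrite E in O.
  set (s := Csqrt _) in *.
  transitivity ((z + s) * (s - z) * Cexp (- Casinh z))%C; [rewrite D; ring|].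
  replace ((z + s) * (s - z) * Cexp (- Casinh z))%C
    with (((z + s) * Cexp (- Casinh z)) * (s - z))%C by ring.
  rewrite O; ring.
Qed.

Lemma Csinh_Casinh z : Csinh (Casinh z) = z.
Proof. destruct (Cexp_Casinh z) as [E F]; unfold Csinh; rewrite E, F; field. Qed.

Lemma Ccosh_Casinh z : Ccosh (Casinh z) = Csqrt (1 + z * z).
Proof. destruct (Cexp_Casinh z) as [E F]; unfold Ccosh; rewrite E, F; field. Qed.

(** In this strip [cosh w] has positive real part, so it is the principal root of [1 + sinh^2 w],
    and the logarithm is then taken of [exp w]. *)
Lemma Casinh_Csinh w : - (PI / 2) < Im w < PI / 2 -> Casinh (Csinh w) = w.
Proof.
  intros H; unfold Casinh.
  rewrite (Csqrt_unique _ (Ccosh w)).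
  - replace (Csinh w + Ccosh w)%C with (Cexp w) by (unfold Csinh, Ccosh; field).
    apply Clog_Cexp; lra.
  - apply Ccosh_sqr.
  - rewrite Ccosh_eq; simpl; apply Rmult_lt_0_compat.
    + pose proof (cosh_ge_1 (Re w)); unfold Re in *; lra.
    + apply cos_gt_0; unfold Im in *; lra.
Qed.

(** * Analyticity of [Casinh] *)

Definition rcont (g : C -> R) (c : C) : Prop :=
  forall eps : R, 0 < eps -> near c (fun z => Rabs (g z - g c) < eps).

Lemma rcont_plus f g c : rcont f c -> rcont g c -> rcont (fun z => f z + g z) c.
Proof.
  intros F G eps He; eapply near_mono, near_and;
    [| exact (F (eps / 2) ltac:(lra)) | exact (G (eps / 2) ltac:(lra))].
  simpl; intros z [A B]; replace (f z + g z - (f c + g c)) with ((f z - f c) + (g z - g c)) by ring.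
  eapply Rle_lt_trans; [apply Rabs_triang | lra].
Qed.

Lemma rcont_comp (phi : R -> R) g c : continuity_pt phi (g c) -> rcont g c ->
  rcont (fun z => phi (g z)) c.
Proof.
  intros P G eps He.
  destruct (proj1 (continuity_pt_locally phi (g c)) P (mkposreal _ He)) as [d Hd].
  eapply near_mono, (G d (cond_pos d)); simpl; intros z Hz; exact (Hd _ Hz).
Qed.

Lemma rcont_mult f g c : rcont f c -> rcont g c -> rcont (fun z => f z * g z) c.
Proof.
  intros F G.
  assert (Q : forall h, rcont h c -> rcont (fun z => (h z) ^ 2) c).
  { intros h H; apply (rcont_comp (fun x => x ^ 2)); auto; reg. }
  assert (S : forall k h, rcont h c -> rcont (fun z => k * h z) c).
  { intros k h H; apply (rcont_comp (fun x => k * x)); auto; reg. }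
  (* Polarisation reduces products to squares, which are compositions with a real function of one
     variable. *)
  assert (H : rcont (fun z => / 4 * ((f z + g z) ^ 2 + -1 * (f z + -1 * g z) ^ 2)) c).
  { apply S, rcont_plus; [|apply S]; apply Q, rcont_plus; auto. }
  intros eps He; eapply near_mono, (H eps He); simpl; intros z Hz.
  replace (f z * g z - f c * g c) with
    (/ 4 * ((f z + g z) ^ 2 + -1 * (f z + -1 * g z) ^ 2) -
     / 4 * ((f c + g c) ^ 2 + -1 * (f c + -1 * g c) ^ 2)) by field; exact Hz.
Qed.

Lemma rcont_ext f g c : near c (fun z => f z = g z) -> rcont f c -> rcont g c.
Proof.
  intros E F eps He; pose proof (near_at _ _ E) as Ec; simpl in Ec.
  eapply near_mono, near_and; [| exact E | exact (F eps He)].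
  simpl; intros z [A B]; congruence.
Qed.

Lemma Rabs_Re_le z : Rabs (Re z) <= Cmod z.
Proof. eapply Rle_trans; [apply (Rmax_l _ (Rabs (snd z))) | apply Rmax_Cmod]. Qed.

Lemma Rabs_Im_le z : Rabs (Im z) <= Cmod z.
Proof. eapply Rle_trans; [apply (Rmax_r (Rabs (fst z))) | apply Rmax_Cmod]. Qed.

Lemma rcont_Re c : rcont Re c.
Proof.
  intros eps He; exists eps; split; auto; intros z Hz.
  pose proof (Rabs_Re_le (z - c)); simpl in *; unfold Re, Rminus in *; lra.
Qed.

Lemma rcont_Im c : rcont Im c.
Proof.
  intros eps He; exists eps; split; auto; intros z Hz.
  pose proof (Rabs_Im_le (z - c)); simpl in *; unfold Im, Rminus in *; lra.
Qed.

Lemma cont_at_of_rcont (f g : C -> R) c : rcont f c -> rcont g c ->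
  cont_at (fun z => (f z, g z)) c.
Proof.
  intros F G eps He; eapply near_mono, near_and;
    [| exact (F (eps / 2) ltac:(lra)) | exact (G (eps / 2) ltac:(lra))].
  simpl; intros z [A B]; eapply Rle_lt_trans; [apply Cmod_le_abs_sum|]; simpl.
  unfold Rminus in *; lra.
Qed.

Lemma cont_at_comp f g c : cont_at g c -> cont_at f (g c) -> cont_at (fun z => f (g z)) c.
Proof. intros G F eps He; exact (cont_comp_near g c _ G (F eps He)). Qed.

Lemma cont_at_plus f g c : cont_at f c -> cont_at g c -> cont_at (fun z => f z + g z)%C c.
Proof.
  intros F G eps He; eapply near_mono, near_and;
    [| exact (F (eps / 2) ltac:(lra)) | exact (G (eps / 2) ltac:(lra))].
  simpl; intros z [A B].
  replace (f z + g z - (f c + g c))%C with ((f z - f c) + (g z - g c))%C by ring.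
  eapply Rle_lt_trans; [apply Cmod_triangle | lra].
Qed.

Lemma is_derive_continuity_pt f x l : is_derive f x l -> continuity_pt f x.
Proof. intros H; apply derivable_continuous_pt; exists l; now apply is_derive_Reals. Qed.

Lemma rcont_Cmod c : rcont Cmod c.
Proof.
  apply (rcont_comp sqrt (fun z => fst z ^ 2 + snd z ^ 2)).
  - apply continuity_pt_sqrt; pose proof (pow2_ge_0 (fst c)); pose proof (pow2_ge_0 (snd c)); lra.
  - apply rcont_plus; apply (rcont_comp (fun x => x ^ 2)); try reg; [apply rcont_Re | apply rcont_Im].
Qed.

(** The defining case split of [Carg] hides continuity across the positive real axis; on the right
    half-plane this formula exhibits it. *)
Lemma Carg_atan z : 0 < Re z -> Carg z = atan (Im z / Re z).
Proof.
  intros P; assert (N : z <> 0%C) by now apply Re_pos_neq0.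
  apply Cmod_gt_0 in N; pose proof (Cmod_sqr z) as M.
  pose proof (atan_bound (Im z / Re z)) as AB.
  set (t := atan (Im z / Re z)) in *.
  assert (E : z = Cexp (ln (Cmod z), t)).
  { assert (S : sqrt (1 + (Im z / Re z)²) = Cmod z / Re z).
    { apply Rsqr_inj; [apply sqrt_pos | left; now apply Rdiv_lt_0_compat|].
      rewrite Rsqr_sqrt by (pose proof (Rle_0_sqr (Im z / Re z)); lra).
      rewrite !Rsqr_pow2; unfold Rdiv; rewrite !Rpow_mult_distr, M; field; lra. }
    unfold Cexp; simpl; rewrite exp_ln by auto; unfold t; rewrite cos_atan, sin_atan, S.
    apply injective_projections; simpl; unfold Re, Im in *; field; lra. }
  rewrite E at 1; rewrite Carg_Cexp; simpl; lra.
Qed.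

Lemma rcont_Carg c : 0 < Re c -> rcont Carg c.
Proof.
  intros P; apply rcont_ext with (fun z => atan (Im z * / Re z)).
  - eapply near_mono, (rcont_Re c (Re c) P); simpl; intros z Hz.
    apply Rabs_lt_between in Hz; symmetry; apply Carg_atan; lra.
  - apply rcont_comp; [eapply is_derive_continuity_pt, is_derive_atan|].
    apply rcont_mult; [apply rcont_Im|]; apply (rcont_comp Rinv); [|apply rcont_Re].
    eapply is_derive_continuity_pt; auto_derive; [lra | reflexivity].
Qed.

Lemma cont_Clog c : 0 < Re c -> cont_at Clog c.
Proof.
  intros P; apply cont_at_of_rcont; [|now apply rcont_Carg].
  apply (rcont_comp ln); [|apply rcont_Cmod].
  eapply is_derive_continuity_pt, is_derive_ln; apply Cmod_gt_0; now apply Re_pos_neq0.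
Qed.

Lemma cont_Csqrt c : 0 < Re c -> cont_at Csqrt c.
Proof.
  intros P.
  assert (S : rcont (fun z => sqrt (Cmod z)) c).
  { apply (rcont_comp sqrt); [apply continuity_pt_sqrt, Cmod_ge_0 | apply rcont_Cmod]. }
  apply cont_at_of_rcont; apply rcont_mult; auto.
  - apply (rcont_comp (fun x => cos (x / 2))); [|now apply rcont_Carg].
    eapply is_derive_continuity_pt; auto_derive; auto.
  - apply (rcont_comp (fun x => sin (x / 2))); [|now apply rcont_Carg].
    eapply is_derive_continuity_pt; auto_derive; auto.
Qed.

Lemma Re_one_plus_sqr z : in_disc z -> 0 < Re (1 + z * z)%C.
Proof.
  intros H; unfold in_disc in H; pose proof (Cmod_ge_0 z); pose proof (Cmod_sqr z) as M.
  assert (Cmod z ^ 2 < 1) by (simpl; nra).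
  destruct z as [x y]; simpl in *; nra.
Qed.

(** With [q] the root, [q + z] and [q - z] are mutually inverse, so their real parts have the same
    sign ([A]), and these add up to [2 Re q > 0]. *)
Lemma Re_Casinh_arg z : in_disc z -> 0 < Re (z + Csqrt (1 + z * z))%C.
Proof.
  intros H; pose proof (Re_one_plus_sqr z H) as P.
  pose proof (Casinh_den z) as D; pose proof (Re_Csqrt_ge0 (1 + z * z)%C) as S.
  pose proof (Csqrt_sqr (1 + z * z)%C) as E; apply (f_equal Re) in E.
  set (q := Csqrt _) in *.
  pose proof (f_equal Re D) as D1; pose proof (f_equal Im D) as D2; clear D.
  set (p := Re (1 + z * z)%C) in *; clearbody p.
  destruct q as [q1 q2], z as [x y]; simpl in *.
  assert (Q : 0 < q1) by nra.
  set (a := x + q1) in *; set (b := y + q2) in *.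
  set (a' := q1 + - x) in *; set (b' := q2 + - y) in *.
  assert (A : a' * (a ^ 2 + b ^ 2) = a).
  { transitivity (a * (a * a' - b * b') + b * (a * b' + b * a')); [simpl; ring|].
    rewrite D1, D2; ring. }
  destruct (Rlt_le_dec 0 a) as [|L]; auto; exfalso.
  assert (A' : 0 < a') by (unfold a, a' in *; lra).
  pose proof (pow2_ge_0 a); pose proof (pow2_ge_0 b).
  assert (Z : a ^ 2 + b ^ 2 <= 0) by nra.
  assert (a = 0) by (simpl in *; nra); assert (b = 0) by (simpl in *; nra).
  rewrite H2, H3 in D1; lra.
Qed.

Lemma has_der_Casinh z : in_disc z -> has_der Casinh z (/ Csqrt (1 + z * z)).
Proof.
  intros H; rewrite <- Ccosh_Casinh.
  apply has_der_right_inverse with Csinh.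
  - unfold Casinh; apply (cont_at_comp Clog).
    + apply (cont_at_plus (fun z => z)).
      * eapply has_der_cont, has_der_id.
      * apply (cont_at_comp Csqrt (fun z => 1 + z * z)%C).
        -- eapply has_der_cont, has_der_plus; [apply has_der_const|].
           apply has_der_mult; apply has_der_id.
        -- apply cont_Csqrt, Re_one_plus_sqr, H.
    + apply cont_Clog, Re_Casinh_arg, H.
  - apply has_der_Csinh.
  - rewrite Ccosh_Casinh; intros E; pose proof (Csqrt_sqr (1 + z * z)%C) as S.
    rewrite E, Cmult_0_l in S; apply (Re_pos_neq0 _ (Re_one_plus_sqr z H)); auto.
  - apply near_all; apply Csinh_Casinh.
Qed.

(** * The class [class_A] as functions with a factor [z] *)

(** The factor [1 + z^n U] is [f / z] with its singularity at 0 removed; [hol U] records both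
    analyticity and the gap in the coefficients. *)
Definition has_factor (n : nat) (f U : C -> C) : Prop :=
  hol U /\ forall z, in_disc z -> (f z = z * (1 + z ^ n * U z))%C.

Lemma hol_factor n U : hol U -> hol (fun z => 1 + z ^ n * U z)%C.
Proof. intros H; apply (hol_plus (fun _ => RtoC 1)); [apply hol_const | now apply hol_monom]. Qed.

Lemma class_A_factor n f : (1 <= n)%nat -> class_A n f -> exists U, has_factor n f U.
Proof.
  intros Hn [_ [a [A0 [A1 [Ak Hf]]]]].
  assert (D : disc_coeffs a).
  { apply coeffs_of_cv; intros z Hz; exists (f z); now apply is_pseries_cv, Hf. }
  destruct (hol_of_coeffs _ (coeffs_tail a (S n) D)) as [U [HU CU]].
  exists U; split; auto; intros z Hz.
  apply cv_unique with (psum a z); [now apply is_pseries_cv, Hf|].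
  rewrite <- (cv_shift _ _ (S n)).
  replace (z * (1 + z ^ n * U z))%C with (z + z ^ S n * U z)%C by (rewrite Cpow_S; ring).
  apply cv_ext with (fun m => z + z ^ S n * psum (fun k => a (S n + k)%nat) z m)%C.
  - intros m; rewrite psum_shift; f_equal.
    destruct n as [|n]; [lia|].
    replace (S (S n)) with (2 + n)%nat by lia; rewrite psum_shift.
    rewrite (psum_zero _ z n); [|intros k Hk; apply Ak; lia].
    simpl; rewrite A0, A1; ring.
  - apply cv_plus; [apply cv_const | apply cv_scal; auto].
Qed.

Lemma factor_class_A n f U : (1 <= n)%nat -> has_factor n f U -> class_A n f.
Proof.
  intros Hn [HU Ef]; split.
  - apply hol_analytic, hol_ext with (fun z => z ^ 1 * (1 + z ^ n * U z))%C.
    + intros z Hz; rewrite Cpow_1_r; symmetry; auto.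
    + now apply hol_monom, hol_factor.
  - destruct HU as [b Hb].
    set (a := fun k => if Nat.ltb n k then b (k - S n)%nat
                       else if Nat.eqb k 1 then RtoC 1 else RtoC 0).
    assert (Lo : forall k, (k <= n)%nat -> a k = if Nat.eqb k 1 then RtoC 1 else RtoC 0).
    { intros k Hk; unfold a; replace (Nat.ltb n k) with false; auto.
      symmetry; apply Nat.ltb_ge; lia. }
    exists a; split; [|split; [|split]].
    + rewrite Lo by lia; reflexivity.
    + rewrite Lo by lia; reflexivity.
    + intros k Hk; rewrite Lo by lia.
      replace (Nat.eqb k 1) with false; auto; symmetry; apply Nat.eqb_neq; lia.
    + intros z Hz; apply is_pseries_cv; rewrite Ef by auto.
      rewrite <- (cv_shift _ _ (S n)).
      replace (z * (1 + z ^ n * U z))%C with (z + z ^ S n * U z)%C by (rewrite Cpow_S; ring).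
      apply cv_ext with (fun m => z + z ^ S n * psum b z m)%C.
      * intros m; rewrite psum_shift; f_equal.
        -- destruct n as [|n]; [lia|].
           replace (S (S n)) with (2 + n)%nat by lia; rewrite psum_shift.
           rewrite (psum_zero _ z n).
           ++ simpl psum; rewrite !Lo by lia; simpl; ring.
           ++ intros k Hk; rewrite Lo by lia; reflexivity.
        -- f_equal; apply psum_ext; intros k; unfold a.
           replace (Nat.ltb n (S n + k)) with true by (symmetry; apply Nat.ltb_lt; lia).
           f_equal; lia.
      * apply cv_plus; [apply cv_const | apply cv_scal; now apply is_pseries_cv, Hb].
Qed.

Lemma has_factor_1 n f U : (1 <= n)%nat -> has_factor n f U ->
  has_factor 1 f (fun z => z ^ (n - 1) * U z)%C.
Proof.
  intros Hn [HU E]; split; [now apply hol_monom|].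
  intros z Hz; rewrite E by auto; destruct n as [|n]; [lia|].
  replace (S n - 1)%nat with n by lia; rewrite Cpow_S, Cpow_1_r; ring.
Qed.

Lemma in_disc_dilate r z : 0 <= r <= 1 -> in_disc z -> in_disc (RtoC r * z)%C.
Proof.
  unfold in_disc; intros Hr Hz; rewrite Cmod_mult, Cmod_R, Rabs_pos_eq by lra.
  pose proof (Cmod_ge_0 z); nra.
Qed.

Lemma has_factor_dilate n f U r : 0 < r <= 1 -> has_factor n f U ->
  has_factor n (fun z => / RtoC r * f (RtoC r * z))%C (fun z => RtoC r ^ n * U (RtoC r * z))%C.
Proof.
  intros Hr [HU E]; split.
  - apply hol_scal, hol_dilate; auto; lra.
  - intros z Hz; rewrite E by (apply in_disc_dilate; auto; lra).
    rewrite Cpow_mult_l; field; intros H; apply RtoC_inj in H; lra.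
Qed.

(* For [f = z u] the quantity [z f'/f - 1] at [r z] is the logarithmic derivative of [u] there. *)
Lemma quot_dilate n f U r z l : 0 < r <= 1 -> has_factor n f U -> in_disc z ->
  has_der (fun z => 1 + z ^ n * U z)%C (RtoC r * z)%C l ->
  (1 + (RtoC r * z) ^ n * U (RtoC r * z) <> 0)%C ->
  let fr := (fun z => / RtoC r * f (RtoC r * z))%C in
  quot (fun z => z * C_derive fr z)%C fr z
  = (1 + RtoC r * z * l / (1 + (RtoC r * z) ^ n * U (RtoC r * z)))%C.
Proof.
  intros Hr [HU E] Hz D N fr; unfold quot; destruct (Ceq_dec z 0) as [->|Nz].
  { rewrite Cmult_0_r in *; field; auto. }
  assert (Nr : RtoC r <> 0%C) by (intros H; apply RtoC_inj in H; lra).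
  set (u := fun z => (1 + z ^ n * U z)%C) in *.
  assert (Ef : forall z, in_disc z -> fr z = (z * u (RtoC r * z))%C).
  { intros y Hy; unfold fr, u; rewrite E by (apply in_disc_dilate; auto; lra); field; auto. }
  assert (Dr : has_der (fun z => RtoC r * z)%C z (0 * z + RtoC r * 1)%C)
    by exact (has_der_mult _ _ _ _ _ (has_der_const (RtoC r) z) (has_der_id z)).
  pose proof (has_der_mult _ _ _ _ _ (has_der_id z)
    (has_der_comp u (fun z => RtoC r * z)%C z _ _ D Dr)) as Df; cbv beta in Df.
  rewrite (has_der_C_derive fr z (1 * u (RtoC r * z) + z * (l * (0 * z + RtoC r * 1)))%C).
  - rewrite Ef by auto; fold (u (RtoC r * z)%C) in N |- *; field; auto.
  - eapply has_der_ext, Df; eapply near_mono, (near_disc z 1 Hz); simpl; intros; symmetry; auto.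
Qed.

(** * Criteria for membership in [Sstar_rho_n] and the radius *)

(** The upper bound 1, below [PI / 2], keeps the disc of radius [asinh 1] inside the strip where
    [Casinh] inverts [Csinh]. *)
Lemma arcsinh_1_bounds : 0 < arcsinh 1 <= 1.
Proof.
  pose proof (arcsinh_lt 0 1 Rlt_0_1) as H; rewrite arcsinh_0 in H.
  pose proof (sinh_ge_id (arcsinh 1) ltac:(lra)) as K; rewrite sinh_arcsinh in K; lra.
Qed.

Lemma analytic_of_has_der f : (forall z, in_disc z -> exists l, has_der f z l) -> analytic_disc f.
Proof. intros H z Hz; destruct (H z Hz) as [l D]; exists l; now apply has_der_is_derive. Qed.

(* The disc of radius [asinh 1] about 1 lies in the image of [1 + asinh]. *)
Lemma Sstar_rho_of_bound n f U r : (1 <= n)%nat -> 0 < r <= 1 -> has_factor n f U ->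
  (forall z, in_disc z -> (1 + z ^ n * U z)%C <> 0%C) ->
  (forall z l, in_disc z -> has_der (fun z => 1 + z ^ n * U z)%C (RtoC r * z)%C l ->
     Cmod (RtoC r * z * l / (1 + (RtoC r * z) ^ n * U (RtoC r * z)%C)) <= Cmod z * arcsinh 1) ->
  Sstar_rho_n n (fun z => / RtoC r * f (RtoC r * z))%C.
Proof.
  intros Hn Hr HF N B.
  pose proof (has_factor_dilate n f U r Hr HF) as HFr.
  split; [eapply factor_class_A; eauto | split].
  { eapply factor_class_A; [lia | eapply has_factor_1; eauto]. }
  pose proof (hol_factor n U (proj1 HF)) as Hu.
  set (u := fun z => (1 + z ^ n * U z)%C) in *.
  destruct (hol_der u Hu) as [u1 [Hu1 D]].
  assert (Rz : forall z, in_disc z -> in_disc (RtoC r * z)%C)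
    by (intros; apply in_disc_dilate; auto; lra).
  set (q := fun z => (RtoC r * z * u1 (RtoC r * z) / u (RtoC r * z))%C).
  assert (Bq : forall z, in_disc z -> Cmod (q z) <= Cmod z * arcsinh 1).
  { intros z Hz; apply (B z (u1 (RtoC r * z)%C)); auto; apply D; auto. }
  assert (Dq : forall z, in_disc z -> exists l, has_der q z l).
  { assert (H1 : hol (fun z => RtoC r * z * u1 (RtoC r * z))%C).
    { apply hol_ext with (fun z => RtoC r * (z ^ 1 * u1 (RtoC r * z)))%C.
      - intros; rewrite Cpow_1_r; ring.
      - apply hol_scal, hol_monom, hol_dilate; auto; lra. }
    assert (H2 : hol (fun z => u (RtoC r * z))%C) by (apply hol_dilate; auto; lra).
    destruct (hol_der _ H1) as [d1 [_ D1]]; destruct (hol_der _ H2) as [d2 [_ D2]].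
    intros z Hz; eexists; apply has_der_div; [apply D1; auto | apply D2; auto | apply N; auto]. }
  assert (Eq : forall z, in_disc z -> (quot (fun z => z * C_derive
     (fun z => / RtoC r * f (RtoC r * z)) z) (fun z => / RtoC r * f (RtoC r * z)) z = 1 + q z)%C).
  { intros z Hz; unfold q; apply (quot_dilate n f U); auto; apply N; auto. }
  pose proof arcsinh_1_bounds as S; pose proof PI2_1 as P.
  split; [|split].
  - apply analytic_of_has_der; intros z Hz; destruct (Dq z Hz) as [l Dl].
    eexists; eapply has_der_ext, (has_der_plus _ _ _ _ _ (has_der_const 1 z) Dl).
    eapply near_mono, (near_disc z 1 Hz); simpl; intros; symmetry; apply Eq; auto.
  - apply analytic_of_has_der; intros z Hz.
    eexists; apply (has_der_plus (fun _ => RtoC 1)); [apply has_der_const | now apply has_der_Casinh].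
  - exists (fun z => Csinh (q z)); repeat split.
    + apply analytic_of_has_der; intros z Hz; destruct (Dq z Hz) as [l Dl].
      eexists; apply has_der_comp; [apply has_der_Csinh | exact Dl].
    + unfold q; rewrite Cmult_0_r, Cmult_0_l; unfold Cdiv; rewrite Cmult_0_l, Csinh_RtoC, sinh_0; auto.
    + intros z Hz; specialize (Bq z Hz); unfold in_disc in Hz; pose proof (Cmod_ge_0 z).
      eapply Rle_trans; [apply Cmod_Csinh_le|].
      apply Rle_trans with (sinh (Cmod z * arcsinh 1)).
      * destruct (Rle_lt_or_eq_dec _ _ Bq) as [L| ->]; [left; now apply sinh_lt | lra].
      * eapply Rle_trans; [apply sinh_scale; lra | rewrite sinh_arcsinh; lra].
    + intros z Hz; rewrite Eq, Casinh_Csinh; auto.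
      specialize (Bq z Hz); unfold in_disc in Hz; pose proof (Rabs_Im_le (q z)) as I.
      pose proof (Cmod_ge_0 z); assert (Cmod z * arcsinh 1 < 1) by nra.
      assert (X : Rabs (Im (q z)) < PI / 2) by lra; apply Rabs_lt_between in X; lra.
Qed.

(** Applying [Csinh] to [q = Casinh (w z)] recovers [w z], whose modulus is at most [|z|] by
    subordination. *)
Lemma Sstar_rho_necessary n f U r z l : 0 < r <= 1 -> has_factor n f U -> in_disc z ->
  Sstar_rho (fun z => / RtoC r * f (RtoC r * z))%C ->
  has_der (fun z => 1 + z ^ n * U z)%C (RtoC r * z)%C l ->
  (1 + (RtoC r * z) ^ n * U (RtoC r * z) <> 0)%C ->
  Cmod (Csinh (RtoC r * z * l / (1 + (RtoC r * z) ^ n * U (RtoC r * z)%C))) <= Cmod z.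
Proof.
  intros Hr HF Hz [_ [_ [_ [w [_ [_ [Bw Ew]]]]]]] D N.
  specialize (Ew z Hz); rewrite (quot_dilate n f U r z l) in Ew by auto.
  set (q := (RtoC r * z * l / _)%C) in *.
  assert (E : q = Casinh (w z)).
  { transitivity (1 + q - 1)%C; [ring | rewrite Ew; ring]. }
  rewrite E, Csinh_Casinh; auto.
Qed.

(** The function [(a y + b y^2) / (1 - y^2)] grows at least linearly from 0 and equals [s] at [x],
    so at [y <= t x] it is at most [t s]. With [t = |z|] this is the factor [|z|] that subordination
    requires. *)
Lemma bound_scale Q y t x a b s : 0 <= y <= x * t -> 0 <= t <= 1 -> 0 < x < 1 -> 0 <= a -> 0 <= b ->
  a * x + b * x ^ 2 = s * (1 - x ^ 2) -> 0 <= Q ->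
  Q * (1 - y ^ 2) <= a * y + b * y ^ 2 -> Q <= t * s.
Proof.
  intros Hy Ht Hx Ha Hb E HQ H.
  assert (Y : y <= x) by nra.
  assert (Y2 : y ^ 2 <= t * x ^ 2).
  { apply Rle_trans with (x * y); [simpl; nra | simpl; nra]. }
  assert (Y3 : y ^ 2 <= x ^ 2) by (apply pow_incr; lra).
  assert (X2 : x ^ 2 < 1) by (simpl; nra).
  apply Rmult_le_reg_r with (1 - x ^ 2); [lra|].
  apply Rle_trans with (Q * (1 - y ^ 2)); [apply Rmult_le_compat_l; lra|].
  eapply Rle_trans; [exact H|].
  rewrite Rmult_assoc, <- E; rewrite Rmult_plus_distr_l.
  apply Rplus_le_compat.
  - replace (t * (a * x)) with (a * (x * t)) by ring; apply Rmult_le_compat_l; lra.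
  - replace (t * (b * x ^ 2)) with (b * (t * x ^ 2)) by ring; apply Rmult_le_compat_l; lra.
Qed.

Lemma Rpower_root x n : 0 < x < 1 -> (1 <= n)%nat ->
  0 < Rpower x (/ INR n) < 1 /\ Rpower x (/ INR n) ^ n = x.
Proof.
  intros Hx Hn; assert (Np : 0 < INR n) by (apply lt_0_INR; lia).
  assert (P : 0 < Rpower x (/ INR n)) by apply exp_pos.
  assert (E : Rpower x (/ INR n) ^ n = x).
  { rewrite <- Rpower_pow, Rpower_mult, Rinv_l, Rpower_1; lra. }
  split; [split|]; auto; apply Rnot_le_lt; intros L.
  pose proof (pow_R1_Rle _ n L); lra.
Qed.

(** [x] is the value of [|z|^n] at which the bound reaches [asinh 1]. The second group of hypotheses
    describes an extremal function as [z g(z^n)], with [y] the direction on the unit circle in which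
    the bound is attained; there [z u'/u] becomes [n w g'(w) / g(w)] at [w = x y^n]. *)
Lemma is_radius_of_sharp_bound n (G : (C -> C) -> Prop) a b x : (1 <= n)%nat ->
  0 <= a -> 0 <= b -> 0 < x < 1 -> a * x + b * x ^ 2 = arcsinh 1 * (1 - x ^ 2) ->
  (forall f, G f -> exists U, has_factor n f U /\
     (forall z, in_disc z -> (1 + z ^ n * U z)%C <> 0%C) /\
     forall z l, in_disc z -> has_der (fun z => 1 + z ^ n * U z)%C z l ->
     Cmod (z * l / (1 + z ^ n * U z)) * (1 - (Cmod z ^ n) ^ 2)
     <= a * Cmod z ^ n + b * (Cmod z ^ n) ^ 2) ->
  (exists f U y g g', G f /\ has_factor n f U /\ Cmod y = 1 /\
     (forall z, in_disc z -> (1 + z ^ n * U z = g (z ^ n))%C) /\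
     has_der g (RtoC x * y ^ n)%C g' /\ g (RtoC x * y ^ n)%C <> 0%C /\
     Cmod (Csinh (INR n * (RtoC x * y ^ n) * g' / g (RtoC x * y ^ n)%C)) = 1) ->
  is_radius (Sstar_rho_n n) G (Rpower x (/ INR n)).
Proof.
  intros Hn Ha Hb Hx E Up [f [U [y [g [g' [Gf [HF [Hy [Eu [Dg [Ng Sh]]]]]]]]]]].
  destruct (Rpower_root x n Hx Hn) as [Hrho Erho]; set (rho := Rpower x (/ INR n)) in *.
  split; [split; [lra|]|].
  - clear f U HF Eu Gf; intros f Gf r Hr; destruct (Up f Gf) as [U [HF [N B]]].
    apply (Sstar_rho_of_bound n f U); auto; [lra|]; intros z l Hz D.
    assert (Rz : in_disc (RtoC r * z)%C) by (apply in_disc_dilate; auto; lra).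
    specialize (B _ l Rz D); unfold in_disc in Hz; pose proof (Cmod_ge_0 z) as Z0.
    apply (bound_scale _ (Cmod (RtoC r * z) ^ n) _ x a b); auto; try lra; [|apply Cmod_ge_0].
    split; [apply pow_le, Cmod_ge_0|].
    rewrite Cmod_mult, Cmod_R, Rabs_pos_eq, Rpow_mult_distr, <- Erho by lra.
    apply Rmult_le_compat; try apply pow_le; try lra; [apply pow_incr; lra|].
    destruct n as [|m]; [lia|]; simpl.
    assert (Cmod z ^ m <= 1) by (rewrite <- (pow1 m); apply pow_incr; lra).
    pose proof (pow_le _ m Z0); nra.
  - intros r1 [Hr1 A]; apply Rnot_lt_le; intros L.
    specialize (A f Gf r1 ltac:(lra)).
    (* For [r1 > rho] the dilation by [r1] sends this point to [rho y], where [|sinh|] equals 1;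
       [Sstar_rho_necessary] would bound it by [|z| = rho / r1 < 1]. *)
    set (z := (RtoC (rho / r1) * y)%C).
    assert (Hq : 0 < rho / r1 < 1).
    { split; [apply Rdiv_lt_0_compat; lra|]; apply Rmult_lt_reg_r with r1; [lra|].
      unfold Rdiv; rewrite Rmult_assoc, Rinv_l; lra. }
    assert (Cz : Cmod z = rho / r1).
    { unfold z; rewrite Cmod_mult, Hy, Cmod_R, Rabs_pos_eq; lra. }
    assert (Hz : in_disc z) by (unfold in_disc; lra).
    assert (Ez : (RtoC r1 * z = RtoC rho * y)%C).
    { unfold z; rewrite RtoC_div by lra; field; intros H; apply RtoC_inj in H; lra. }
    assert (Hrz : in_disc (RtoC rho * y)%C).
    { unfold in_disc; rewrite Cmod_mult, Hy, Cmod_R, Rabs_pos_eq; lra. }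
    assert (Ey : ((RtoC rho * y) ^ n = RtoC x * y ^ n)%C).
    { rewrite Cpow_mult_l, <- RtoC_pow, Erho; auto. }
    destruct (has_der_pow_mult n (fun _ => RtoC 1) (RtoC rho * y)%C 0 Hn (has_der_const 1 _))
      as [m [Dm Em]].
    assert (D : has_der (fun z => 1 + z ^ n * U z)%C (RtoC r1 * z)%C (g' * m)%C).
    { rewrite Ez; eapply has_der_ext, (has_der_comp g (fun z => z ^ n * 1)%C).
      - eapply near_mono, (near_disc _ 1 Hrz); simpl; intros c Hc.
        rewrite Eu by auto; f_equal; ring.
      - rewrite Cmult_1_r, Ey; auto.
      - exact Dm. }
    assert (K : (1 + (RtoC r1 * z) ^ n * U (RtoC r1 * z) = g (RtoC x * y ^ n))%C).
    { rewrite Ez, Eu, Ey; auto. }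
    pose proof (Sstar_rho_necessary n f U r1 z _ ltac:(lra) HF Hz (proj2 A) D) as B.
    rewrite K in B; specialize (B Ng).
    replace (RtoC r1 * z * (g' * m))%C with (INR n * (RtoC x * y ^ n) * g')%C in B.
    + lra.
    + rewrite Ez; transitivity (g' * (RtoC rho * y * m))%C; [rewrite Em, Ey|]; ring.
Qed.

(** * Upper bounds *)

Lemma factor_at_0 n (U : C -> C) : (1 <= n)%nat -> (1 + 0 ^ n * U 0 = 1)%C.
Proof. intros Hn; destruct n; [lia|]; rewrite Cpow_S; ring. Qed.

Lemma quot_factor n f g U V z : (1 <= n)%nat -> has_factor n f U -> has_factor n g V ->
  in_disc z -> quot f g z = ((1 + z ^ n * U z) / (1 + z ^ n * V z))%C.
Proof.
  intros Hn [_ F] [_ G] Hz; unfold quot; destruct (Ceq_dec z 0) as [->|N].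
  - rewrite !factor_at_0 by auto; field; apply C1_nz.
  - rewrite F, G by auto; unfold Cdiv.
    (* At a zero of the denominator both sides are 0, the default value of division by 0, so the
       identity holds before [g] is known to be nonzero. *)
    destruct (Ceq_dec (1 + z ^ n * V z)%C 0) as [E|N'].
    + rewrite E; apply injective_projections; simpl; unfold Rdiv; ring_simplify;
      rewrite ?Rinv_0; ring.
    + field; auto.
Qed.

Lemma quot_id_factor n g V z : (1 <= n)%nat -> has_factor n g V -> in_disc z ->
  quot g (fun u => u) z = (1 + z ^ n * V z)%C.
Proof.
  intros Hn [_ G] Hz; unfold quot; destruct (Ceq_dec z 0) as [->|N].
  - now rewrite factor_at_0.
  - rewrite G by auto; field; auto.
Qed.

Lemma Re_div_neq0 (u v : C) : Re (u / v)%C <> 0 -> u <> 0%C.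
Proof. intros H ->; apply H; unfold Cdiv; rewrite Cmult_0_l; reflexivity. Qed.

(** A quotient of two factors is again [1 + z^n Q], now with [Q] only in [hjet]; this is the form in
    which the logarithmic derivative bounds accept it. *)
Lemma factor_div n U V : hol U -> hol V -> (forall z, in_disc z -> (1 + z ^ n * V z)%C <> 0%C) ->
  hjet (fun z => (U z - V z) / (1 + z ^ n * V z))%C /\
  forall z, in_disc z -> ((1 + z ^ n * U z) / (1 + z ^ n * V z)
    = 1 + z ^ n * ((U z - V z) / (1 + z ^ n * V z)))%C.
Proof.
  intros HU HV N; split.
  - apply hjet_div; auto.
    + apply hjet_hol, hol_ext with (fun z => U z + (- (1)) * V z)%C; [intros; ring|].
      apply hol_plus; auto; now apply hol_scal.
    + now apply hjet_hol, hol_factor.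
  - intros z Hz; field; auto.
Qed.

Lemma log_derivative_div (z u v u1 v1 : C) : u <> 0%C -> v <> 0%C ->
  (z * ((u1 * v - u * v1) / (v * v)) / (u / v) = z * u1 / u - z * v1 / v)%C.
Proof. intros; field; auto. Qed.

Lemma hol_has_der F z : hol F -> in_disc z -> exists l, has_der F z l.
Proof. intros H Hz; destruct (hol_der F H) as [F' [_ D]]; eauto. Qed.

(** Write [u = (u / v) v], where [v] belongs to [g]. Both factors have positive real part, and with
    [x = |z|^n] each contributes [2 n x] to the numerator. *)
Lemma class_F1_bound n f : (1 <= n)%nat -> class_F1 n f -> exists U, has_factor n f U /\
  (forall z, in_disc z -> (1 + z ^ n * U z)%C <> 0%C) /\
  forall z l, in_disc z -> has_der (fun z => 1 + z ^ n * U z)%C z l ->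
  Cmod (z * l / (1 + z ^ n * U z)) * (1 - (Cmod z ^ n) ^ 2)
  <= 4 * INR n * Cmod z ^ n + 0 * (Cmod z ^ n) ^ 2.
Proof.
  intros Hn [Af [g [Ag H]]].
  destruct (class_A_factor n f Hn Af) as [U HU]; destruct (class_A_factor n g Hn Ag) as [V HV].
  exists U; split; auto.
  assert (Pv : forall z, in_disc z -> 0 < Re (1 + z ^ n * V z)%C).
  { intros z Hz; destruct (H z Hz) as [_ K]; rewrite (quot_id_factor n g V) in K; auto. }
  assert (Ph : forall z, in_disc z -> 0 < Re ((1 + z ^ n * U z) / (1 + z ^ n * V z))%C).
  { intros z Hz; destruct (H z Hz) as [K _]; rewrite (quot_factor n f g U V) in K; auto. }
  assert (Nv : forall z, in_disc z -> (1 + z ^ n * V z)%C <> 0%C)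
    by (intros; apply Re_pos_neq0; auto).
  assert (Nu : forall z, in_disc z -> (1 + z ^ n * U z)%C <> 0%C).
  { intros z Hz; apply (Re_div_neq0 _ (1 + z ^ n * V z)%C), Rgt_not_eq, Ph; auto. }
  split; auto; intros z l Hz D.
  destruct HU as [HU _]; destruct HV as [HV _].
  destruct (hol_has_der _ z (hol_factor n V HV) Hz) as [v1 Dv].
  destruct (factor_div n U V HU HV Nv) as [JQ EQ].
  pose proof (log_derivative_Re_pos n V _ z v1 Hn (hjet_hol _ HV) (fun _ _ => eq_refl) Pv Hz Dv) as B1.
  pose proof (log_derivative_Re_pos n _ _ z _ Hn JQ EQ Ph Hz (has_der_div _ _ _ _ _ D Dv (Nv z Hz))) as B2.
  cbv beta in B2; rewrite log_derivative_div in B2 by auto.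
  set (X := (z * l / (1 + z ^ n * U z))%C) in *; set (Y := (z * v1 / (1 + z ^ n * V z))%C) in *.
  pose proof (Cmod_triangle_sub X Y).
  pose proof (pow_in_0_1 (Cmod z) n (conj (Cmod_ge_0 z) Hz) Hn).
  assert (0 < 1 - (Cmod z ^ n) ^ 2) by (simpl; nra); nra.
Qed.

(** As for [class_F1], but [v] now has real part above 1/2: the contributions are [2 n x] from
    [u / v] and [n x (1 + x)] from [v]. *)
Lemma class_F2_bound n f : (1 <= n)%nat -> class_F2 n f -> exists U, has_factor n f U /\
  (forall z, in_disc z -> (1 + z ^ n * U z)%C <> 0%C) /\
  forall z l, in_disc z -> has_der (fun z => 1 + z ^ n * U z)%C z l ->
  Cmod (z * l / (1 + z ^ n * U z)) * (1 - (Cmod z ^ n) ^ 2)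
  <= 3 * INR n * Cmod z ^ n + INR n * (Cmod z ^ n) ^ 2.
Proof.
  intros Hn [Af [g [Ag H]]].
  destruct (class_A_factor n f Hn Af) as [U HU]; destruct (class_A_factor n g Hn Ag) as [V HV].
  exists U; split; auto.
  assert (Pv : forall z, in_disc z -> 1 / 2 < Re (1 + z ^ n * V z)%C).
  { intros z Hz; destruct (H z Hz) as [_ K]; rewrite (quot_id_factor n g V) in K; auto. }
  assert (Ph : forall z, in_disc z -> 0 < Re ((1 + z ^ n * U z) / (1 + z ^ n * V z))%C).
  { intros z Hz; destruct (H z Hz) as [K _]; rewrite (quot_factor n f g U V) in K; auto. }
  assert (Nv : forall z, in_disc z -> (1 + z ^ n * V z)%C <> 0%C)
    by (intros y Hy; apply Re_pos_neq0; specialize (Pv y Hy); lra).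
  assert (Nu : forall z, in_disc z -> (1 + z ^ n * U z)%C <> 0%C).
  { intros z Hz; apply (Re_div_neq0 _ (1 + z ^ n * V z)%C), Rgt_not_eq, Ph; auto. }
  split; auto; intros z l Hz D.
  destruct HU as [HU _]; destruct HV as [HV _].
  destruct (hol_has_der _ z (hol_factor n V HV) Hz) as [v1 Dv].
  destruct (factor_div n U V HU HV Nv) as [JQ EQ].
  pose proof (log_derivative_Re_gt_half n V _ z v1 Hn (hjet_hol _ HV) (fun _ _ => eq_refl) Pv Hz Dv)
    as B1.
  pose proof (log_derivative_Re_pos n _ _ z _ Hn JQ EQ Ph Hz (has_der_div _ _ _ _ _ D Dv (Nv z Hz))) as B2.
  cbv beta in B2; rewrite log_derivative_div in B2 by auto.
  set (X := (z * l / (1 + z ^ n * U z))%C) in *; set (Y := (z * v1 / (1 + z ^ n * V z))%C) in *.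
  pose proof (Cmod_triangle_sub X Y).
  pose proof (pow_in_0_1 (Cmod z) n (conj (Cmod_ge_0 z) Hz) Hn).
  assert (0 < 1 - (Cmod z ^ n) ^ 2) by (simpl; nra); nra.
Qed.

(** Both [|h - 1| < 1] and, for [h] nonzero, [Re (1 / h) > 1/2] say that [|h|^2 < 2 Re h]. *)
Lemma Re_inv_gt_half (h : C) : Cmod (h - 1) < 1 -> h <> 0%C /\ 1 / 2 < Re (/ h)%C.
Proof.
  intros H.
  assert (N : h <> 0%C).
  { intros ->; replace (0 - 1)%C with (- (1))%C in H by ring; rewrite Cmod_opp, Cmod_1 in H; lra. }
  split; auto.
  assert (H2 : Cmod (h - 1) ^ 2 < 1) by (pose proof (Cmod_ge_0 (h - 1)); simpl; nra).
  apply Cmod_gt_0 in N; assert (N2 : 0 < Cmod h ^ 2) by (apply pow_lt; auto).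
  rewrite Cmod_sqr in *; destruct h as [x y]; simpl in *.
  apply Rmult_lt_reg_r with (x * (x * 1) + y * (y * 1)); auto.
  replace (x / (x * (x * 1) + y * (y * 1)) * (x * (x * 1) + y * (y * 1))) with x by (field; lra).
  nra.
Qed.

(* [|f/g - 1| < 1] means [Re (g/f) > 1/2]. *)
Lemma class_F3_bound n f : (1 <= n)%nat -> class_F3 n f -> exists U, has_factor n f U /\
  (forall z, in_disc z -> (1 + z ^ n * U z)%C <> 0%C) /\
  forall z l, in_disc z -> has_der (fun z => 1 + z ^ n * U z)%C z l ->
  Cmod (z * l / (1 + z ^ n * U z)) * (1 - (Cmod z ^ n) ^ 2)
  <= 3 * INR n * Cmod z ^ n + INR n * (Cmod z ^ n) ^ 2.
Proof.
  intros Hn [Af [g [Ag H]]].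
  destruct (class_A_factor n f Hn Af) as [U HU]; destruct (class_A_factor n g Hn Ag) as [V HV].
  exists U; split; auto.
  assert (Pv : forall z, in_disc z -> 0 < Re (1 + z ^ n * V z)%C).
  { intros z Hz; destruct (H z Hz) as [_ K]; rewrite (quot_id_factor n g V) in K; auto. }
  assert (Nv : forall z, in_disc z -> (1 + z ^ n * V z)%C <> 0%C)
    by (intros; apply Re_pos_neq0; auto).
  assert (Hh : forall z, in_disc z -> ((1 + z ^ n * U z) / (1 + z ^ n * V z))%C <> 0%C /\
    1 / 2 < Re (/ ((1 + z ^ n * U z) / (1 + z ^ n * V z)))%C).
  { intros z Hz; destruct (H z Hz) as [K _]; rewrite (quot_factor n f g U V) in K by auto.
    now apply Re_inv_gt_half. }
  assert (Nu : forall z, in_disc z -> (1 + z ^ n * U z)%C <> 0%C).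
  { intros z Hz E; apply (proj1 (Hh z Hz)); rewrite E; unfold Cdiv; ring. }
  assert (Pk : forall z, in_disc z -> 1 / 2 < Re ((1 + z ^ n * V z) / (1 + z ^ n * U z))%C).
  { intros z Hz; replace ((1 + z ^ n * V z) / (1 + z ^ n * U z))%C
      with (/ ((1 + z ^ n * U z) / (1 + z ^ n * V z)))%C by (field; auto); apply Hh; auto. }
  split; auto; intros z l Hz D.
  destruct HU as [HU _]; destruct HV as [HV _].
  destruct (hol_has_der _ z (hol_factor n V HV) Hz) as [v1 Dv].
  destruct (factor_div n V U HV HU Nu) as [JQ EQ].
  pose proof (log_derivative_Re_pos n V _ z v1 Hn (hjet_hol _ HV) (fun _ _ => eq_refl) Pv Hz Dv) as B1.
  pose proof (log_derivative_Re_gt_half n _ _ z _ Hn JQ EQ Pk Hz (has_der_div _ _ _ _ _ Dv D (Nu z Hz)))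
    as B2.
  cbv beta in B2; rewrite log_derivative_div in B2 by auto.
  set (X := (z * l / (1 + z ^ n * U z))%C) in *; set (Y := (z * v1 / (1 + z ^ n * V z))%C) in *.
  pose proof (Cmod_triangle_sub X Y) as T; rewrite Cmod_minus_sym in T.
  pose proof (pow_in_0_1 (Cmod z) n (conj (Cmod_ge_0 z) Hz) Hn).
  assert (0 < 1 - (Cmod z ^ n) ^ 2) by (simpl; nra); nra.
Qed.

(** * Composition with [z^n] and the geometric series *)

Lemma in_disc_pow n z : (1 <= n)%nat -> in_disc z -> in_disc (z ^ n)%C.
Proof.
  intros Hn Hz; unfold in_disc in *; rewrite Cmod_pow.
  apply pow_in_0_1; auto; split; auto using Cmod_ge_0.
Qed.

Lemma psum_head (a : nat -> C) z n : (1 <= n)%nat ->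
  (forall k, (0 < k < n)%nat -> a k = RtoC 0) -> psum a z n = a 0%nat.
Proof.
  intros Hn H; destruct n as [|n]; [lia|].
  change (S n) with (1 + n)%nat; rewrite psum_shift, (psum_zero _ z n).
  - simpl; ring.
  - intros k Hk; apply H; lia.
Qed.

(** The coefficients are spread out to the multiples of [n]. Partial sums agree only along these
    multiples, so convergence of the whole series comes from [disc_coeffs] and its limit from the
    subsequence. *)
Lemma hol_comp_pow n F : (1 <= n)%nat -> hol F -> hol (fun z => F (z ^ n)%C).
Proof.
  intros Hn HF; apply hol_coeffs in HF; destruct HF as [a [Da Fa]].
  set (c := fun k => if Nat.eqb (k mod n) 0 then a (k / n)%nat else RtoC 0).
  assert (Dc : disc_coeffs c).
  { intros s Hs; destruct (Da (s ^ n)) as [M HM].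
    { split; [apply pow_lt; lra | apply pow_in_0_1; auto; lra]. }
    exists M; intros k; unfold c; destruct (Nat.eqb (k mod n) 0) eqn:E.
    - apply Nat.eqb_eq in E.
      replace (s ^ k) with ((s ^ n) ^ (k / n)); auto.
      rewrite <- pow_mult; f_equal; symmetry; apply Nat.Div0.div_exact; auto.
    - rewrite Cmod_0, Rmult_0_l; eapply Rle_trans; [|apply (HM 0%nat)].
      simpl; pose proof (Cmod_ge_0 (a 0%nat)); lra. }
  assert (P : forall z m, psum c z (n * m) = psum a (z ^ n)%C m).
  { intros z; induction m; [rewrite Nat.mul_0_r; reflexivity|].
    rewrite Nat.mul_succ_r, psum_shift, IHm, Cpow_mult_r; simpl psum; f_equal.
    rewrite psum_head; auto.
    - unfold c; rewrite Nat.add_0_r, Nat.mul_comm, Nat.Div0.mod_mul, Nat.div_mul by lia.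
      simpl; ring.
    - intros k Hk; unfold c.
      rewrite (Nat.add_comm (n * m)), (Nat.mul_comm n m), Nat.Div0.mod_add, Nat.mod_small by lia.
      destruct k; [lia | reflexivity]. }
  apply hol_coeffs; exists c; split; auto; intros z Hz.
  destruct (coeffs_cv c z Dc Hz) as [l Hl].
  replace (F (z ^ n)%C) with l; auto.
  apply cv_unique with (psum a (z ^ n)%C); [|apply Fa; now apply in_disc_pow].
  apply cv_ext with (fun m => psum c z (n * m)); [apply P|].
  intros eps He; destruct (Hl eps He) as [N HN]; exists N; intros m Hm; apply HN; nia.
Qed.

Lemma one_minus_neq0 z : in_disc z -> (1 - z)%C <> 0%C.
Proof.
  intros Hz; apply Cmod_neq0; unfold in_disc in Hz; pose proof (one_minus_Cmod_le z); lra.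
Qed.

Lemma has_der_one_plus c : has_der (fun w => 1 + w)%C c 1.
Proof.
  pose proof (has_der_plus _ _ _ _ _ (has_der_const 1 c) (has_der_id c)) as H.
  now rewrite Cplus_0_l in H.
Qed.

Lemma has_der_one_minus c : has_der (fun w => 1 - w)%C c (- (1))%C.
Proof.
  replace (- (1))%C with (0 + (0 * c + (- (1)) * 1))%C by ring.
  eapply has_der_ext, (has_der_plus _ _ _ _ _ (has_der_const 1 c)
    (has_der_mult _ _ _ _ _ (has_der_const (- (1))%C c) (has_der_id c))).
  apply near_all; intros; ring.
Qed.

Lemma hol_geom : hol (fun z => / (1 - z))%C.
Proof.
  assert (D : disc_coeffs (fun _ => RtoC 1)).
  { intros s Hs; exists 1; intros k; rewrite Cmod_1, Rmult_1_l, <- (pow1 k); apply pow_incr; lra. }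
  destruct (hol_of_coeffs _ D) as [F [HF CF]].
  apply hol_ext with F; auto; intros z Hz.
  pose proof (one_minus_neq0 z Hz) as N.
  assert (E : ((1 - z) * F z = 1)%C).
  { apply cv_unique with (fun m => (1 - z) * psum (fun _ => RtoC 1) z (S m))%C.
    - apply cv_scal, (cv_shift (psum (fun _ => RtoC 1) z) (F z) 1); auto.
    - apply cv_ext with (fun m => 1 + - (1) * (1 * z ^ S m))%C.
      + induction n; [simpl psum; rewrite Cpow_1_r; simpl; ring|].
        change (psum (fun _ => RtoC 1) z (S (S n)))
          with (psum (fun _ => RtoC 1) z (S n) + 1 * z ^ S n)%C.
        rewrite Cmult_plus_distr_l, <- IHn, (Cpow_S z (S n)); ring.
      + pose proof (cv_plus _ _ _ _ (cv_const 1)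
          (cv_scal (- (1))%C _ _ (coeffs_pow_to_0 _ z D Hz))) as H.
        now rewrite Cmult_0_r, Cplus_0_r in H. }
  transitivity ((1 - z) * F z * / (1 - z))%C; [field; auto | rewrite E; ring].
Qed.

(** Obtained as the derivative of the geometric series, in place of a product of two series. *)
Lemma hol_geom_sqr : hol (fun z => / ((1 - z) * (1 - z)))%C.
Proof.
  destruct (hol_der _ hol_geom) as [F [HF D]].
  apply hol_ext with F; auto; intros z Hz; pose proof (one_minus_neq0 z Hz) as N.
  rewrite (has_der_unique _ z _ _ (D z Hz) (has_der_inv _ _ _ (has_der_one_minus z) N)).
  field; auto.
Qed.

Lemma Cexp_pow w n : (Cexp w ^ n)%C = Cexp (INR n * w).
Proof.
  induction n.
  - replace (INR 0 * w)%C with (RtoC 0) by (simpl; ring); rewrite Cexp_0; reflexivity.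
  - rewrite Cpow_S, IHn, <- Cexp_plus, S_INR, RtoC_plus; f_equal; ring.
Qed.

Lemma root_of_minus_one n : (1 <= n)%nat -> exists y : C, Cmod y = 1 /\ (y ^ n = - (1))%C.
Proof.
  intros Hn; exists (Cexp (0, PI / INR n)); split.
  - rewrite Cmod_Cexp; apply exp_0.
  - rewrite Cexp_pow; unfold Cexp; simpl.
    replace (INR n * 0 - 0 * (PI / INR n)) with 0 by ring.
    replace (INR n * (PI / INR n) + 0 * 0) with PI.
    + rewrite exp_0, cos_PI, sin_PI; apply injective_projections; simpl; ring.
    + field; apply not_0_INR; lia.
Qed.

(** * Extremal functions *)

(** Every extremal function divided by [z] depends on [w = z^n] alone; [star] lets it be given once,
    as [1 + w G(w)], for all [n]. *)
Definition star (n : nat) (G : C -> C) (z : C) : C := (z * (1 + z ^ n * G (z ^ n)))%C.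

Lemma star_factor n G : (1 <= n)%nat -> hol G -> has_factor n (star n G) (fun z => G (z ^ n)%C).
Proof. intros Hn HG; split; [now apply hol_comp_pow | reflexivity]. Qed.

Lemma quot_star n G H z : (1 <= n)%nat -> hol G -> hol H -> in_disc z ->
  quot (star n G) (star n H) z = ((1 + z ^ n * G (z ^ n)) / (1 + z ^ n * H (z ^ n)))%C.
Proof.
  intros Hn HG HH Hz.
  apply (quot_factor n _ _ (fun z => G (z ^ n)%C) (fun z => H (z ^ n)%C)); auto; now apply star_factor.
Qed.

Lemma quot_id_star n G z : (1 <= n)%nat -> hol G -> in_disc z ->
  quot (star n G) (fun u => u) z = (1 + z ^ n * G (z ^ n))%C.
Proof.
  intros Hn HG Hz.
  apply (quot_id_factor n _ (fun z => G (z ^ n)%C)); auto; now apply star_factor.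
Qed.

Lemma star_class_A n G : (1 <= n)%nat -> hol G -> class_A n (star n G).
Proof. intros; eapply factor_class_A, star_factor; auto. Qed.

Lemma Re_Cayley_pos w : in_disc w -> 0 < Re ((1 + w) / (1 - w))%C.
Proof.
  intros Hw; pose proof (one_minus_neq0 w Hw) as N; unfold in_disc in Hw.
  pose proof (Cmod_ge_0 w); assert (W : Cmod w ^ 2 < 1) by (simpl; nra).
  apply Cmod_gt_0 in N; assert (N2 : 0 < Cmod (1 - w) ^ 2) by (apply pow_lt; auto).
  rewrite Cmod_sqr in *; destruct w as [x y]; simpl in *.
  match goal with |- 0 < ?e => replace e with ((1 - (x * (x * 1) + y * (y * 1))) /
    ((1 + - x) * ((1 + - x) * 1) + (0 + - y) * ((0 + - y) * 1))) end.
  - apply Rdiv_lt_0_compat; lra.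
  - field; lra.
Qed.

Lemma Re_inv_one_minus w : in_disc w -> 1 / 2 < Re (/ (1 - w))%C.
Proof.
  intros Hw; apply Re_inv_gt_half; replace (1 - w - 1)%C with (- w)%C by ring.
  now rewrite Cmod_opp.
Qed.

Lemma Cayley_hol : hol (fun w => 2 * / (1 - w))%C.
Proof. apply hol_scal, hol_geom. Qed.

(** The three series solve [1 + w G(w) = h(w)] for [h] equal to [(1 + w)^2 / (1 - w)^2],
    [(1 + w) / (1 - w)^2] and [(1 + w)^2 / (1 - w)]. The exponent in [w ^ 1] matches [hol_monom]. *)
Definition extremal_F1 (n : nat) := star n (fun w => 4 * / ((1 - w) * (1 - w)))%C.
Definition extremal_F2 (n : nat) :=
  star n (fun w => 3 * / ((1 - w) * (1 - w)) + - (1) * (w ^ 1 * / ((1 - w) * (1 - w))))%C.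
Definition extremal_F3 (n : nat) := star n (fun w => 3 * / (1 - w) + w ^ 1 * / (1 - w))%C.

Lemma extremal_F1_hol : hol (fun w => 4 * / ((1 - w) * (1 - w)))%C.
Proof. apply hol_scal, hol_geom_sqr. Qed.

Lemma extremal_F2_hol :
  hol (fun w => 3 * / ((1 - w) * (1 - w)) + - (1) * (w ^ 1 * / ((1 - w) * (1 - w))))%C.
Proof. apply hol_plus; apply hol_scal; [|apply hol_monom]; apply hol_geom_sqr. Qed.

Lemma extremal_F3_hol : hol (fun w => 3 * / (1 - w) + w ^ 1 * / (1 - w))%C.
Proof. apply hol_plus; [apply hol_scal | apply hol_monom]; apply hol_geom. Qed.

Definition Cayley (w : C) : C := ((1 + w) / (1 - w))%C.

Lemma Cayley_factor w : in_disc w -> (1 + w * (2 * / (1 - w)))%C = Cayley w.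
Proof. intros H; unfold Cayley; field; now apply one_minus_neq0. Qed.

Lemma extremal_F1_factor w : in_disc w ->
  (1 + w * (4 * / ((1 - w) * (1 - w))) = Cayley w * Cayley w)%C.
Proof. intros H; unfold Cayley; field; now apply one_minus_neq0. Qed.

Lemma extremal_F2_factor w : in_disc w ->
  (1 + w * (3 * / ((1 - w) * (1 - w)) + - (1) * (w ^ 1 * / ((1 - w) * (1 - w))))
   = Cayley w * / (1 - w))%C.
Proof. intros H; unfold Cayley; rewrite Cpow_1_r; field; now apply one_minus_neq0. Qed.

Lemma extremal_F3_factor w : in_disc w ->
  (1 + w * (3 * / (1 - w) + w ^ 1 * / (1 - w)) = Cayley w * (1 + w))%C.
Proof. intros H; unfold Cayley; rewrite Cpow_1_r; field; now apply one_minus_neq0. Qed.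

Lemma Cayley_neq0 w : in_disc w -> Cayley w <> 0%C.
Proof. intros H; apply Re_pos_neq0; now apply Re_Cayley_pos. Qed.

Lemma extremal_F1_in n : (1 <= n)%nat -> class_F1 n (extremal_F1 n).
Proof.
  intros Hn; split; [apply star_class_A; auto using extremal_F1_hol|].
  exists (star n (fun w => 2 * / (1 - w))%C); split; [apply star_class_A; auto using Cayley_hol|].
  intros z Hz; pose proof (in_disc_pow n z Hn Hz) as Hw.
  unfold extremal_F1; rewrite quot_star, quot_id_star by auto using extremal_F1_hol, Cayley_hol.
  rewrite extremal_F1_factor, Cayley_factor by auto.
  replace (Cayley (z ^ n) * Cayley (z ^ n) / Cayley (z ^ n))%C with (Cayley (z ^ n))
    by (field; now apply Cayley_neq0).
  split; now apply Re_Cayley_pos.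
Qed.

Lemma extremal_F2_in n : (1 <= n)%nat -> class_F2 n (extremal_F2 n).
Proof.
  intros Hn; split; [apply star_class_A; auto using extremal_F2_hol|].
  exists (star n (fun w => / (1 - w))%C); split; [apply star_class_A; auto using hol_geom|].
  intros z Hz; pose proof (in_disc_pow n z Hn Hz) as Hw; pose proof (one_minus_neq0 _ Hw) as N.
  unfold extremal_F2; rewrite quot_star, quot_id_star by auto using extremal_F2_hol, hol_geom.
  rewrite extremal_F2_factor by auto.
  replace (1 + z ^ n * / (1 - z ^ n))%C with (/ (1 - z ^ n))%C by (field; auto).
  replace (Cayley (z ^ n) * / (1 - z ^ n) / / (1 - z ^ n))%C with (Cayley (z ^ n))
    by (field; auto using C1_nz).
  split; [now apply Re_Cayley_pos | now apply Re_inv_one_minus].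
Qed.

Lemma extremal_F3_in n : (1 <= n)%nat -> class_F3 n (extremal_F3 n).
Proof.
  intros Hn; split; [apply star_class_A; auto using extremal_F3_hol|].
  exists (star n (fun w => 2 * / (1 - w))%C); split; [apply star_class_A; auto using Cayley_hol|].
  intros z Hz; pose proof (in_disc_pow n z Hn Hz) as Hw.
  unfold extremal_F3; rewrite quot_star, quot_id_star by auto using extremal_F3_hol, Cayley_hol.
  rewrite extremal_F3_factor, Cayley_factor by auto.
  replace (Cayley (z ^ n) * (1 + z ^ n) / Cayley (z ^ n) - 1)%C with (z ^ n)%C
    by (field; now apply Cayley_neq0).
  split; [exact Hw | now apply Re_Cayley_pos].
Qed.

Lemma has_der_Cayley c : in_disc c -> has_der Cayley c (2 / ((1 - c) * (1 - c)))%C.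
Proof.
  intros Hc; pose proof (one_minus_neq0 c Hc) as N.
  replace (2 / ((1 - c) * (1 - c)))%C
    with ((1 * (1 - c) - (1 + c) * (- (1))) / ((1 - c) * (1 - c)))%C by (field; auto).
  exact (has_der_div _ _ _ _ _ (has_der_one_plus c) (has_der_one_minus c) N).
Qed.

Lemma Cmod_Csinh_asinh1 t : t = arcsinh 1 \/ t = - arcsinh 1 -> Cmod (Csinh (RtoC t)) = 1.
Proof.
  intros [-> | ->]; rewrite Csinh_RtoC, Cmod_R.
  - rewrite sinh_arcsinh; apply Rabs_R1.
  - replace (sinh (- arcsinh 1)) with (- sinh (arcsinh 1)).
    + rewrite sinh_arcsinh, Rabs_Ropp; apply Rabs_R1.
    + unfold sinh; rewrite Ropp_involutive; field.
Qed.

Lemma in_disc_RtoC x : 0 <= x < 1 -> in_disc (RtoC x).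
Proof. intros H; unfold in_disc; rewrite Cmod_R, Rabs_pos_eq; lra. Qed.

Lemma radius_F1 n x : (1 <= n)%nat -> 0 < x < 1 ->
  4 * INR n * x = arcsinh 1 * (1 - x ^ 2) ->
  is_radius (Sstar_rho_n n) (class_F1 n) (Rpower x (/ INR n)).
Proof.
  intros Hn Hx E; pose proof (pos_INR n) as N0.
  apply is_radius_of_sharp_bound with (4 * INR n) 0; auto; try lra.
  - intros f Hf; now apply class_F1_bound.
  - pose proof (in_disc_RtoC x ltac:(lra)) as Dx.
    pose proof (one_minus_neq0 _ Dx) as N1; pose proof (Cayley_neq0 _ Dx) as N2.
    exists (extremal_F1 n); eexists; exists (RtoC 1), (fun w => Cayley w * Cayley w)%C; eexists.
    split; [now apply extremal_F1_in | split; [apply star_factor; auto using extremal_F1_hol |]].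
    split; [|split; [|split; [|split]]].
    + apply Cmod_1.
    + intros z Hz; apply extremal_F1_factor; now apply in_disc_pow.
    + rewrite Cpow_1_l, Cmult_1_r; apply has_der_mult; now apply has_der_Cayley.
    + rewrite Cpow_1_l, Cmult_1_r; now apply Cmult_neq_0.
    + rewrite Cpow_1_l, Cmult_1_r.
      (* For [g = ((1 + w) / (1 - w))^2] one has [w g'/g = 4 w / (1 - w^2)], so at [w = x] the bound
         is attained with value [asinh 1]. *)
      match goal with |- Cmod (Csinh ?e) = 1 => replace e with (RtoC (arcsinh 1)) end.
      * apply Cmod_Csinh_asinh1; auto.
      * replace (arcsinh 1) with (4 * INR n * x / ((1 - x) * (1 + x)))
          by (rewrite E; field; lra).
        rewrite RtoC_div, !RtoC_mult, RtoC_minus, RtoC_plus by nra.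
        assert (N3 : (1 + RtoC x)%C <> 0%C) by (apply Re_pos_neq0; simpl; lra).
        unfold Cayley; field; auto.
Qed.

Lemma radius_F2 n x : (1 <= n)%nat -> 0 < x < 1 ->
  3 * INR n * x + INR n * x ^ 2 = arcsinh 1 * (1 - x ^ 2) ->
  is_radius (Sstar_rho_n n) (class_F2 n) (Rpower x (/ INR n)).
Proof.
  intros Hn Hx E; pose proof (pos_INR n) as N0.
  apply is_radius_of_sharp_bound with (3 * INR n) (INR n); auto; try lra.
  - intros f Hf; now apply class_F2_bound.
  - pose proof (in_disc_RtoC x ltac:(lra)) as Dx.
    pose proof (one_minus_neq0 _ Dx) as N1; pose proof (Cayley_neq0 _ Dx) as N2.
    exists (extremal_F2 n); eexists; exists (RtoC 1), (fun w => Cayley w * / (1 - w))%C; eexists.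
    split; [now apply extremal_F2_in | split; [apply star_factor; auto using extremal_F2_hol |]].
    split; [|split; [|split; [|split]]].
    + apply Cmod_1.
    + intros z Hz; apply extremal_F2_factor; now apply in_disc_pow.
    + rewrite Cpow_1_l, Cmult_1_r; apply has_der_mult; [now apply has_der_Cayley|].
      apply (has_der_inv (fun w => 1 - w)%C); [apply has_der_one_minus | auto].
    + rewrite Cpow_1_l, Cmult_1_r; apply Cmult_neq_0; auto.
      intros H; apply (C1_nz); rewrite <- (Cinv_r _ N1), H; ring.
    + rewrite Cpow_1_l, Cmult_1_r.
      (* Here [w g'/g = (3 w + w^2) / (1 - w^2)], which attains the bound at [w = x]. *)
      match goal with |- Cmod (Csinh ?e) = 1 => replace e with (RtoC (arcsinh 1)) end.
      * apply Cmod_Csinh_asinh1; auto.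
      * replace (arcsinh 1) with ((3 * INR n * x + INR n * (x * x)) / ((1 - x) * (1 + x)))
          by (replace (3 * INR n * x + INR n * (x * x)) with (3 * INR n * x + INR n * x ^ 2) by ring;
              rewrite E; field; lra).
        rewrite RtoC_div, RtoC_plus, !RtoC_mult, RtoC_minus, RtoC_plus by nra.
        assert (N3 : (1 + RtoC x)%C <> 0%C) by (apply Re_pos_neq0; simpl; lra).
        unfold Cayley; field; auto.
Qed.

(** For [(1 + w)^2 / (1 - w)] the quantity [w g'/g] is [(3 w - w^2) / (1 - w^2)]. It stays below the
    bound at [w = x] and attains it in modulus at [w = -x], with value [- asinh 1] after
    multiplication by [n]; hence the direction [y] with [y^n = -1]. *)
Lemma radius_F3 n x : (1 <= n)%nat -> 0 < x < 1 ->
  3 * INR n * x + INR n * x ^ 2 = arcsinh 1 * (1 - x ^ 2) ->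
  is_radius (Sstar_rho_n n) (class_F3 n) (Rpower x (/ INR n)).
Proof.
  intros Hn Hx E; pose proof (pos_INR n) as N0.
  apply is_radius_of_sharp_bound with (3 * INR n) (INR n); auto; try lra.
  - intros f Hf; now apply class_F3_bound.
  - destruct (root_of_minus_one n Hn) as [y [Cy Ey]].
    assert (Dx : in_disc (RtoC x * - (1))%C).
    { unfold in_disc; rewrite Cmod_mult, Cmod_opp, Cmod_1, Cmod_R, Rabs_pos_eq; lra. }
    pose proof (one_minus_neq0 _ Dx) as N1; pose proof (Cayley_neq0 _ Dx) as N2.
    assert (N3 : (1 - RtoC x)%C <> 0%C) by (apply Re_pos_neq0; simpl; lra).
    assert (N4 : (1 + RtoC x)%C <> 0%C) by (apply Re_pos_neq0; simpl; lra).
    exists (extremal_F3 n); eexists; exists y, (fun w => Cayley w * (1 + w))%C; eexists.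
    rewrite Ey.
    split; [now apply extremal_F3_in | split; [apply star_factor; auto using extremal_F3_hol |]].
    split; [|split; [|split; [|split]]].
    + exact Cy.
    + intros z Hz; apply extremal_F3_factor; now apply in_disc_pow.
    + apply has_der_mult; [now apply has_der_Cayley | apply has_der_one_plus].
    + apply Cmult_neq_0; auto.
      replace (1 + RtoC x * - (1))%C with (1 - RtoC x)%C by ring; auto.
    + match goal with |- Cmod (Csinh ?e) = 1 => replace e with (RtoC (- arcsinh 1)) end.
      * apply Cmod_Csinh_asinh1; auto.
      * replace (arcsinh 1) with ((3 * INR n * x + INR n * (x * x)) / ((1 - x) * (1 + x)))
          by (replace (3 * INR n * x + INR n * (x * x)) with (3 * INR n * x + INR n * x ^ 2) by ring;
              rewrite E; field; lra).
        rewrite RtoC_opp, RtoC_div, RtoC_plus, !RtoC_mult, RtoC_minus, RtoC_plus by nra.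
        unfold Cayley.
        replace (1 + RtoC x * - (1))%C with (1 - RtoC x)%C by ring.
        replace (1 - RtoC x * - (1))%C with (1 + RtoC x)%C by ring.
        field; auto.
Qed.

(** * The quadratic equations for the radii *)

(** The condition [s <= a] places the positive root below 1, because [a x^2 + b x > s] as soon as
    [x >= 1]. *)
Lemma quadratic_root a b s : 0 < s -> 0 < b -> s <= a ->
  let x := (sqrt (b ^ 2 + 4 * a * s) - b) / (2 * a) in
  0 < x < 1 /\ a * x ^ 2 + b * x = s.
Proof.
  intros Hs Hb Ha x.
  assert (P : 0 < a * s) by (apply Rmult_lt_0_compat; lra).
  assert (D : 0 <= b ^ 2 + 4 * a * s) by (pose proof (pow2_ge_0 b); lra).
  pose proof (sqrt_sqrt _ D) as Q; pose proof (sqrt_pos (b ^ 2 + 4 * a * s)) as Q0.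
  assert (E : a * x ^ 2 + b * x = s).
  { unfold x; set (q := sqrt _) in *.
    transitivity ((q * q - b ^ 2) / (4 * a)); [simpl; field; lra | rewrite Q; field; lra]. }
  assert (X : 0 < x).
  { unfold x; apply Rdiv_lt_0_compat; [|lra]; set (q := sqrt _) in *; simpl in *; nra. }
  split; auto; split; auto.
  apply Rnot_le_lt; intros L; clearbody x.
  assert (a * 1 <= a * x ^ 2) by (apply Rmult_le_compat_l; [lra | simpl; nra]).
  assert (0 < b * x) by (apply Rmult_lt_0_compat; lra); lra.
Qed.

Theorem theorem4p7 (n : nat) (hn : (1 <= n)%nat) :
  let s := arcsinh 1 in
  let N := INR n in
  let R1 := Rpower ((sqrt (4 * N ^ 2 + s ^ 2) - 2 * N) / s) (/ N) in
  let R2 := Rpower ((sqrt (9 * N ^ 2 + 4 * s * (N + s)) - 3 * N)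
                    / (2 * (N + s))) (/ N) in
  is_radius (Sstar_rho_n n) (class_F1 n) R1 /\
  is_radius (Sstar_rho_n n) (class_F2 n) R2 /\
  is_radius (Sstar_rho_n n) (class_F3 n) R2.
Proof.
  intros s N R1 R2.
  pose proof arcsinh_1_bounds as S; fold s in S.
  assert (Np : 0 < N) by (apply lt_0_INR; lia).
  split; [|split].
  (* The equation [4 N x = s (1 - x^2)] is [s x^2 + 4 N x = s]; the stated root has a common factor
     2 cancelled, which [Q] restores. *)
  - destruct (quadratic_root s (4 * N) s) as [X E]; try lra.
    assert (Q : (sqrt (4 * N ^ 2 + s ^ 2) - 2 * N) / s
      = (sqrt ((4 * N) ^ 2 + 4 * s * s) - 4 * N) / (2 * s)).
    { replace ((4 * N) ^ 2 + 4 * s * s) with (Rsqr 2 * (4 * N ^ 2 + s ^ 2))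
        by (unfold Rsqr; simpl; ring).
      rewrite sqrt_mult_alt, sqrt_Rsqr by (try apply Rle_0_sqr; lra); field; lra. }
    unfold R1; rewrite Q; set (x := _ / (2 * s)) in *; clearbody x.
    apply radius_F1; auto; fold s N; lra.
  (* The equation [3 N x + N x^2 = s (1 - x^2)] is [(N + s) x^2 + 3 N x = s]. *)
  - destruct (quadratic_root (N + s) (3 * N) s) as [X E]; try lra.
    assert (Q : 9 * N ^ 2 + 4 * s * (N + s) = (3 * N) ^ 2 + 4 * (N + s) * s) by (simpl; ring).
    unfold R2; rewrite Q; set (x := _ / (2 * (N + s))) in *; clearbody x.
    apply radius_F2; auto; fold s N; lra.
  - destruct (quadratic_root (N + s) (3 * N) s) as [X E]; try lra.
    assert (Q : 9 * N ^ 2 + 4 * s * (N + s) = (3 * N) ^ 2 + 4 * (N + s) * s) by (simpl; ring).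
    unfold R2; rewrite Q; set (x := _ / (2 * (N + s))) in *; clearbody x.
    apply radius_F3; auto; fold s N; lra.
Qed.
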